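(* (a) For every complex $t$ with $|t|\le 1$ and $t\ne 1$, $$S^L_{-1/2}(t):=2\sum_{k=1}^\infty\binom{2k}{k}^2\Big(\frac{t}{2^4}\Big)^k(2H_{2k}-H_k)=-P_{-1/2}(1-2t)\log(1-t),$$ $$S^L_{-1/3}(t):=\sum_{k=1}^\infty\binom{2k}{k}\binom{3k}{k}\Big(\frac{t}{3^3}\Big)^k(3H_{3k}-H_k)=-P_{-1/3}(1-2t)\log(1-t),$$ $$S^L_{-1/4}(t):=2\sum_{k=1}^\infty\binom{2k}{k}\binom{4k}{2k}\Big(\frac{t}{2^6}\Big)^k(2H_{4k}-H_{2k})=-P_{-1/4}(1-2t)\log(1-t),$$ $$S^L_{-1/6}(t):=\sum_{k=1}^\infty\binom{3k}{k}\binom{6k}{3k}\Big(\frac{t}{2^43^3}\Big)^k(6H_{6k}-3H_{3k}-2H_{2k}+H_k)=-P_{-1/6}(1-2t)\log(1-t).$$ (b) For every complex $t$ with $|t|\le1$ and $t\notin[-1,0]\cup\{1\}$, $$\widetilde S^L_{-1/2}(t):=-\sum_{k=1}^\infty\binom{2k}{k}^2\Big(\frac{t}{2^4}\Big)^kH_k=-\frac{\pi P_{-1/2}(2t-1)}{2}+\frac{P_{-1/2}(1-2t)}{2}\log\frac{2^4(1-t)}{t},$$ $$\widetilde S^L_{-1/3}(t):=-\sum_{k=1}^\infty\binom{2k}{k}\binom{3k}{k}\Big(\frac{t}{3^3}\Big)^kH_k=-\frac{\pi P_{-1/3}(2t-1)}{\sqrt3}+\frac{P_{-1/3}(1-2t)}{2}\log\frac{3^3(1-t)}{t},$$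 $$\widetilde S^L_{-1/4}(t):=-\sum_{k=1}^\infty\binom{2k}{k}\binom{4k}{2k}\Big(\frac{t}{2^6}\Big)^kH_k=-\frac{\pi P_{-1/4}(2t-1)}{\sqrt2}+\frac{P_{-1/4}(1-2t)}{2}\log\frac{2^6(1-t)}{t},$$ $$\widetilde S^L_{-1/6}(t):=-\sum_{k=1}^\infty\binom{3k}{k}\binom{6k}{3k}\Big(\frac{t}{2^43^3}\Big)^kH_k=-\pi P_{-1/6}(2t-1)+\frac{P_{-1/6}(1-2t)}{2}\log\frac{2^43^3(1-t)}{t}.$$ Moreover, for $t\in[-1,0)$ and $\nu\in\{-\frac12,-\frac13,-\frac14,-\frac16\}$, the series $\widetilde S^L_\nu(t)$ equals $\lim_{\varepsilon\to0^+}\widetilde S^L_\nu(t+ i\varepsilon)$ and also $\lim_{\varepsilon\to0^+}\widetilde S^L_\nu(t- i\varepsilon)$, where $\widetilde S^L_\nu(t\pm i\varepsilon)$ is evaluated by the corresponding closed form on the right-hand side in (b).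
   Context: $H_m:=\sum_{k=1}^m\frac1k$ (with $H_0=0$). Logarithms are principal: $\mathrm{Re}\log\xi=\log|\xi|$, $\mathrm{Im}\log\xi=\arg\xi\in(-\pi,\pi]$ for $\xi\in\mathbb C\setminus\{0\}$, and $\xi^\beta:=e^{\beta\log\xi}$. For $\nu\in(-1,0)$ and $t\in\mathbb C\setminus[1,\infty)$ the Legendre function of degree $\nu$ is $$P_\nu(1-2t):=-\frac{\sin(\nu\pi)}{\pi}\int_0^1\Big[\frac{X(1-tX)}{1-X}\Big]^\nu\frac{dX}{1-X}={}_2F_1(-\nu,\nu+1;1;t),$$ so that $P_\nu$ is holomorphic on $\mathbb C\setminus(-\infty,-1]$. *)

(* Defs.v *)
From Stdlib Require Import Reals Lra.
From Coquelicot Require Import Coquelicot.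

Open Scope R_scope.

Definition Cexp (z : C) : C := (exp (Re z) * cos (Im z), exp (Re z) * sin (Im z)).

(** Principal argument, with values in (-PI, PI]; junk at [z = 0]. *)
Definition Carg (z : C) : R :=
  if Rle_dec 0 (Im z) then acos (Re z / Cmod z) else - acos (Re z / Cmod z).

Definition Clog (z : C) : C := (ln (Cmod z), Carg z).

Definition Cpower (z b : C) : C := Cexp (b * Clog z)%C.

Lemma Re_div_Cmod_bound (z : C) (hz : z <> 0) : -1 <= Re z / Cmod z <= 1.
Proof.
  assert (Hm : 0 < Cmod z) by now apply Cmod_gt_0.
  assert (H := re_le_Cmod z). apply Rabs_le_between in H.
  split; apply Rmult_le_reg_r with (Cmod z); trivial;
    unfold Rdiv; rewrite Rmult_assoc, Rinv_l; lra.
Qed.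

Lemma Carg_bound (z : C) (hz : z <> 0) : - PI < Carg z <= PI.
Proof.
  assert (B := Re_div_Cmod_bound z hz).
  assert (A := acos_bound (Re z / Cmod z)).
  assert (P := PI_RGT_0).
  unfold Carg; destruct (Rle_dec 0 (Im z)) as [|n]; [lra|].
  split; [|lra].
  destruct (Req_dec (acos (Re z / Cmod z)) PI) as [e|ne]; [exfalso|lra].
  assert (Hm : 0 < Cmod z) by now apply Cmod_gt_0.
  assert (E := cos_acos _ B). rewrite e, cos_PI in E.
  assert (E' : Re z = - Cmod z).
  { replace (Re z) with (Re z / Cmod z * Cmod z) by (field; lra).
    rewrite <- E; ring. }
  assert (M := Cmod2_alt z). rewrite E' in M. nra.
Qed.

Lemma Cexp_Clog (z : C) (hz : z <> 0) : Cexp (Clog z) = z.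
Proof.
  assert (B := Re_div_Cmod_bound z hz).
  assert (Hm : 0 < Cmod z) by now apply Cmod_gt_0.
  assert (Hs : Cmod z * sin (acos (Re z / Cmod z)) = Rabs (Im z)).
  { rewrite sin_acos by exact B.
    rewrite <- (sqrt_Rsqr (Cmod z)) at 1 by lra.
    rewrite <- sqrt_mult_alt by apply Rle_0_sqr.
    rewrite <- sqrt_Rsqr_abs. f_equal.
    assert (M := Cmod2_alt z). unfold Rsqr.
    replace (Im z * Im z) with (Cmod z ^ 2 - Re z ^ 2) by lra.
    field; lra. }
  unfold Cexp, Clog, Carg; simpl. rewrite exp_ln by exact Hm.
  transitivity (Re z, Im z); [f_equal|now destruct z].
  - destruct (Rle_dec 0 (Im z)); rewrite ?cos_neg, cos_acos by exact B;
      unfold Re; field; lra.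
  - destruct (Rle_dec 0 (Im z)); rewrite ?sin_neg.
    + rewrite Hs. apply Rabs_pos_eq. assumption.
    + rewrite <- Ropp_mult_distr_r, Hs, Rabs_left by lra.
      unfold Im; ring.
Qed.

Definition legendre_integrand (nu : R) (t : C) (X : R) : C :=
  (Cpower (X * (1 - t * X) / (1 - X)) nu / (1 - X))%C.

Definition legendre_integral (nu : R) (t : C) : C :=
  @RInt_gen C_R_CompleteNormedModule
    (legendre_integrand nu t) (at_right 0) (at_left 1).

(** [P_nu(z)]; the integral representation is written for [z = 1 - 2 t]. *)
Definition legendreP (nu : R) (z : C) : C :=
  (- (sin (nu * PI) / PI)%R * legendre_integral nu ((1 - z) / 2))%C.

Definition harmonic (m : nat) : R := sum_n_m (fun k => / INR k) 1 m.

(** [Coquelicot] reuses the name [C] of the standard library's binomials. *)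
Definition binom (n k : nat) : R := Binomial.C n k.

Definition is_sum_from1 (a : nat -> C) (s : C) : Prop :=
  @is_series C_AbsRing C_NormedModule (fun n => a (S n)) s.

(** [is_SL_i t v] (resp. [is_SLt_i t v]): the series defining [S^L_{-1/i}]
    (resp. its tilde version) converges at [t], and its value is [v]. *)
Definition is_SL_2 (t v : C) : Prop :=
  exists s : C,
    is_sum_from1 (fun k =>
      (binom (2 * k) k)%R ^ 2 * (t / 2 ^ 4) ^ k
      * (2 * harmonic (2 * k) - harmonic k)%R)%C s
    /\ v = (2 * s)%C.

Definition is_SL_3 (t v : C) : Prop :=
  is_sum_from1 (fun k =>
    binom (2 * k) k * binom (3 * k) k * (t / 3 ^ 3) ^ k
    * (3 * harmonic (3 * k) - harmonic k)%R)%C v.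

Definition is_SL_4 (t v : C) : Prop :=
  exists s : C,
    is_sum_from1 (fun k =>
      binom (2 * k) k * binom (4 * k) (2 * k) * (t / 2 ^ 6) ^ k
      * (2 * harmonic (4 * k) - harmonic (2 * k))%R)%C s
    /\ v = (2 * s)%C.

Definition is_SL_6 (t v : C) : Prop :=
  is_sum_from1 (fun k =>
    binom (3 * k) k * binom (6 * k) (3 * k) * (t / (2 ^ 4 * 3 ^ 3)) ^ k
    * (6 * harmonic (6 * k) - 3 * harmonic (3 * k)
       - 2 * harmonic (2 * k) + harmonic k)%R)%C v.

Definition is_SLt_2 (t v : C) : Prop :=
  exists s : C,
    is_sum_from1 (fun k =>
      (binom (2 * k) k)%R ^ 2 * (t / 2 ^ 4) ^ k * harmonic k)%C s
    /\ v = (- s)%C.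

Definition is_SLt_3 (t v : C) : Prop :=
  exists s : C,
    is_sum_from1 (fun k =>
      binom (2 * k) k * binom (3 * k) k * (t / 3 ^ 3) ^ k * harmonic k)%C s
    /\ v = (- s)%C.

Definition is_SLt_4 (t v : C) : Prop :=
  exists s : C,
    is_sum_from1 (fun k =>
      binom (2 * k) k * binom (4 * k) (2 * k) * (t / 2 ^ 6) ^ k
      * harmonic k)%C s
    /\ v = (- s)%C.

Definition is_SLt_6 (t v : C) : Prop :=
  exists s : C,
    is_sum_from1 (fun k =>
      binom (3 * k) k * binom (6 * k) (3 * k) * (t / (2 ^ 4 * 3 ^ 3)) ^ k
      * harmonic k)%C s
    /\ v = (- s)%C.

Definition SLt_rhs_2 (t : C) : C :=
  (- (PI * legendreP (- / 2) (2 * t - 1) / 2)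
   + legendreP (- / 2) (1 - 2 * t) / 2 * Clog (2 ^ 4 * (1 - t) / t))%C.

Definition SLt_rhs_3 (t : C) : C :=
  (- (PI * legendreP (- / 3) (2 * t - 1) / sqrt 3)
   + legendreP (- / 3) (1 - 2 * t) / 2 * Clog (3 ^ 3 * (1 - t) / t))%C.

Definition SLt_rhs_4 (t : C) : C :=
  (- (PI * legendreP (- / 4) (2 * t - 1) / sqrt 2)
   + legendreP (- / 4) (1 - 2 * t) / 2 * Clog (2 ^ 6 * (1 - t) / t))%C.

Definition SLt_rhs_6 (t : C) : C :=
  (- (PI * legendreP (- / 6) (2 * t - 1))
   + legendreP (- / 6) (1 - 2 * t) / 2 * Clog (2 ^ 4 * 3 ^ 3 * (1 - t) / t))%C.

Definition is_limit_on_cut (series : C -> C -> Prop) (rhs : C -> C) (x : R) : Prop :=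
  exists v : C,
    series x v
    /\ filterlim (fun eps : R => rhs (x + Ci * eps)%C) (at_right 0) (locally v)
    /\ filterlim (fun eps : R => rhs (x - Ci * eps)%C) (at_right 0) (locally v).

(* Main.v *)
Require Import Defs.
From Stdlib Require Import Reals Lra Lia Factorial.
From Coquelicot Require Import Coquelicot.

Open Scope R_scope.

(** Let [nu = - 1/n] and [q = (1 - 1/n) / n].  Up to a constant, [P_nu(1 - 2 t)] is the Euler
    integral [J n t], which becomes a proper integral after [X = u^n / (u^n + (1 - u)^n)].  Both
    [J n t] and [J n (1 - t)] solve Legendre's equation [(t (1 - t) y')' = q y], and so do
    [sum_k a_k L_k t^k + P log(1 - t)] and [- P log t - sum_k a_k (L_k - 2 H_k - kappa) t^k],
    where [P = sum_k a_k t^k] and [a_k L_k] is the coefficient in [S^L].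

    On (0,1) the Wronskian of a difference of two solutions with [P] is constant, and tends to
    [0] at [t = 0], so the difference is a multiple of [P].  The multiple is [0]: for the
    solutions regular at [0], by the value there; for [J n (1 - t)], because [J n (1 - t)]
    stays bounded as [t] tends to [1] while [P] does not, provided that
    [kappa = lim (L_k - 2 H_k)], which makes the logarithmic solution [o(P)].  Gronwall's
    inequality along circular arcs centred at [0] carries the identities from (0,1) to the
    (slit) open disk, and Dirichlet's test with a limit along rays carries them to the
    boundary.  On the cut, Gronwall's inequality along rays shows that [J n (1 - rho t)] is
    Lipschitz in [rho], uniformly in [t = x + i eps]; this reduces the limit from outside the
    disk (for [x = -1]) to one from inside. *)

(** Both ends of (0,1) are singular for Legendre's equation, so Gronwall's inequality cannot start
    there, whereas the Wronskian argument asks only for limits. To keep these finite, the system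
    carries [z = t (1 - t) y'] instead of [y']: it is continuous at [0] for a regular solution, and
    for [J n (1 - t)] it tends to [-1], which fixes the coefficient of [log t].

    The factors [L_k - 2 H_k] come from Frobenius's method: they are the logarithmic derivatives at
    [s = 0] of the products over [j < k] of [(j + s - nu) (j + s + 1 + nu) / (j + s + 1)^2]. The
    constant [kappa], usually a digamma value, is invisible at [0], where every choice gives a
    solution with the same logarithm; hence the comparison at [t = 1].

    The analysis is uniform in [n >= 2]. The four degrees enter only through arithmetic: binomial
    products, harmonic combinations, [kappa], and the value [J n 0], which is found with arctangents
    and cancels the factor [sin (pi / n) / pi], so that [P] is [1] at [t = 0]. *)

Definition slit (z : C) : Prop := Im z <> 0 \/ 0 < Re z.

Lemma slit_neq_0 (z : C) : slit z -> z <> 0.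
Proof. intros [H|H] E; subst; simpl in H; lra. Qed.

Lemma ln_nonpos (x : R) : 0 < x <= 1 -> ln x <= 0.
Proof.
  intros [H [H1|H1]]; [|rewrite H1, ln_1; lra]. rewrite <- ln_1. left. now apply ln_increasing.
Qed.

Lemma exp_le (x y : R) : x <= y -> exp x <= exp y.
Proof. intros [H|H]; [left; now apply exp_increasing|rewrite H; lra]. Qed.

(** * Moduli, arguments and the principal logarithm *)

Lemma C_eq (z w : C) : Re z = Re w -> Im z = Im w -> z = w.
Proof. destruct z, w; simpl; intros; subst; reflexivity. Qed.

Lemma Cmod_sqr (z : C) : Cmod z * Cmod z = Re z * Re z + Im z * Im z.
Proof. assert (H := Cmod2_alt z). lra. Qed.

Lemma im_le_Cmod (z : C) : Rabs (Im z) <= Cmod z.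
Proof.
  apply Rsqr_incr_0; [|apply Rabs_pos|apply Cmod_ge_0].
  rewrite <- Rsqr_abs. unfold Rsqr. rewrite Cmod_sqr.
  assert (0 <= Re z * Re z) by apply Rle_0_sqr. lra.
Qed.

Lemma Cmod_le_re_im (z : C) : Cmod z <= Rabs (Re z) + Rabs (Im z).
Proof.
  apply Rsqr_incr_0.
  - unfold Rsqr. rewrite Cmod_sqr.
    assert (E1 : Re z * Re z = Rabs (Re z) * Rabs (Re z)) by apply Rsqr_abs.
    assert (E2 : Im z * Im z = Rabs (Im z) * Rabs (Im z)) by apply Rsqr_abs.
    assert (H1 := Rabs_pos (Re z)). assert (H2 := Rabs_pos (Im z)). nra.
  - apply Cmod_ge_0.
  - assert (H1 := Rabs_pos (Re z)). assert (H2 := Rabs_pos (Im z)). lra.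
Qed.

Lemma slit_pos (z : C) : slit z -> 0 < Cmod z + Re z.
Proof.
  intros H. assert (Hz := slit_neq_0 z H). apply Cmod_gt_0 in Hz.
  destruct H as [H|H]; [|lra].
  assert (M := Cmod_sqr z). assert (0 < Im z * Im z) by nra.
  destruct (Rle_dec (Cmod z + Re z) 0) as [L|L]; [exfalso; nra|lra].
Qed.

Lemma slit_or (z : C) : 0 < Cmod z + Re z -> slit z.
Proof.
  intros H. destruct (Req_dec (Im z) 0) as [E|E]; [right|now left].
  assert (M := Cmod_sqr z). rewrite E in M. 
  assert (Hg := Cmod_ge_0 z). nra.
Qed.

Lemma slit_scal (c : R) (z : C) : 0 < c -> slit z -> slit (c * z)%C.
Proof.
  intros Hc [H|H]; [left|right]; simpl; unfold Re, Im in H; nra.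
Qed.

(** The half-angle formula, smooth on the whole slit plane (unlike [acos]). *)
Lemma Carg_atan (z : C) : slit z -> Carg z = 2 * atan (Im z / (Cmod z + Re z)).
Proof.
  intros H. assert (Hp := slit_pos z H).
  assert (Hm : 0 < Cmod z) by now apply Cmod_gt_0, slit_neq_0.
  set (v := Im z / (Cmod z + Re z)).
  assert (Hb := atan_bound v).
  assert (Hs : 1 + v * v = 2 * Cmod z / (Cmod z + Re z)).
  { assert (M := Cmod_sqr z). unfold v.
    apply Rmult_eq_reg_r with ((Cmod z + Re z) * (Cmod z + Re z)); [|nra].
    field_simplify; [nra|lra|lra]. }
  assert (Hsp : 0 < 1 + v * v) by nra.
  assert (Hc : cos (2 * atan v) = Re z / Cmod z).
  { rewrite cos_2a_cos, cos_atan.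
    replace (2 * (1 / sqrt (1 + v²)) * (1 / sqrt (1 + v²)) - 1)
      with (2 / (sqrt (1 + v²) * sqrt (1 + v²)) - 1).
    2: { field. apply Rgt_not_eq, sqrt_lt_R0. exact Hsp. }
    unfold Rsqr. rewrite sqrt_sqrt by lra. rewrite Hs. field; lra. }
  unfold Carg. rewrite <- Hc.
  destruct (Rle_dec 0 (Im z)) as [L|L].
  - assert (0 <= v). { apply Rle_mult_inv_pos; lra. }
    assert (0 <= atan v).
    { destruct (Req_dec v 0) as [E|E]; [rewrite E, atan_0; lra|].
      left. rewrite <- atan_0. apply atan_increasing. lra. }
    apply acos_cos. lra.
  - assert (v < 0). { unfold v, Rdiv. apply Rnot_le_lt in L.
      apply Rmult_lt_reg_r with (Cmod z + Re z); [lra|].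
      rewrite Rmult_assoc, Rinv_l; lra. }
    assert (atan v < 0) by (rewrite <- atan_0; apply atan_increasing; lra).
    rewrite <- cos_neg, acos_cos by lra. ring.
Qed.

Lemma Carg_slit_bound (z : C) : slit z -> - PI < Carg z < PI.
Proof.
  intros H. rewrite (Carg_atan z H).
  assert (Hb := atan_bound (Im z / (Cmod z + Re z))). lra.
Qed.

Lemma Carg_sign (z : C) : slit z ->
  (0 < Im z -> 0 < Carg z) /\ (Im z < 0 -> Carg z < 0) /\ (Im z = 0 -> Carg z = 0).
Proof.
  intros H. rewrite (Carg_atan z H). assert (Hp := slit_pos z H).
  repeat split; intros L.
  - assert (0 < Im z / (Cmod z + Re z)) by now apply Rdiv_lt_0_compat.
    assert (A := atan_increasing _ _ H0). rewrite atan_0 in A. lra.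
  - assert (Im z / (Cmod z + Re z) < 0).
    { apply Ropp_lt_cancel. rewrite Ropp_0. unfold Rdiv. rewrite Ropp_mult_distr_l.
      apply Rdiv_lt_0_compat; lra. }
    assert (A := atan_increasing _ _ H0). rewrite atan_0 in A. lra.
  - rewrite L. unfold Rdiv. rewrite Rmult_0_l, atan_0. ring.
Qed.

Lemma Clog_RtoC (x : R) : 0 < x -> Clog x = ln x.
Proof.
  intros H. apply C_eq; simpl.
  - rewrite Cmod_R, Rabs_pos_eq; lra.
  - apply (Carg_sign x); [right; simpl; lra|reflexivity].
Qed.

Lemma Clog_scal (c : R) (z : C) : 0 < c -> z <> 0 -> Clog (c * z) = (ln c + Clog z)%C.
Proof.
  intros Hc Hz. assert (Hm : 0 < Cmod z) by now apply Cmod_gt_0.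
  apply C_eq; simpl.
  - rewrite Cmod_mult, Cmod_R, Rabs_pos_eq, ln_mult; lra.
  - unfold Carg. rewrite Cmod_mult, Cmod_R, (Rabs_pos_eq c) by lra.
    replace (Im (c * z)) with (c * Im z) by (simpl; unfold Im; ring).
    replace (Re (c * z) / (c * Cmod z)) with (Re z / Cmod z).
    2: { simpl; unfold Re; field; lra. }
    destruct (Rle_dec 0 (Im z)), (Rle_dec 0 (c * Im z)); try nra; ring.
Qed.

Lemma Cexp_plus (z w : C) : Cexp (z + w) = (Cexp z * Cexp w)%C.
Proof.
  unfold Cexp; apply C_eq; simpl; rewrite exp_plus, ?cos_plus, ?sin_plus; unfold Re, Im; ring.
Qed.

Lemma Cexp_RtoC (x : R) : Cexp x = exp x.
Proof. unfold Cexp; apply C_eq; simpl; rewrite ?cos_0, ?sin_0; ring. Qed.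

Lemma Cmod_Cexp (z : C) : Cmod (Cexp z) = exp (Re z).
Proof.
  apply Rsqr_inj; [apply Cmod_ge_0|left; apply exp_pos|].
  unfold Rsqr; rewrite Cmod_sqr; unfold Cexp; simpl.
  assert (S := sin2_cos2 (Im z)). unfold Rsqr in S.
  replace (_ + _) with
    (exp (Re z) * exp (Re z) * (sin (Im z) * sin (Im z) + cos (Im z) * cos (Im z)))
    by ring.
  rewrite S; ring.
Qed.

Lemma Cexp_neq_0 (z : C) : Cexp z <> 0.
Proof. apply Cmod_gt_0. rewrite Cmod_Cexp. apply exp_pos. Qed.

(** Logarithms of products and quotients are computed with this: once the exponentials agree, only
    the bound on the imaginary part is left to check. *)
Lemma Clog_unique (w z : C) : Cexp w = z -> - PI < Im w < PI -> Clog z = w.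
Proof.
  intros E H. subst z. assert (Hn := Cexp_neq_0 w).
  assert (Hr : Re (Clog (Cexp w)) = Re w).
  { simpl. rewrite Cmod_Cexp. apply ln_exp. }
  apply C_eq; [exact Hr|].
  simpl. unfold Carg. rewrite Cmod_Cexp.
  assert (P := exp_pos (Re w)).
  replace (Re (Cexp w) / exp (Re w)) with (cos (Im w)).
  2: { unfold Cexp; simpl; field; lra. }
  unfold Cexp at 1; simpl.
  destruct (Rle_dec 0 (exp (Re w) * sin (Im w))) as [L|L].
  - assert (0 <= sin (Im w)) by nra.
    assert (0 <= Im w).
    { destruct (Rle_dec 0 (Im w)) as [|N]; [trivial|exfalso].
      assert (0 < sin (- Im w)) by (apply sin_gt_0; lra). rewrite sin_neg in H1. lra. }
    apply acos_cos; lra.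
  - assert (sin (Im w) < 0) by nra.
    assert (Im w < 0).
    { destruct (Rlt_dec (Im w) 0) as [|N]; [trivial|exfalso].
      assert (0 <= sin (Im w)) by (apply sin_ge_0; lra). lra. }
    rewrite <- cos_neg, acos_cos by lra. ring.
Qed.

Lemma Cpower_RtoC (x b : R) : 0 < x -> Cpower x b = Rpower x b.
Proof.
  intros H. unfold Cpower. rewrite Clog_RtoC by trivial.
  rewrite <- RtoC_mult, Cexp_RtoC. reflexivity.
Qed.

Lemma Cpower_scal (c b : R) (z : C) : 0 < c -> z <> 0 ->
  Cpower (c * z) b = (Rpower c b * Cpower z b)%C.
Proof.
  intros Hc Hz. unfold Cpower. rewrite Clog_scal by trivial.
  replace (b * (ln c + Clog z))%C with (RtoC (b * ln c) + b * Clog z)%C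
    by (rewrite RtoC_mult; ring).
  rewrite Cexp_plus, Cexp_RtoC. reflexivity.
Qed.

(** * Complex-valued functions of a real variable *)

(** Derivatives are taken along real curves and by components, so that real calculus applies.
    Differential equations in the complex plane are always pulled back along a segment, an arc or a
    ray. *)
Definition cderive (y : R -> C) (x : R) (l : C) : Prop :=
  is_derive (fun r => Re (y r)) x (Re l) /\ is_derive (fun r => Im (y r)) x (Im l).

Definition ccont {T : UniformSpace} (f : T -> C) (x : T) : Prop :=
  continuous (fun t => Re (f t)) x /\ continuous (fun t => Im (f t)) x.

Lemma is_derive_eq (f : R -> R) (x l l' : R) : is_derive f x l -> l = l' -> is_derive f x l'.
Proof. intros H E; now subst. Qed.

Lemma cderive_eq (y : R -> C) (x : R) (l l' : C) : cderive y x l -> l = l' -> cderive y x l'.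
Proof. intros H E; now subst. Qed.

Lemma cderive_ext_loc (f g : R -> C) (x : R) (l : C) :
  locally x (fun t => f t = g t) -> cderive f x l -> cderive g x l.
Proof.
  intros H [H1 H2]; split.
  - eapply is_derive_ext_loc; [|exact H1].
    revert H; apply filter_imp; intros t E; now rewrite E.
  - eapply is_derive_ext_loc; [|exact H2].
    revert H; apply filter_imp; intros t E; now rewrite E.
Qed.

Lemma cderive_ext (f g : R -> C) (x : R) (l : C) :
  (forall t, f t = g t) -> cderive f x l -> cderive g x l.
Proof. intros H; apply cderive_ext_loc. now apply filter_forall. Qed.

Lemma cderive_const (c : C) (x : R) : cderive (fun _ => c) x 0.
Proof. split; apply @is_derive_const. Qed.

Lemma cderive_RtoC (f : R -> R) (x l : R) : is_derive f x l -> cderive (fun r => RtoC (f r)) x l.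
Proof. intros H; split; simpl; [exact H|apply @is_derive_const]. Qed.

Lemma cderive_plus (f g : R -> C) (x : R) (a b : C) :
  cderive f x a -> cderive g x b -> cderive (fun r => f r + g r)%C x (a + b)%C.
Proof. intros [H1 H2] [H3 H4]; split; simpl; apply @is_derive_plus; assumption. Qed.

Lemma cderive_opp (f : R -> C) (x : R) (a : C) :
  cderive f x a -> cderive (fun r => - f r)%C x (- a)%C.
Proof. intros [H1 H2]; split; simpl; apply @is_derive_opp; assumption. Qed.

Lemma cderive_minus (f g : R -> C) (x : R) (a b : C) :
  cderive f x a -> cderive g x b -> cderive (fun r => f r - g r)%C x (a - b)%C.
Proof. intros; apply cderive_plus; [|apply cderive_opp]; assumption. Qed.

Lemma cderive_mult (f g : R -> C) (x : R) (a b : C) :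
  cderive f x a -> cderive g x b -> cderive (fun r => f r * g r)%C x (a * g x + f x * b)%C.
Proof.
  intros [H1 H2] [H3 H4]; split; simpl.
  - eapply is_derive_eq.
    + apply @is_derive_minus; apply @is_derive_mult;
        [exact H1|exact H3|apply Rmult_comm|exact H2|exact H4|apply Rmult_comm].
    + unfold minus, plus, opp, mult; simpl; unfold mult, plus; simpl; unfold Re, Im; ring.
  - eapply is_derive_eq.
    + apply @is_derive_plus; apply @is_derive_mult;
        [exact H1|exact H4|apply Rmult_comm|exact H2|exact H3|apply Rmult_comm].
    + unfold minus, plus, opp, mult; simpl; unfold mult, plus; simpl; unfold Re, Im; ring.
Qed.

Lemma cderive_scal (c : C) (f : R -> C) (x : R) (a : C) :
  cderive f x a -> cderive (fun r => c * f r)%C x (c * a)%C.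
Proof.
  intros H. eapply cderive_eq; [apply cderive_mult; [apply cderive_const|exact H]|cbv beta; ring].
Qed.

Lemma norm2_pos (z : C) : z <> 0 -> 0 < Re z ^ 2 + Im z ^ 2.
Proof.
  intros H. rewrite <- Cmod2_alt. apply Cmod_gt_0 in H. now apply pow_lt.
Qed.

Lemma cderive_inv (f : R -> C) (x : R) (a : C) :
  f x <> 0 -> cderive f x a -> cderive (fun r => / f r)%C x (- a / (f x * f x))%C.
Proof.
  intros Hn [H1 H2]. assert (P := norm2_pos _ Hn).
  pose (u := fun r : R => Re (f r)). pose (v := fun r : R => Im (f r)).
  change (is_derive u x (Re a)) in H1. change (is_derive v x (Im a)) in H2.
  change (Re (f x)) with (u x) in P. change (Im (f x)) with (v x) in P.
  assert (E1 : Derive (fun t : R => u t) x = Re a) by exact (is_derive_unique _ _ _ H1).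
  assert (E2 : Derive (fun t : R => v t) x = Im a) by exact (is_derive_unique _ _ _ H2).
  split.
  - apply is_derive_ext with (fun r => u r / (u r ^ 2 + v r ^ 2)); [reflexivity|].
    auto_derive. { repeat split; try (now eexists; eassumption). lra. }
    rewrite E1, E2. replace (f x) with (u x, v x) by (now apply C_eq).
    destruct a as [a1 a2]. simpl. field.
    split; [|lra]. intros E. assert (0 < (u x ^ 2 + v x ^ 2) * (u x ^ 2 + v x ^ 2)) by nra. nra.
  - apply is_derive_ext with (fun r => - v r / (u r ^ 2 + v r ^ 2)); [reflexivity|].
    auto_derive. { repeat split; try (now eexists; eassumption). lra. }
    rewrite E1, E2. replace (f x) with (u x, v x) by (now apply C_eq).
    destruct a as [a1 a2]. simpl. field.
    split; [|lra]. intros E. assert (0 < (u x ^ 2 + v x ^ 2) * (u x ^ 2 + v x ^ 2)) by nra. nra.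
Qed.

Lemma cderive_div (f g : R -> C) (x : R) (a b : C) :
  g x <> 0 -> cderive f x a -> cderive g x b ->
  cderive (fun r => f r / g r)%C x ((a * g x - f x * b) / (g x * g x))%C.
Proof.
  intros Hn Hf Hg. eapply cderive_eq.
  - apply cderive_mult; [exact Hf|]. apply cderive_inv; [exact Hn|exact Hg].
  - cbv beta. field. exact Hn.
Qed.

Lemma cderive_Cexp (f : R -> C) (x : R) (a : C) :
  cderive f x a -> cderive (fun r => Cexp (f r)) x (a * Cexp (f x))%C.
Proof.
  intros [H1 H2].
  pose (u := fun r : R => Re (f r)). pose (v := fun r : R => Im (f r)).
  change (is_derive u x (Re a)) in H1. change (is_derive v x (Im a)) in H2.
  assert (E1 : Derive (fun t : R => u t) x = Re a) by exact (is_derive_unique _ _ _ H1).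
  assert (E2 : Derive (fun t : R => v t) x = Im a) by exact (is_derive_unique _ _ _ H2).
  split.
  - apply is_derive_ext with (fun r => exp (u r) * cos (v r)); [reflexivity|].
    auto_derive. { repeat split; now eexists; eassumption. }
    rewrite E1, E2. simpl. fold (u x) (v x). unfold Re, Im. ring.
  - apply is_derive_ext with (fun r => exp (u r) * sin (v r)); [reflexivity|].
    auto_derive. { repeat split; now eexists; eassumption. }
    rewrite E1, E2. simpl. fold (u x) (v x). unfold Re, Im. ring.
Qed.

Lemma ccont_ext_loc {T : UniformSpace} (f g : T -> C) (x : T) :
  locally x (fun t => f t = g t) -> ccont f x -> ccont g x.
Proof.
  intros H [H1 H2]; split.
  - apply continuous_ext_loc with (fun t => Re (f t)); [|exact H1].
    revert H; apply filter_imp; intros t E; now rewrite E.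
  - apply continuous_ext_loc with (fun t => Im (f t)); [|exact H2].
    revert H; apply filter_imp; intros t E; now rewrite E.
Qed.

Lemma ccont_const {T : UniformSpace} (c : C) (x : T) : ccont (fun _ => c) x.
Proof. split; apply continuous_const. Qed.

Lemma ccont_RtoC {T : UniformSpace} (f : T -> R) (x : T) :
  continuous f x -> ccont (fun r => RtoC (f r)) x.
Proof. intros H; split; simpl; [exact H|apply continuous_const]. Qed.

Lemma continuous_Rmult {T : UniformSpace} (f g : T -> R) (x : T) :
  continuous f x -> continuous g x -> continuous (fun t => f t * g t) x.
Proof. intros; now apply (@continuous_mult T R_AbsRing). Qed.

Lemma continuous_Rplus {T : UniformSpace} (f g : T -> R) (x : T) :
  continuous f x -> continuous g x -> continuous (fun t => f t + g t) x.
Proof. intros; now apply (@continuous_plus T R_AbsRing R_NormedModule). Qed.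

Lemma continuous_Ropp {T : UniformSpace} (f : T -> R) (x : T) :
  continuous f x -> continuous (fun t => - f t) x.
Proof. intros; now apply (@continuous_opp T R_AbsRing R_NormedModule). Qed.

Lemma continuous_Rminus {T : UniformSpace} (f g : T -> R) (x : T) :
  continuous f x -> continuous g x -> continuous (fun t => f t - g t) x.
Proof. intros; now apply (@continuous_minus T R_AbsRing R_NormedModule). Qed.

Lemma continuous_Rinv' {T : UniformSpace} (f : T -> R) (x : T) :
  f x <> 0 -> continuous f x -> continuous (fun t => / f t) x.
Proof.
  intros Hn H. apply (continuous_comp f Rinv); [exact H|].
  now apply continuous_Rinv.
Qed.

Lemma continuous_Rdiv {T : UniformSpace} (f g : T -> R) (x : T) :
  g x <> 0 -> continuous f x -> continuous g x -> continuous (fun t => f t / g t) x.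
Proof. intros; apply continuous_Rmult; [|apply continuous_Rinv']; assumption. Qed.

Lemma continuous_of_derivable (f : R -> R) (x : R) : ex_derive f x -> continuous f x.
Proof. apply (@ex_derive_continuous R_AbsRing R_NormedModule). Qed.

Lemma continuous_Rsq {T : UniformSpace} (f : T -> R) (x : T) :
  continuous f x -> continuous (fun t => f t ^ 2) x.
Proof.
  intros H. apply (continuous_comp f (fun y => y ^ 2)); [exact H|].
  apply continuous_of_derivable. auto_derive. trivial.
Qed.

Lemma ccont_plus {T : UniformSpace} (f g : T -> C) (x : T) :
  ccont f x -> ccont g x -> ccont (fun r => f r + g r)%C x.
Proof. intros [H1 H2] [H3 H4]; split; simpl; apply continuous_Rplus; assumption. Qed.

Lemma ccont_opp {T : UniformSpace} (f : T -> C) (x : T) :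
  ccont f x -> ccont (fun r => - f r)%C x.
Proof. intros [H1 H2]; split; simpl; apply continuous_Ropp; assumption. Qed.

Lemma ccont_minus {T : UniformSpace} (f g : T -> C) (x : T) :
  ccont f x -> ccont g x -> ccont (fun r => f r - g r)%C x.
Proof. intros; apply ccont_plus; [|apply ccont_opp]; assumption. Qed.

Lemma ccont_mult {T : UniformSpace} (f g : T -> C) (x : T) :
  ccont f x -> ccont g x -> ccont (fun r => f r * g r)%C x.
Proof.
  intros [H1 H2] [H3 H4]; split; simpl.
  - apply continuous_Rminus; apply continuous_Rmult; assumption.
  - apply continuous_Rplus; apply continuous_Rmult; assumption.
Qed.

Lemma ccont_inv {T : UniformSpace} (f : T -> C) (x : T) :
  f x <> 0 -> ccont f x -> ccont (fun r => / f r)%C x.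
Proof.
  intros Hn [H1 H2]. assert (P := norm2_pos _ Hn). simpl in P.
  assert (Hd : continuous (fun r => Re (f r) ^ 2 + Im (f r) ^ 2) x).
  { apply (continuous_Rplus (fun r => Re (f r) ^ 2)); now apply continuous_Rsq. }
  split; simpl; apply continuous_Rdiv; try (simpl; unfold Re, Im in *; lra); try exact Hd.
  - exact H1.
  - apply continuous_Ropp; exact H2.
Qed.

Lemma ccont_div {T : UniformSpace} (f g : T -> C) (x : T) :
  g x <> 0 -> ccont f x -> ccont g x -> ccont (fun r => f r / g r)%C x.
Proof. intros; apply ccont_mult; [|apply ccont_inv]; assumption. Qed.

Lemma ccont_Cmod {T : UniformSpace} (f : T -> C) (x : T) :
  ccont f x -> continuous (fun r => Cmod (f r)) x.
Proof.
  intros [H1 H2]. unfold Cmod.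
  apply (continuous_comp (fun r => fst (f r) ^ 2 + snd (f r) ^ 2) sqrt).
  - apply (continuous_Rplus (fun r => fst (f r) ^ 2)); now apply continuous_Rsq.
  - apply continuous_sqrt.
Qed.

Lemma slit_locally {T : UniformSpace} (f : T -> C) (x : T) :
  slit (f x) -> ccont f x -> locally x (fun t => slit (f t)).
Proof.
  intros Hs Hc.
  assert (H : continuous (fun t => Cmod (f t) + Re (f t)) x).
  { apply continuous_Rplus; [now apply ccont_Cmod|apply Hc]. }
  apply slit_pos in Hs.
  assert (H' : locally x (fun t => 0 < Cmod (f t) + Re (f t)))
    by exact (H (fun y => 0 < y) (open_gt 0 _ Hs)).
  revert H'; apply filter_imp; intros t Ht; now apply slit_or.
Qed.

Lemma ccont_Clog {T : UniformSpace} (f : T -> C) (x : T) :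
  slit (f x) -> ccont f x -> ccont (fun r => Clog (f r)) x.
Proof.
  intros Hs Hc. assert (Hp := slit_pos _ Hs). assert (Hz := slit_neq_0 _ Hs).
  apply Cmod_gt_0 in Hz.
  split.
  - simpl. apply (continuous_comp (fun r => Cmod (f r)) ln); [now apply ccont_Cmod|].
    apply continuous_of_derivable. auto_derive. exact Hz.
  - simpl. apply continuous_ext_loc with
      (fun t => 2 * atan (Im (f t) / (Cmod (f t) + Re (f t)))).
    + generalize (slit_locally f x Hs Hc). apply filter_imp.
      intros t Ht. now rewrite Carg_atan.
    + apply continuous_Rmult; [apply continuous_const|].
      apply (continuous_comp (fun t => Im (f t) / (Cmod (f t) + Re (f t))) atan).
      * apply continuous_Rdiv; [lra|apply Hc|].
        apply continuous_Rplus; [now apply ccont_Cmod|apply Hc].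
      * apply continuous_of_derivable. auto_derive. trivial.
Qed.

Lemma ccont_RtoC_id (r : R) : ccont RtoC r.
Proof. apply (ccont_RtoC (fun r => r)). apply continuous_id. Qed.

Ltac ccont_tac := repeat lazymatch goal with
  | |- ccont (fun _ => ?c) _ => apply ccont_const
  | |- ccont (fun t => Cplus (@?f t) (@?g t)) _ => apply (ccont_plus f g)
  | |- ccont (fun t => Cminus (@?f t) (@?g t)) _ => apply (ccont_minus f g)
  | |- ccont (fun t => Cmult (@?f t) (@?g t)) _ => apply (ccont_mult f g)
  | |- ccont (fun t => Cdiv (@?f t) (@?g t)) _ => apply (ccont_div f g)
  | |- ccont (fun t => Copp (@?f t)) _ => apply (ccont_opp f)
  | |- ccont (fun t => Clog (@?f t)) _ => apply (ccont_Clog f)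
  | |- ccont (fun t => RtoC t) _ => apply ccont_RtoC_id
  | |- ccont RtoC _ => apply ccont_RtoC_id
  end.

Lemma ccont_Cexp {T : UniformSpace} (f : T -> C) (x : T) :
  ccont f x -> ccont (fun r => Cexp (f r)) x.
Proof.
  intros [H1 H2].
  split; simpl; apply continuous_Rmult.
  - apply (continuous_comp (fun r => Re (f r)) exp); [exact H1|].
    apply continuous_of_derivable. auto_derive. trivial.
  - apply (continuous_comp (fun r => Im (f r)) cos); [exact H2|].
    apply continuous_of_derivable. auto_derive. trivial.
  - apply (continuous_comp (fun r => Re (f r)) exp); [exact H1|].
    apply continuous_of_derivable. auto_derive. trivial.
  - apply (continuous_comp (fun r => Im (f r)) sin); [exact H2|].
    apply continuous_of_derivable. auto_derive. trivial.
Qed.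

Lemma ccont_Cpower {T : UniformSpace} (b : R) (f : T -> C) (x : T) :
  slit (f x) -> ccont f x -> ccont (fun r => Cpower (f r) b) x.
Proof.
  intros Hs Hc. unfold Cpower. apply ccont_Cexp. apply ccont_mult; [apply ccont_const|].
  now apply ccont_Clog.
Qed.

Lemma cderive_ccont (f : R -> C) (x : R) (a : C) : cderive f x a -> ccont f x.
Proof.
  intros [H1 H2]; split; apply continuous_of_derivable; eexists; eassumption.
Qed.

Lemma cderive_Clog (f : R -> C) (x : R) (a : C) :
  slit (f x) -> cderive f x a -> cderive (fun r => Clog (f r)) x (a / f x)%C.
Proof.
  intros Hs H. assert (Hc := cderive_ccont _ _ _ H). destruct H as [H1 H2].
  assert (Hp := slit_pos _ Hs). assert (Hz := slit_neq_0 _ Hs).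
  assert (Hm := Hz). apply Cmod_gt_0 in Hm.
  assert (HN := norm2_pos _ Hz). assert (HS := slit_locally f x Hs Hc).
  assert (M := Cmod_sqr (f x)).
  pose (u := fun r : R => Re (f r)). pose (v := fun r : R => Im (f r)).
  change (is_derive u x (Re a)) in H1. change (is_derive v x (Im a)) in H2.
  assert (E1 : Derive (fun t : R => u t) x = Re a) by exact (is_derive_unique _ _ _ H1).
  assert (E2 : Derive (fun t : R => v t) x = Im a) by exact (is_derive_unique _ _ _ H2).
  assert (EM : sqrt (u x ^ 2 + v x ^ 2) = Cmod (f x)) by reflexivity.
  assert (EF : f x = (u x, v x)) by now apply C_eq.
  change (Re (f x)) with (u x) in *. change (Im (f x)) with (v x) in *.
  split.
  - apply is_derive_ext with (fun r => ln (sqrt (u r ^ 2 + v r ^ 2))); [reflexivity|].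
    auto_derive.
    { simpl in HN. repeat split; try (now eexists; eassumption). lra. 
      replace (u x * (u x * 1) + v x * (v x * 1)) with (u x ^ 2 + v x ^ 2) by ring. rewrite EM. exact Hm. }
    rewrite E1, E2.
    replace (u x * (u x * 1) + v x * (v x * 1)) with (u x ^ 2 + v x ^ 2) by ring.
    rewrite EM. set (m := Cmod (f x)) in *.
    rewrite EF. destruct a as [a1 a2]. simpl.
    replace (u x * (u x * 1) + v x * (v x * 1)) with (m * m) by lra.
    field; lra.
  - apply is_derive_ext_loc with
      (fun r => 2 * atan (v r / (sqrt (u r ^ 2 + v r ^ 2) + u r))).
    { revert HS; apply filter_imp; intros t Ht. simpl. now rewrite Carg_atan. }
    auto_derive.
    { simpl in HN. repeat split; try (now eexists; eassumption). lra.
      replace (u x * (u x * 1) + v x * (v x * 1)) with (u x ^ 2 + v x ^ 2) by ring.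
      rewrite EM. lra. }
    rewrite E1, E2.
    replace (u x * (u x * 1) + v x * (v x * 1)) with (u x ^ 2 + v x ^ 2) by ring.
    rewrite EM. set (m := Cmod (f x)) in *.
    rewrite EF. destruct a as [a1 a2]. simpl.
    replace (u x * (u x * 1) + v x * (v x * 1)) with (m * m) by lra.
    set (U := u x) in *. set (V := v x) in *.
    assert (Hs2 : 1 + (V / (m + U)) ^ 2 = 2 * m / (m + U)).
    { apply Rmult_eq_reg_r with ((m + U) * (m + U)); [|nra].
      field_simplify; [nra|lra|lra]. }
    replace (1 + V * / (m + U) * (V * / (m + U) * 1)) with (1 + (V / (m + U)) ^ 2)
      by (unfold Rdiv; ring).
    rewrite Hs2.
    assert (HV : V * V = m * m - U * U) by lra.
    apply Rmult_eq_reg_r with (m * m * (m + U)); [|nra].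
    field_simplify; [|lra|lra].
    replace (V ^ 2) with (m * m - U * U) by (rewrite <- HV; ring). field_simplify; lra.
Qed.

Lemma cderive_Cpower (b : R) (f : R -> C) (x : R) (a : C) :
  slit (f x) -> cderive f x a ->
  cderive (fun r => Cpower (f r) b) x (b * (a / f x) * Cpower (f x) b)%C.
Proof.
  intros Hs H. unfold Cpower.
  apply (cderive_Cexp (fun r => b * Clog (f r))%C).
  apply cderive_scal. now apply cderive_Clog.
Qed.

(** * Integrals of complex-valued functions and differentiation under the integral sign *)

Definition cint (f : R -> C) (a b : R) : C :=
  (RInt (fun u => Re (f u)) a b, RInt (fun u => Im (f u)) a b).

Definition ccont_on (f : R -> C) (a b : R) : Prop := forall u, a <= u <= b -> ccont f u.

Lemma ccont_on_ex_RInt (f : R -> C) (a b : R) : a <= b -> ccont_on f a b ->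
  ex_RInt (fun u => Re (f u)) a b /\ ex_RInt (fun u => Im (f u)) a b.
Proof.
  intros Hab H.
  split; apply (@ex_RInt_continuous R_CompleteNormedModule); intros z Hz;
    rewrite Rmin_left, Rmax_right in Hz by lra;
    [exact (proj1 (H z Hz))|exact (proj2 (H z Hz))].
Qed.

Lemma cint_ext (f g : R -> C) (a b : R) : a <= b ->
  (forall u, a <= u <= b -> f u = g u) -> cint f a b = cint g a b.
Proof.
  intros Hab H. unfold cint. f_equal; apply RInt_ext; intros x Hx;
    rewrite Rmin_left, Rmax_right in Hx by lra; rewrite H; trivial; lra.
Qed.

Lemma cint_plus (f g : R -> C) (a b : R) : a <= b -> ccont_on f a b -> ccont_on g a b ->
  cint (fun u => f u + g u)%C a b = (cint f a b + cint g a b)%C.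
Proof.
  intros Hab Hf Hg.
  destruct (ccont_on_ex_RInt f a b Hab Hf), (ccont_on_ex_RInt g a b Hab Hg).
  apply C_eq; simpl; now apply (@RInt_plus R_CompleteNormedModule).
Qed.

Lemma cint_scal (c : C) (f : R -> C) (a b : R) : a <= b -> ccont_on f a b ->
  cint (fun u => c * f u)%C a b = (c * cint f a b)%C.
Proof.
  intros Hab Hf. destruct (ccont_on_ex_RInt f a b Hab Hf) as [H1 H2].
  apply C_eq; simpl.
  - transitivity (RInt (fun u => minus (scal (fst c) (Re (f u))) (scal (snd c) (Im (f u)))) a b);
      [reflexivity|].
    rewrite (@RInt_minus R_CompleteNormedModule).
    + rewrite !(@RInt_scal R_CompleteNormedModule) by assumption. reflexivity.
    + now apply (@ex_RInt_scal R_CompleteNormedModule).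
    + now apply (@ex_RInt_scal R_CompleteNormedModule).
  - transitivity (RInt (fun u => plus (scal (fst c) (Im (f u))) (scal (snd c) (Re (f u)))) a b);
      [reflexivity|].
    rewrite (@RInt_plus R_CompleteNormedModule).
    + rewrite !(@RInt_scal R_CompleteNormedModule) by assumption. reflexivity.
    + now apply (@ex_RInt_scal R_CompleteNormedModule).
    + now apply (@ex_RInt_scal R_CompleteNormedModule).
Qed.

Lemma cint_derive (G g : R -> C) (a b : R) : a <= b ->
  (forall u, a <= u <= b -> cderive G u (g u)) -> ccont_on g a b ->
  cint g a b = (G b - G a)%C.
Proof.
  intros Hab HG Hg.
  apply C_eq; simpl; apply is_RInt_unique.
  - apply (is_RInt_derive (fun u => Re (G u)) (fun u => Re (g u)));
      intros x Hx; rewrite Rmin_left, Rmax_right in Hx by lra;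
      [exact (proj1 (HG x Hx))|exact (proj1 (Hg x Hx))].
  - apply (is_RInt_derive (fun u => Im (G u)) (fun u => Im (g u)));
      intros x Hx; rewrite Rmin_left, Rmax_right in Hx by lra;
      [exact (proj2 (HG x Hx))|exact (proj2 (Hg x Hx))].
Qed.

(** The factor 2 comes from bounding the real and imaginary parts separately; sharp constants are
    irrelevant below. *)
Lemma Cmod_cint_le (f : R -> C) (a b K : R) : a <= b -> ccont_on f a b ->
  (forall u, a <= u <= b -> Cmod (f u) <= K) -> Cmod (cint f a b) <= 2 * ((b - a) * K).
Proof.
  intros Hab Hf HK. destruct (ccont_on_ex_RInt f a b Hab Hf) as [H1 H2].
  eapply Rle_trans; [apply Cmod_le_re_im|]. simpl.
  assert (Rabs (RInt (fun u => Re (f u)) a b) <= (b - a) * K).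
  { apply abs_RInt_le_const; trivial. intros t Ht.
    eapply Rle_trans; [apply re_le_Cmod|now apply HK]. }
  assert (Rabs (RInt (fun u => Im (f u)) a b) <= (b - a) * K).
  { apply abs_RInt_le_const; trivial. intros t Ht.
    eapply Rle_trans; [apply im_le_Cmod|now apply HK]. }
  unfold Re, Im in *. lra.
Qed.

(** Stated with an explicit derivative [f'], so that joint continuity is checked on a formula and
    not on [Derive]. *)
Lemma is_derive_RInt_param_01 (f f' : R -> R -> R) (x : R) :
  locally x (fun r => forall u, 0 <= u <= 1 -> is_derive (fun r => f r u) r (f' r u)) ->
  (forall u, 0 <= u <= 1 -> locally (x, u)
     (fun z : R * R => is_derive (fun r => f r (snd z)) (fst z) (f' (fst z) (snd z)))) ->
  (forall u, 0 <= u <= 1 -> @continuous (prod_UniformSpace R_UniformSpace R_UniformSpace)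
     R_UniformSpace (fun z => f' (fst z) (snd z)) (x, u)) ->
  locally x (fun r => ex_RInt (f r) 0 1) ->
  is_derive (fun r => RInt (f r) 0 1) x (RInt (f' x) 0 1).
Proof.
  intros Hd Hl Hc Hi.
  assert (Hm : Rmin 0 1 = 0) by (apply Rmin_left; lra).
  assert (HM : Rmax 0 1 = 1) by (apply Rmax_right; lra).
  assert (E : forall t, 0 <= t <= 1 -> Derive (fun z => f z t) x = f' x t).
  { intros t Ht. apply is_derive_unique. exact (locally_singleton _ _ Hd t Ht). }
  replace (RInt (f' x) 0 1) with (RInt (fun t => Derive (fun r => f r t) x) 0 1).
  2: { apply RInt_ext. rewrite Hm, HM. intros t Ht. apply E. lra. }
  apply is_derive_RInt_param; rewrite ?Hm, ?HM.
  - revert Hd; apply filter_imp. intros r H t Ht. exact (ex_intro _ _ (H t Ht)).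
  - intros t Ht. apply continuity_2d_pt_filterlim. rewrite E by exact Ht.
    eapply filterlim_ext_loc; [|exact (Hc t Ht)].
    generalize (Hl t Ht); apply filter_imp. intros z Hz. symmetry. now apply is_derive_unique.
  - exact Hi.
Qed.

Lemma cderive_cint_param (F F' : R -> R -> C) (x : R) :
  locally x (fun r => forall u, 0 <= u <= 1 -> cderive (fun r => F r u) r (F' r u)) ->
  (forall u, 0 <= u <= 1 ->
     locally (x, u) (fun z : R * R => cderive (fun r => F r (snd z)) (fst z) (F' (fst z) (snd z)))) ->
  (forall u, 0 <= u <= 1 -> @ccont (prod_UniformSpace R_UniformSpace R_UniformSpace)
     (fun z => F' (fst z) (snd z)) (x, u)) ->
  locally x (fun r => ccont_on (F r) 0 1) ->
  cderive (fun r => cint (F r) 0 1) x (cint (F' x) 0 1).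
Proof.
  intros Hd Hl Hc Hi. split; simpl.
  - apply (is_derive_RInt_param_01 (fun r u => Re (F r u)) (fun r u => Re (F' r u))).
    + revert Hd; apply filter_imp. intros r H u Hu. exact (proj1 (H u Hu)).
    + intros u Hu. generalize (Hl u Hu); apply filter_imp. intros z H. exact (proj1 H).
    + intros u Hu. exact (proj1 (Hc u Hu)).
    + revert Hi; apply filter_imp. intros r H. exact (proj1 (ccont_on_ex_RInt _ 0 1 Rle_0_1 H)).
  - apply (is_derive_RInt_param_01 (fun r u => Im (F r u)) (fun r u => Im (F' r u))).
    + revert Hd; apply filter_imp. intros r H u Hu. exact (proj2 (H u Hu)).
    + intros u Hu. generalize (Hl u Hu); apply filter_imp. intros z H. exact (proj2 H).
    + intros u Hu. exact (proj2 (Hc u Hu)).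
    + revert Hi; apply filter_imp. intros r H. exact (proj2 (ccont_on_ex_RInt _ 0 1 Rle_0_1 H)).
Qed.

(** * The Euler integral after the substitution [X = u^n / (u^n + (1-u)^n)] *)

Definition Qd (n : nat) (u : R) : R := u ^ n + (1 - u) ^ n.
Definition Xf (n : nat) (u : R) : R := u ^ n / Qd n u.
(** This weight is [X^(-1/n) (1 - X)^(1/n - 1) dX/du]: since [X / (1 - X) = (u / (1 - u))^n], both
    endpoint singularities cancel against [dX/du] and leave the exponent [n - 2]. *)
Definition mw (n : nat) (u : R) : R := INR n * u ^ (n - 2) / Qd n u.
Definition kern (n : nat) (s : C) (x : R) : C := Cpower (1 - s * x) (- / INR n)%R.

Definition J (n : nat) (s : C) : C :=
  cint (fun u => mw n u * kern n s (Xf n u))%C 0 1.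
(** By [euler_A1], [(1 - 1/n) M n s] is [(1 - s) J'(s)]. Unlike [J'], it has a finite limit as [s]
    tends to [1] from below, namely the one in [M_lim] divided out below. *)
Definition M (n : nat) (s : C) : C :=
  cint (fun u => (mw n u * (1 - Xf n u))%R * kern n s (Xf n u))%C 0 1.

Lemma Qd_pos (n : nat) (u : R) : 0 <= u <= 1 -> 0 < Qd n u.
Proof.
  intros H. unfold Qd.
  assert (0 <= u ^ n) by (apply pow_le; lra).
  assert (0 <= (1 - u) ^ n) by (apply pow_le; lra).
  destruct (Rle_dec u 0) as [L|L].
  - assert (0 < (1 - u) ^ n) by (apply pow_lt; lra). lra.
  - assert (0 < u ^ n) by (apply pow_lt; lra). lra.
Qed.

Lemma Xf_bound (n : nat) (u : R) : 0 <= u <= 1 -> 0 <= Xf n u <= 1.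
Proof.
  intros H. assert (P := Qd_pos n u H). unfold Xf, Qd in *.
  assert (0 <= u ^ n) by (apply pow_le; lra).
  assert (0 <= (1 - u) ^ n) by (apply pow_le; lra).
  split.
  - apply Rle_mult_inv_pos; lra.
  - apply Rmult_le_reg_r with (u ^ n + (1 - u) ^ n); [lra|].
    unfold Rdiv. rewrite Rmult_assoc, Rinv_l; lra.
Qed.

Lemma continuous_pow_id (n : nat) (u : R) : continuous (fun u => u ^ n) u.
Proof. apply continuous_of_derivable. auto_derive. trivial. Qed.

Lemma continuous_Xf (n : nat) (u : R) : 0 <= u <= 1 -> continuous (Xf n) u.
Proof.
  intros H. assert (P := Qd_pos n u H). apply continuous_of_derivable.
  unfold Xf, Qd in *. auto_derive. now apply Rgt_not_eq.
Qed.

Lemma continuous_mw (n : nat) (u : R) : 0 <= u <= 1 -> continuous (mw n) u.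
Proof.
  intros H. assert (P := Qd_pos n u H). apply continuous_of_derivable.
  unfold mw, Qd in *. auto_derive. now apply Rgt_not_eq.
Qed.

(** The slit plane is star-shaped about [1]. *)
Lemma slit_segment (s : C) (x : R) : slit (1 - s) -> 0 <= x <= 1 -> slit (1 - s * x).
Proof.
  intros H Hx. destruct (Req_dec x 0) as [E|E].
  { right. subst; simpl; lra. }
  assert (E1 : Im (1 - s * x) = - (Im s * x)) by (simpl; unfold Im, Re; ring).
  assert (E2 : Re (1 - s * x) = 1 - Re s * x) by (simpl; unfold Im, Re; ring).
  destruct H as [H|H].
  - left. rewrite E1. intros F. apply H.
    destruct (Rmult_integral (Im s) x) as [G|G]; [lra|simpl; unfold Im in G; lra|contradiction].
  - right. rewrite E2. assert (Re (1 - s) = 1 - Re s) by (simpl; unfold Im, Re; ring). nra.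
Qed.

Lemma ccont_kern {T : UniformSpace} (n : nat) (g : T -> C) (X : T -> R) (x : T) :
  slit (1 - g x * X x) -> ccont g x -> continuous X x ->
  ccont (fun t => kern n (g t) (X t)) x.
Proof.
  intros Hs Hg HX. unfold kern.
  apply (ccont_Cpower (- / INR n) (fun t => 1 - g t * X t)%C x); [exact Hs|].
  ccont_tac; [exact Hg|now apply ccont_RtoC].
Qed.

Lemma continuous_comp_fst {U : UniformSpace} (f : R -> R) (x u : R) :
  continuous f x ->
  @continuous (prod_UniformSpace R_UniformSpace R_UniformSpace) _ (fun z => f (fst z)) (x, u).
Proof. intros H. apply (continuous_comp fst f); [apply continuous_fst|exact H]. Qed.

Lemma continuous_comp_snd (f : R -> R) (x u : R) :
  continuous f u ->
  @continuous (prod_UniformSpace R_UniformSpace R_UniformSpace) _ (fun z => f (snd z)) (x, u).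
Proof. intros H. apply (continuous_comp snd f); [apply continuous_snd|exact H]. Qed.

(** The weight [w] is left general to serve both [J] and [M]. *)
Lemma cderive_kern_int (n : nat) (w : R -> R) (g g' : R -> C) (x : R) :
  (forall u, 0 <= u <= 1 -> continuous w u) ->
  locally x (fun r => cderive g r (g' r)) -> ccont g' x -> slit (1 - g x) ->
  cderive (fun r => cint (fun u => w u * kern n (g r) (Xf n u))%C 0 1) x
    (g' x * (/ INR n)%R *
     cint (fun u => w u * Xf n u / (1 - g x * Xf n u) * kern n (g x) (Xf n u))%C 0 1)%C.
Proof.
  intros Hw Hg Hg' Hs.
  assert (Hgx := locally_singleton _ _ Hg). assert (Hgc := cderive_ccont _ _ _ Hgx).
  assert (Hk : forall (r v : R), cderive g r (g' r) -> slit (1 - g r * Xf n v) ->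
    cderive (fun r => w v * kern n (g r) (Xf n v))%C r
      (g' r * (/ INR n)%R * (w v * Xf n v / (1 - g r * Xf n v) * kern n (g r) (Xf n v)))%C).
  { intros r v Hr Hv. unfold kern. eapply cderive_eq.
    - apply cderive_scal. apply cderive_Cpower; [exact Hv|].
      apply cderive_minus; [apply cderive_const|].
      apply cderive_mult; [exact Hr|apply cderive_const].
    - rewrite !RtoC_opp. field. now apply slit_neq_0. }
  assert (Hsl : locally x (fun r => slit (1 - g r))).
  { apply (slit_locally (fun r => 1 - g r)%C); [exact Hs|].
    apply ccont_minus; [apply ccont_const|exact Hgc]. }
  assert (HC : forall u, 0 <= u <= 1 -> ccont (fun u : R =>
    (w u * Xf n u / (1 - g x * Xf n u) * kern n (g x) (Xf n u)))%C u).
  { intros u Hu. assert (S := slit_segment _ _ Hs (Xf_bound n u Hu)).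
    assert (CX := continuous_Xf n u Hu).
    apply ccont_mult.
    - apply ccont_div; [now apply slit_neq_0| |].
      + apply ccont_mult; apply ccont_RtoC; auto.
      + apply ccont_minus; [apply ccont_const|].
        apply ccont_mult; [apply ccont_const|now apply ccont_RtoC].
    - apply ccont_kern; [exact S|apply ccont_const|exact CX]. }
  rewrite <- cint_scal; [|lra|exact HC].
  apply (cderive_cint_param (fun r u => w u * kern n (g r) (Xf n u))%C
    (fun r u => g' r * (/ INR n)%R *
      (w u * Xf n u / (1 - g r * Xf n u) * kern n (g r) (Xf n u)))%C).
  - generalize (filter_and _ _ Hg Hsl). apply filter_imp. intros r [H1 H2] u Hu.
    apply Hk; [exact H1|]. apply slit_segment; [exact H2|now apply Xf_bound].
  - intros u Hu. assert (S := slit_segment _ _ Hs (Xf_bound n u Hu)).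
    assert (CX := continuous_Xf n u Hu).
    assert (L1 : @locally (prod_UniformSpace R_UniformSpace R_UniformSpace) (x, u)
      (fun z : R * R => cderive g (fst z) (g' (fst z)))).
    { exact (continuous_fst x u _ Hg). }
    assert (L2 : @locally (prod_UniformSpace R_UniformSpace R_UniformSpace) (x, u)
      (fun z : R * R => slit (1 - g (fst z) * Xf n (snd z)))).
    { apply (slit_locally (fun z : R * R => 1 - g (fst z) * Xf n (snd z))%C); [exact S|].
      apply ccont_minus; [apply ccont_const|].
      apply ccont_mult.
      - split; apply (@continuous_comp_fst R_UniformSpace (fun r => _ (g r))); apply Hgc.
      - apply ccont_RtoC. apply continuous_comp_snd. exact CX. }
    generalize (filter_and _ _ L1 L2). apply filter_imp.
    intros [r v] [H1 H2]. apply Hk; [exact H1|exact H2].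
  - intros u Hu. assert (S := slit_segment _ _ Hs (Xf_bound n u Hu)).
    assert (CX := continuous_Xf n u Hu).
    assert (C1 : @ccont (prod_UniformSpace R_UniformSpace R_UniformSpace) (fun z => g (fst z)) (x,u)).
    { split; apply (@continuous_comp_fst R_UniformSpace (fun r => _ (g r))); apply Hgc. }
    assert (C2 : @ccont (prod_UniformSpace R_UniformSpace R_UniformSpace) (fun z => g' (fst z)) (x,u)).
    { split; apply (@continuous_comp_fst R_UniformSpace (fun r => _ (g' r))); apply Hg'. }
    assert (C3 : @continuous (prod_UniformSpace R_UniformSpace R_UniformSpace) R_UniformSpace
       (fun z => Xf n (snd z)) (x,u)) by now apply continuous_comp_snd.
    assert (C4 : @continuous (prod_UniformSpace R_UniformSpace R_UniformSpace) R_UniformSpace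
       (fun z => w (snd z)) (x,u)) by now apply continuous_comp_snd, Hw.
    apply ccont_mult; [apply ccont_mult; [exact C2|apply ccont_const]|].
    apply ccont_mult.
    + apply ccont_div; [now apply slit_neq_0| |].
      * apply ccont_mult; now apply ccont_RtoC.
      * apply ccont_minus; [apply ccont_const|].
        apply ccont_mult; [exact C1|now apply ccont_RtoC].
    + apply (ccont_kern n (fun z : R * R => g (fst z)) (fun z : R * R => Xf n (snd z)));
        assumption.
  - revert Hsl; apply filter_imp. intros r Hr u Hu.
    apply ccont_mult; [now apply ccont_RtoC, Hw|].
    apply ccont_kern; [|apply ccont_const|now apply continuous_Xf].
    apply slit_segment; [exact Hr|now apply Xf_bound].
Qed.

Lemma INR_ge_2 (n : nat) : (2 <= n)%nat -> 2 <= INR n.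
Proof. intros H. apply le_INR in H. simpl in H. lra. Qed.

(** Powers with exponents [n] and [n - 1] are rewritten over [x ^ (n - 2)], which [field] can then
    treat as an atom. *)
Lemma pow_split (n : nat) (x : R) : (2 <= n)%nat ->
  x ^ n = x * (x * x ^ (n - 2)) /\ x ^ (n - 1) = x * x ^ (n - 2).
Proof.
  intros Hn. split.
  - replace n with (S (S (n - 2))) at 1 by lia. reflexivity.
  - replace (n - 1)%nat with (S (n - 2)) by lia. reflexivity.
Qed.

Lemma is_derive_Xf (n : nat) (u : R) : (2 <= n)%nat -> 0 <= u <= 1 ->
  is_derive (Xf n) u (INR n * u ^ (n - 1) * (1 - u) ^ (n - 1) / (Qd n u * Qd n u)).
Proof.
  intros Hn Hu. assert (P := Qd_pos n u Hu). unfold Xf, Qd in *.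
  auto_derive; [now apply Rgt_not_eq|]. change (1 + - u) with (1 - u).
  replace (pred n) with (n - 1)%nat by lia.
  destruct (pow_split n u Hn) as [E1 E3]. destruct (pow_split n (1 - u) Hn) as [E2 E4].
  rewrite E1, E2, E3, E4 in *. field. lra.
Qed.

(* In the variable [X] this is [X^(1-1/n) * (1-X)^(1/n)]. *)
Definition Rb (n : nat) (u : R) : R := u ^ (n - 1) * (1 - u) / Qd n u.

Lemma is_derive_Rb (n : nat) (u : R) : (2 <= n)%nat -> 0 <= u <= 1 ->
  is_derive (Rb n) u (mw n u * (1 - Xf n u - / INR n)).
Proof.
  intros Hn Hu. assert (P := Qd_pos n u Hu). assert (Hn2 := INR_ge_2 n Hn).
  unfold Rb, mw, Xf, Qd in *.
  auto_derive; [now apply Rgt_not_eq|]. change (1 + - u) with (1 - u).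
  replace (pred n) with (n - 1)%nat by lia.
  replace (pred (n - 1)) with (n - 2)%nat by lia.
  destruct (pow_split n u Hn) as [E1 E3]. destruct (pow_split n (1 - u) Hn) as [E2 E4].
  rewrite (minus_INR n 1) by lia. change (INR 1) with 1.
  rewrite E1, E2, E3, E4 in *. field. lra.
Qed.

Lemma Rb_Xf (n : nat) (u : R) : (2 <= n)%nat -> 0 <= u <= 1 ->
  Rb n u * (INR n * u ^ (n - 1) * (1 - u) ^ (n - 1) / (Qd n u * Qd n u))
  = mw n u * Xf n u * (1 - Xf n u).
Proof.
  intros Hn Hu. assert (P := Qd_pos n u Hu).
  unfold Rb, mw, Xf, Qd in *.
  destruct (pow_split n u Hn) as [E1 E3]. destruct (pow_split n (1 - u) Hn) as [E2 E4].
  rewrite E1, E2, E3, E4 in *. field. lra.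
Qed.

Lemma continuous_weight (n : nat) (u : R) : 0 <= u <= 1 ->
  continuous (fun u => mw n u * (1 - Xf n u)) u.
Proof.
  intros Hu. apply continuous_Rmult; [now apply continuous_mw|].
  apply continuous_Rminus; [apply continuous_const|now apply continuous_Xf].
Qed.

Lemma ccont_on_plus (f g : R -> C) (a b : R) :
  ccont_on f a b -> ccont_on g a b -> ccont_on (fun u => f u + g u)%C a b.
Proof. intros Hf Hg u Hu. exact (ccont_plus f g u (Hf u Hu) (Hg u Hu)). Qed.

Lemma ccont_on_scal (c : C) (f : R -> C) (a b : R) :
  ccont_on f a b -> ccont_on (fun u => c * f u)%C a b.
Proof. intros Hf u Hu. exact (ccont_mult _ f u (ccont_const c u) (Hf u Hu)). Qed.

Lemma cint_lin3 (c1 c2 c3 : C) (f g h : R -> C) (a b : R) : a <= b ->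
  ccont_on f a b -> ccont_on g a b -> ccont_on h a b ->
  (c1 * cint f a b + c2 * cint g a b + c3 * cint h a b
   = cint (fun u => c1 * f u + c2 * g u + c3 * h u) a b)%C.
Proof.
  intros Hab Hf Hg Hh. rewrite <- !cint_scal by assumption.
  rewrite (cint_plus (fun u => c1 * f u + c2 * g u)%C (fun u => c3 * h u)%C).
  - rewrite (cint_plus (fun u => c1 * f u)%C (fun u => c2 * g u)%C); trivial;
      now apply ccont_on_scal.
  - exact Hab.
  - apply (ccont_on_plus (fun u => c1 * f u)%C (fun u => c2 * g u)%C); now apply ccont_on_scal.
  - now apply ccont_on_scal.
Qed.

Lemma cint_0 (f : R -> C) (a b : R) : a <= b ->
  (forall u, a <= u <= b -> f u = 0) -> cint f a b = 0.
Proof.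
  intros Hab H. rewrite (cint_ext f (fun _ => 0 * 0)%C); trivial.
  - rewrite (cint_scal 0 (fun _ => 0)%C); [ring|exact Hab|intros u Hu; apply ccont_const].
  - intros u Hu. rewrite H by exact Hu. ring.
Qed.

(** * Contiguity relations of the Euler integral *)

Section euler.
Context (n : nat) (Hn : (2 <= n)%nat) (s : C) (Hs : slit (1 - s)).

Definition Xder (u : R) : R :=
  INR n * u ^ (n - 1) * (1 - u) ^ (n - 1) / (Qd n u * Qd n u).

(** The derivative of [Rb n u * kern n s (Xf n u)], which vanishes at both ends. Both relations
    [euler_A1] and [euler_A2] follow linearly from the vanishing of its integral. *)
Definition exact_integrand (u : R) : C :=
  (mw n u * ((1 - Xf n u) * (1 - s * Xf n u) - (/ INR n)%R * (1 - s * Xf n u)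
     + (/ INR n)%R * s * Xf n u * (1 - Xf n u)) / (1 - s * Xf n u)
   * kern n s (Xf n u))%C.

Lemma ccont_int_kern (f : R -> C) : ccont_on f 0 1 ->
  ccont_on (fun u => f u * kern n s (Xf n u))%C 0 1.
Proof.
  intros Hf u Hu. apply ccont_mult; [now apply Hf|].
  apply ccont_kern; [|apply ccont_const|now apply continuous_Xf].
  apply slit_segment; [exact Hs|now apply Xf_bound].
Qed.

Lemma ccont_one_sX : ccont_on (fun u => 1 - s * Xf n u)%C 0 1.
Proof.
  intros u Hu. apply ccont_minus; [apply ccont_const|].
  apply ccont_mult; [apply ccont_const|now apply ccont_RtoC, continuous_Xf].
Qed.

Lemma one_sX_neq_0 (u : R) : 0 <= u <= 1 -> (1 - s * Xf n u)%C <> 0.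
Proof. intros Hu. apply slit_neq_0, slit_segment; [exact Hs|now apply Xf_bound]. Qed.

Lemma ccont_exact : ccont_on exact_integrand 0 1.
Proof.
  apply ccont_int_kern. intros u Hu.
  assert (CX := ccont_RtoC _ _ (continuous_Xf n u Hu)).
  assert (Cm := ccont_RtoC _ _ (continuous_mw n u Hu)).
  assert (C1 := ccont_one_sX u Hu).
  apply ccont_div; [now apply one_sX_neq_0| |exact C1].
  apply ccont_mult; [exact Cm|].
  ccont_tac; first [exact CX | exact C1].
Qed.

Lemma cint_exact : cint exact_integrand 0 1 = 0.
Proof.
  rewrite (cint_derive (fun u => Rb n u * kern n s (Xf n u))%C).
  - unfold Rb. replace (n - 1)%nat with (S (n - 2)) by lia. simpl.
    unfold Rdiv. rewrite !Rminus_diag, Rmult_0_l, Rmult_0_r, !Rmult_0_l. ring.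
  - lra.
  - intros u Hu. assert (Hne := one_sX_neq_0 u Hu).
    assert (Hn2 := INR_ge_2 n Hn).
    eapply cderive_eq.
    + apply cderive_mult; [apply cderive_RtoC, is_derive_Rb; assumption|].
      apply cderive_Cpower.
      { apply slit_segment; [exact Hs|now apply Xf_bound]. }
      apply cderive_minus; [apply cderive_const|].
      apply cderive_scal. apply cderive_RtoC, is_derive_Xf; assumption.
    + unfold exact_integrand. fold (Xder u).
      assert (E := Rb_Xf n u Hn Hu). fold (Xder u) in E.
      assert (E' : (Rb n u * Xder u = mw n u * Xf n u * (1 - Xf n u))%C).
      { rewrite <- RtoC_mult, E, !RtoC_mult, RtoC_minus. reflexivity. }
      unfold kern. set (K := Cpower _ _) in *.
      transitivity (mw n u * (1 - Xf n u - (/ INR n)%R) * K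
        + (/ INR n)%R * s * (Rb n u * Xder u) / (1 - s * Xf n u) * K)%C.
      * rewrite !RtoC_mult, !RtoC_minus, RtoC_opp. field. exact Hne.
      * rewrite E'. field. exact Hne.
  - exact ccont_exact.
Qed.

(** By [cderive_kern_int], [p A1] and [p A2] are the derivatives of [J] and [M] with respect to
    [s]. *)
Definition A1 : C :=
  cint (fun u => mw n u * Xf n u / (1 - s * Xf n u) * kern n s (Xf n u))%C 0 1.
Definition A2 : C :=
  cint (fun u => (mw n u * (1 - Xf n u))%R * Xf n u / (1 - s * Xf n u) * kern n s (Xf n u))%C 0 1.

Let p : C := (/ INR n)%R.

Lemma ccont_pre (u : R) : 0 <= u <= 1 ->
  ccont (fun u => RtoC (Xf n u)) u /\ ccont (fun u => RtoC (mw n u)) u /\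
  ccont (fun u => 1 - s * Xf n u)%C u /\
  ccont (fun u => RtoC (mw n u * (1 - Xf n u))) u.
Proof.
  intros Hu. split; [|split; [|split]].
  - apply (ccont_RtoC (Xf n)). now apply continuous_Xf.
  - apply (ccont_RtoC (mw n)). now apply continuous_mw.
  - exact (ccont_one_sX u Hu).
  - apply (ccont_RtoC (fun u => mw n u * (1 - Xf n u))). now apply continuous_weight.
Qed.

(** This is [(1 - s) J' = (1 - p) M]. After adding [exact_integrand] the three integrands cancel
    pointwise. *)
Lemma euler_A1 : ((1 - s) * p * A1 = (1 - p) * M n s)%C.
Proof.
  assert (H : ((1 - s) * p * A1 + - (1 - p) * M n s + 1 * cint exact_integrand 0 1 = 0)%C).
  2: { rewrite cint_exact in H.
       replace ((1 - s) * p * A1)%C with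
         (((1 - s) * p * A1 + - (1 - p) * M n s + 1 * 0) + (1 - p) * M n s)%C by ring.
       rewrite H. ring. }
  unfold A1, M.
  assert (C1 : ccont_on (fun u => mw n u * Xf n u / (1 - s * Xf n u) * kern n s (Xf n u))%C 0 1).
  { apply ccont_int_kern. intros u Hu. destruct (ccont_pre u Hu) as (H1 & H2 & H3 & H4).
    apply ccont_div; [now apply one_sX_neq_0| |exact H3]. now apply ccont_mult. }
  assert (C2 : ccont_on (fun u => (mw n u * (1 - Xf n u))%R * kern n s (Xf n u))%C 0 1).
  { apply ccont_int_kern. intros u Hu. now destruct (ccont_pre u Hu) as (H1 & H2 & H3 & H4). }
  assert (C3 := ccont_exact).
  rewrite cint_lin3 by (lra || assumption).
  apply cint_0; [lra|]. intros u Hu. unfold exact_integrand, p.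
  rewrite !RtoC_mult, !RtoC_minus. field. now apply one_sX_neq_0.
Qed.

(** This is [(s M)' = p J]. Together with [euler_A1] it gives [(s (1 - s) J')' = p (1 - p) J],
    Legendre's equation. *)
Lemma euler_A2 : (M n s + s * p * A2 = p * J n s)%C.
Proof.
  assert (H : (1 * M n s + (s * p) * A2 + - p * J n s + - (1) * cint exact_integrand 0 1 = 0)%C).
  2: { rewrite cint_exact in H.
       replace (M n s + s * p * A2)%C with
         ((1 * M n s + (s * p) * A2 + - p * J n s + - (1) * 0) + p * J n s)%C by ring.
       rewrite H. ring. }
  unfold A2, M, J.
  assert (C1 : ccont_on (fun u => (mw n u * (1 - Xf n u))%R * Xf n u / (1 - s * Xf n u) * kern n s (Xf n u))%C 0 1).
  { apply ccont_int_kern. intros u Hu. destruct (ccont_pre u Hu) as (H1 & H2 & H3 & H4).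
    apply ccont_div; [now apply one_sX_neq_0| |exact H3]. now apply ccont_mult. }
  assert (C2 : ccont_on (fun u => (mw n u * (1 - Xf n u))%R * kern n s (Xf n u))%C 0 1).
  { apply ccont_int_kern. intros u Hu. now destruct (ccont_pre u Hu) as (H1 & H2 & H3 & H4). }
  assert (C4 : ccont_on (fun u => mw n u * kern n s (Xf n u))%C 0 1).
  { apply ccont_int_kern. intros u Hu. now destruct (ccont_pre u Hu) as (H1 & H2 & H3 & H4). }
  assert (C3 := ccont_exact).
  rewrite (cint_lin3 1 (s * p) (- p)) by (lra || assumption).
  rewrite <- (cint_scal (- (1))) by (lra || assumption).
  rewrite <- cint_plus; [|lra| |].
  - apply cint_0; [lra|]. intros u Hu. unfold exact_integrand, p.
    rewrite !RtoC_mult, !RtoC_minus. field. now apply one_sX_neq_0.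
  - repeat match goal with |- ccont_on (fun u => Cplus (@?f u) (@?g u)) _ _ =>
      apply (ccont_on_plus f g) end; now apply ccont_on_scal.
  - now apply ccont_on_scal.
Qed.

End euler.

(** Legendre's equation [(t (1 - t) y')' = q y], [q = (1 - 1/n) / n], as a first-order
    system for [y] and [z = t (1 - t) y'] pulled back along a curve [g]. *)
Definition leg (n : nat) (g g' y z : R -> C) (x : R) : Prop :=
  cderive y x (g' x * z x / (g x * (1 - g x)))%C /\
  cderive z x ((/ INR n * (1 - / INR n))%R * g' x * y x)%C.

Definition J_z (n : nat) (s : C) : C := ((1 - / INR n)%R * s * M n s)%C.

Lemma leg_J (n : nat) (g g' : R -> C) (x : R) : (2 <= n)%nat ->
  locally x (fun r => cderive g r (g' r)) -> ccont g' x -> slit (1 - g x) -> g x <> 0 ->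
  leg n g g' (fun r => J n (g r)) (fun r => J_z n (g r)) x.
Proof.
  intros Hn Hg Hg' Hs H0. assert (Hgx := locally_singleton _ _ Hg).
  assert (H1 := slit_neq_0 _ Hs).
  assert (E1 := euler_A1 n Hn (g x) Hs). assert (E2 := euler_A2 n Hn (g x) Hs).
  assert (D1 := cderive_kern_int n (mw n) g g' x (continuous_mw n) Hg Hg' Hs).
  assert (D2 := cderive_kern_int n _ g g' x (continuous_weight n) Hg Hg' Hs).
  cbv beta in D2. fold (A2 n (g x)) in D2. fold (A1 n (g x)) in D1.
  split.
  - eapply cderive_eq; [exact D1|].
    unfold J_z. rewrite RtoC_minus.
    apply (f_equal (fun c => c * g' x / (1 - g x))%C) in E1.
    transitivity ((1 - g x) * (/ INR n)%R * A1 n (g x) * g' x / (1 - g x))%C.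
    { field. exact H1. }
    rewrite E1. field. split; [exact H1|exact H0].
  - unfold J_z. eapply cderive_eq.
    + apply cderive_mult; [|exact D2].
      apply cderive_scal. exact Hgx.
    + cbv beta. fold (M n (g x)). rewrite RtoC_mult.
      transitivity ((1 - / INR n)%R * g' x * (M n (g x) + g x * (/ INR n)%R * A2 n (g x)))%C.
      { ring. }
      rewrite E2. ring.
Qed.

(** Unlike [leg_J], this and the next lemma include [g x = 0], where the system itself is singular;
    they provide the continuity at [0] of the regular solution. *)
Lemma cderive_J (n : nat) (g g' : R -> C) (x : R) : 
  locally x (fun r => cderive g r (g' r)) -> ccont g' x -> slit (1 - g x) ->
  exists l, cderive (fun r => J n (g r)) x l.
Proof.
  intros Hg Hg' Hs. eexists.
  exact (cderive_kern_int n (mw n) g g' x (continuous_mw n) Hg Hg' Hs).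
Qed.

Lemma cderive_J_z (n : nat) (g g' : R -> C) (x : R) : 
  locally x (fun r => cderive g r (g' r)) -> ccont g' x -> slit (1 - g x) ->
  exists l, cderive (fun r => J_z n (g r)) x l.
Proof.
  intros Hg Hg' Hs. unfold J_z. eexists.
  apply cderive_mult; [apply cderive_scal; exact (locally_singleton _ _ Hg)|].
  exact (cderive_kern_int n _ g g' x (continuous_weight n) Hg Hg' Hs).
Qed.

(** The equation is invariant under [t -> 1 - t], and [t (1 - t) y'] changes sign. *)
Lemma leg_J_reflected (n : nat) (g g' : R -> C) (x : R) : (2 <= n)%nat ->
  locally x (fun r => cderive g r (g' r)) -> ccont g' x -> slit (g x) -> (1 - g x)%C <> 0 ->
  leg n g g' (fun r => J n (1 - g r)) (fun r => - J_z n (1 - g r))%C x.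
Proof.
  intros Hn Hg Hg' Hs H1.
  assert (H0 := slit_neq_0 _ Hs).
  destruct (leg_J n (fun r => 1 - g r)%C (fun r => - g' r)%C x Hn) as [D1 D2].
  - revert Hg; apply filter_imp. intros r Hr. eapply cderive_eq.
    + apply cderive_minus; [apply cderive_const|exact Hr].
    + ring.
  - now apply ccont_opp.
  - replace (1 - (1 - g x))%C with (g x) by ring. exact Hs.
  - exact H1.
  - split.
    + eapply cderive_eq; [exact D1|]. cbv beta.
      replace (1 - (1 - g x))%C with (g x) by ring. field. split; assumption.
    + eapply cderive_eq; [apply cderive_opp, D2|]. cbv beta. ring.
Qed.

(** * The substitution and the improper Legendre integral *)

Definition Uinv (n : nat) (x : R) : R :=
  Rpower x (/ INR n) / (Rpower x (/ INR n) + Rpower (1 - x) (/ INR n)).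

Lemma Rpower_root_pow (n : nat) (x : R) : (2 <= n)%nat -> 0 < x -> Rpower x (/ INR n) ^ n = x.
Proof.
  intros Hn Hx. assert (H := INR_ge_2 n Hn).
  rewrite <- Rpower_pow by apply exp_pos. rewrite Rpower_mult, Rinv_l by lra.
  now apply Rpower_1.
Qed.

Lemma Rpower_root_ge (n : nat) (x : R) : (2 <= n)%nat -> 0 < x <= 1 -> x <= Rpower x (/ INR n).
Proof.
  intros Hn Hx. assert (H := INR_ge_2 n Hn).
  rewrite <- (Rpower_1 x) at 1 by lra.
  unfold Rpower. apply exp_le. assert (ln x <= 0) by now apply ln_nonpos.
  assert (0 < / INR n <= 1).
  { split; [apply Rinv_0_lt_compat; lra|]. rewrite <- Rinv_1. apply Rinv_le_contravar; lra. }
  nra.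
Qed.

Lemma Rpower_root_small (n : nat) (x e : R) : (2 <= n)%nat -> 0 < e -> 0 < x < e ^ n ->
  Rpower x (/ INR n) < e.
Proof.
  intros Hn He Hx. assert (H := INR_ge_2 n Hn).
  replace e with (Rpower (e ^ n) (/ INR n)).
  - unfold Rpower. apply exp_increasing. apply Rmult_lt_compat_l.
    + apply Rinv_0_lt_compat; lra.
    + apply ln_increasing; lra.
  - rewrite <- Rpower_pow by exact He. rewrite Rpower_mult, Rinv_r by lra. now apply Rpower_1.
Qed.

Lemma Uinv_bounds (n : nat) (x : R) : (2 <= n)%nat -> 0 < x < 1 ->
  0 < Uinv n x < 1 /\ Uinv n x <= Rpower x (/ INR n) /\ 1 - Uinv n x <= Rpower (1 - x) (/ INR n).
Proof.
  intros Hn Hx. unfold Uinv.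
  assert (Ha := Rpower_root_ge n x Hn ltac:(lra)).
  assert (Hb := Rpower_root_ge n (1 - x) Hn ltac:(lra)).
  assert (Ea : 0 < Rpower x (/ INR n)) by apply exp_pos.
  assert (Eb : 0 < Rpower (1 - x) (/ INR n)) by apply exp_pos.
  set (a := Rpower x _) in *. set (b := Rpower (1 - x) _) in *.
  assert (E : 1 - a / (a + b) = b / (a + b)) by (field; lra).
  assert (D : forall c, 0 < c -> 0 < c / (a + b) <= c).
  { intros c Hc. split; [apply Rdiv_lt_0_compat; lra|].
    apply Rmult_le_reg_r with (a + b); [lra|].
    unfold Rdiv. rewrite Rmult_assoc, Rinv_l by lra. nra. }
  assert (Da := D a Ea). assert (Db := D b Eb). rewrite E. lra.
Qed.

Lemma Xf_Uinv (n : nat) (x : R) : (2 <= n)%nat -> 0 < x < 1 ->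
  Qd n (Uinv n x) = / (Rpower x (/ INR n) + Rpower (1 - x) (/ INR n)) ^ n /\ Xf n (Uinv n x) = x.
Proof.
  intros Hn Hx. unfold Uinv, Xf, Qd.
  assert (Ha := Rpower_root_pow n x Hn ltac:(lra)).
  assert (Hb := Rpower_root_pow n (1 - x) Hn ltac:(lra)).
  assert (Ea : 0 < Rpower x (/ INR n)) by apply exp_pos.
  assert (Eb : 0 < Rpower (1 - x) (/ INR n)) by apply exp_pos.
  set (a := Rpower x _) in *. set (b := Rpower (1 - x) _) in *.
  replace (1 - a / (a + b)) with (b / (a + b)) by (field; lra).
  assert (0 < (a + b) ^ n) by (apply pow_lt; lra).
  assert (Q : (a / (a + b)) ^ n + (b / (a + b)) ^ n = / (a + b) ^ n).
  { unfold Rdiv. rewrite !Rpow_mult_distr, Ha, Hb, pow_inv. ring. }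
  rewrite Q. split; [reflexivity|].
  unfold Rdiv at 1. rewrite Rinv_inv. unfold Rdiv. rewrite Rpow_mult_distr, Ha, pow_inv.
  field. lra.
Qed.

Lemma is_derive_Uinv (n : nat) (x : R) : (2 <= n)%nat -> 0 < x < 1 ->
  is_derive (Uinv n) x
    (Rpower (x / (1 - x)) (- / INR n) / (1 - x) / mw n (Uinv n x)).
Proof.
  intros Hn Hx. assert (H := INR_ge_2 n Hn).
  assert (Ea : 0 < Rpower x (/ INR n)) by apply exp_pos.
  assert (Eb : 0 < Rpower (1 - x) (/ INR n)) by apply exp_pos.
  assert (Ha := Rpower_root_pow n x Hn ltac:(lra)).
  destruct (Xf_Uinv n x Hn Hx) as [Q _].
  unfold mw. rewrite Q.
  assert (ED : Rpower (x / (1 - x)) (- / INR n) = Rpower (1 - x) (/ INR n) / Rpower x (/ INR n)).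
  { rewrite Rpower_Ropp. unfold Rdiv. rewrite <- Rpower_mult_distr.
    - replace (Rpower (/ (1 - x)) (/ INR n)) with (/ Rpower (1 - x) (/ INR n)).
      + field. lra.
      + unfold Rpower. rewrite ln_Rinv, Ropp_mult_distr_r_reverse, exp_Ropp by lra. reflexivity.
    - lra.
    - apply Rinv_0_lt_compat; lra. }
  rewrite ED. unfold Uinv.
  unfold Rpower in *. auto_derive.
  - change (1 + - x) with (1 - x). repeat split; lra.
  - change (1 + - x) with (1 - x).
    set (a := exp (/ INR n * ln x)) in *. set (b := exp (/ INR n * ln (1 - x))) in *.
    destruct (pow_split n a Hn) as [E1 _]. destruct (pow_split n (a + b) Hn) as [E2 _].
    unfold Rdiv. rewrite Rpow_mult_distr, pow_inv, E2.
    assert (Hp : a ^ (n - 2) = x / (a * a)).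
    { rewrite <- Ha, E1. field. lra. }
    rewrite Hp.
    assert (0 < (a + b) ^ (n - 2)) by (apply pow_lt; lra).
    field. repeat split; lra.
Qed.

(** The factor [X / (1 - X)] is positive, so the principal power splits without crossing the cut. *)
Lemma legendre_integrand_eq (n : nat) (s : C) (x : R) : slit (1 - s) -> 0 < x < 1 ->
  legendre_integrand (- / INR n) s x
  = ((Rpower (x / (1 - x)) (- / INR n) / (1 - x))%R * kern n s x)%C.
Proof.
  intros Hs Hx. unfold legendre_integrand, kern.
  assert (Hne : RtoC (1 - x) <> 0) by (intros E; apply RtoC_inj in E; lra).
  replace (x * (1 - s * x) / (1 - x))%C with (RtoC (x / (1 - x)) * (1 - s * x))%C.
  2: { rewrite RtoC_div by lra. rewrite RtoC_minus in *. field. exact Hne. }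
  rewrite Cpower_scal.
  - rewrite RtoC_div by lra. rewrite RtoC_minus in *. field. exact Hne.
  - apply Rdiv_lt_0_compat; lra.
  - apply slit_neq_0, slit_segment; [exact Hs|lra].
Qed.

Lemma filterlim_Cmod {T : Type} (F : (T -> Prop) -> Prop) {FF : Filter F} (f : T -> C) (l : C) :
  (forall e, 0 < e -> F (fun t => Cmod (f t - l) < e)) ->
  @filterlim T C f F (@locally C_UniformSpace l).
Proof.
  intros H P [e He]. unfold filtermap. generalize (H e (cond_pos e)).
  apply filter_imp. intros t Ht. apply He.
  exact (C_NormedModule_mixin_compat1 l (f t) e Ht).
Qed.

Lemma cderive_comp (G : R -> C) (U : R -> R) (x u' : R) (l : C) :
  cderive G (U x) l -> is_derive U x u' -> cderive (fun r => G (U r)) x (u' * l)%C.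
Proof.
  intros [H1 H2] HU. split.
  - eapply is_derive_eq; [exact (is_derive_comp _ _ _ _ _ H1 HU)|].
    unfold scal; simpl; unfold mult; simpl; unfold Re, Im; ring.
  - eapply is_derive_eq; [exact (is_derive_comp _ _ _ _ _ H2 HU)|].
    unfold scal; simpl; unfold mult; simpl; unfold Re, Im; ring.
Qed.

Lemma cderive_cint_upper (g : R -> C) (a b v : R) : a < v < b -> ccont_on g a b ->
  cderive (fun v => cint g a v) v (g v).
Proof.
  intros Hv Hg.
  assert (L : locally v (fun w => a < w < b)) by (apply locally_interval with a b; simpl; tauto).
  assert (I : forall w, a < w < b -> ccont_on g a w) by (intros w Hw u Hu; apply Hg; lra).
  split; simpl.
  - apply (is_derive_RInt (fun u => Re (g u)) _ a).
    + revert L; apply filter_imp. intros w Hw. apply (@RInt_correct R_CompleteNormedModule).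
      refine (proj1 (ccont_on_ex_RInt g a w _ (I w Hw))); lra.
    + refine (proj1 (Hg v _)); lra.
  - apply (is_derive_RInt (fun u => Im (g u)) _ a).
    + revert L; apply filter_imp. intros w Hw. apply (@RInt_correct R_CompleteNormedModule).
      refine (proj2 (ccont_on_ex_RInt g a w _ (I w Hw))); lra.
    + refine (proj2 (Hg v _)); lra.
Qed.

Lemma cint_Chasles (g : R -> C) (a b c : R) : a <= b -> b <= c -> ccont_on g a c ->
  (cint g a b + cint g b c = cint g a c)%C.
Proof.
  intros Hab Hbc Hg.
  assert (H1 : ccont_on g a b) by (intros u Hu; apply Hg; lra).
  assert (H2 : ccont_on g b c) by (intros u Hu; apply Hg; lra).
  destruct (ccont_on_ex_RInt g a b Hab H1), (ccont_on_ex_RInt g b c Hbc H2).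
  apply C_eq; simpl; now apply (@RInt_Chasles R_CompleteNormedModule).
Qed.

Lemma ccont_on_bounded (g : R -> C) (a b : R) : ccont_on g a b ->
  exists K, 0 < K /\ forall u, a <= u <= b -> Cmod (g u) <= K.
Proof.
  intros Hg.
  destruct (@bounded_continuity R_AbsRing R_NormedModule (fun u => Cmod (g u)) a b) as [K HK].
  { intros x Hx. exact (ccont_Cmod g x (Hg x Hx)). }
  exists (Rmax K 1). split; [apply Rlt_le_trans with 1; [lra|apply Rmax_r]|].
  intros u Hu. apply Rle_trans with K; [|apply Rmax_l].
  left. apply Rle_lt_trans with (2 := HK u Hu). apply Rle_abs.
Qed.

Lemma ccont_mw_kern (n : nat) (s : C) : slit (1 - s) ->
  ccont_on (fun u => mw n u * kern n s (Xf n u))%C 0 1.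
Proof.
  intros Hs. apply (ccont_int_kern n s Hs (fun u => RtoC (mw n u))).
  intros u Hu. now apply (ccont_RtoC (mw n)), continuous_mw.
Qed.

Lemma is_RInt_legendre (n : nat) (s : C) (a b : R) : (2 <= n)%nat -> slit (1 - s) ->
  0 < a < 1 -> 0 < b < 1 ->
  @is_RInt C_R_NormedModule (legendre_integrand (- / INR n) s) a b
    (cint (fun u => mw n u * kern n s (Xf n u))%C 0 (Uinv n b)
     - cint (fun u => mw n u * kern n s (Xf n u))%C 0 (Uinv n a))%C.
Proof.
  intros Hn Hs Ha Hb. set (g := fun u => (mw n u * kern n s (Xf n u))%C).
  assert (Hg : ccont_on g 0 1) by now apply ccont_mw_kern.
  set (rho := fun x => Rpower (x / (1 - x)) (- / INR n) / (1 - x)).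
  assert (Hr : forall x, 0 < x < 1 -> 0 < rho x).
  { intros x Hx. apply Rdiv_lt_0_compat; [apply exp_pos|lra]. }
  assert (HE : forall x, 0 < x < 1 -> legendre_integrand (- / INR n) s x = (rho x * kern n s x)%C).
  { intros x Hx. now apply legendre_integrand_eq. }
  assert (HL : forall x, 0 < x < 1 -> locally x (fun x => 0 < x < 1)).
  { intros x Hx. apply locally_interval with 0 1; simpl; tauto. }
  (* The substitution enters as a primitive: in the chain rule the factor [mw] of the new integrand
     cancels the one in the derivative of [Uinv]. *)
  assert (HD : forall x, 0 < x < 1 ->
    cderive (fun x => cint g 0 (Uinv n x)) x (legendre_integrand (- / INR n) s x)).
  { intros x Hx. destruct (Uinv_bounds n x Hn Hx) as [HU _].
    destruct (Xf_Uinv n x Hn Hx) as [HQ HX]. assert (Hn2 := INR_ge_2 n Hn).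
    eapply cderive_eq.
    - apply (cderive_comp (fun v => cint g 0 v)).
      + apply cderive_cint_upper with 1; [lra|exact Hg].
      + now apply is_derive_Uinv.
    - rewrite HE by exact Hx. unfold g. rewrite HX. fold (rho x).
      assert (Hm : mw n (Uinv n x) <> 0).
      { unfold mw. apply Rgt_not_eq, Rdiv_lt_0_compat; [|apply Qd_pos; lra].
        apply Rmult_lt_0_compat; [lra|apply pow_lt; lra]. }
      rewrite RtoC_div by exact Hm. field. intros E; apply Hm. now apply RtoC_inj. }
  assert (HC : forall x, 0 < x < 1 -> ccont (legendre_integrand (- / INR n) s) x).
  { intros x Hx. apply ccont_ext_loc with (fun x => rho x * kern n s x)%C.
    - generalize (HL x Hx). apply filter_imp. intros y Hy. symmetry. now apply HE.
    - apply (ccont_mult (fun x => RtoC (rho x)) (fun x => kern n s x)).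
      + apply (ccont_RtoC rho). apply continuous_of_derivable. unfold rho, Rpower.
        auto_derive. change (1 + - x) with (1 - x).
        repeat split; try lra. apply Rdiv_lt_0_compat; lra.
      + apply (ccont_kern n (fun _ => s) (fun x => x)).
        * apply slit_segment; [exact Hs|lra].
        * apply ccont_const.
        * apply continuous_id. }
  assert (HI : forall x, Rmin a b <= x <= Rmax a b -> 0 < x < 1).
  { intros x Hx. unfold Rmin, Rmax in Hx. destruct (Rle_dec a b); lra. }
  apply (@is_RInt_fct_extend_pair R_NormedModule R_NormedModule).
  - apply (is_RInt_derive (fun x => Re (cint g 0 (Uinv n x)))
      (fun x => Re (legendre_integrand (- / INR n) s x))); intros x Hx.
    + exact (proj1 (HD x (HI x Hx))).
    + exact (proj1 (HC x (HI x Hx))).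
  - apply (is_RInt_derive (fun x => Im (cint g 0 (Uinv n x)))
      (fun x => Im (legendre_integrand (- / INR n) s x))); intros x Hx.
    + exact (proj2 (HD x (HI x Hx))).
    + exact (proj2 (HC x (HI x Hx))).
Qed.

Lemma legendre_integral_J (n : nat) (s : C) : (2 <= n)%nat -> slit (1 - s) ->
  legendre_integral (- / INR n) s = J n s.
Proof.
  intros Hn Hs. unfold legendre_integral.
  apply (@is_RInt_gen_unique C_R_CompleteNormedModule); try typeclasses eauto.
  set (g := fun u => (mw n u * kern n s (Xf n u))%C).
  assert (Hg : ccont_on g 0 1) by now apply ccont_mw_kern.
  assert (HR : at_right 0 (fun x => 0 < x < 1)).
  { apply locally_interval with (-1) 1; simpl; intros; lra. }
  assert (HL : at_left 1 (fun x => 0 < x < 1)).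
  { apply locally_interval with 0 2; simpl; intros; lra. }
  unfold is_RInt_gen.
  apply (filterlimi_lim_ext_loc (F := filter_prod (at_right 0) (at_left 1))
    (fun ab : R * R => (cint g 0 (Uinv n (snd ab)) - cint g 0 (Uinv n (fst ab)))%C)).
  - apply Filter_prod with (1 := HR) (2 := HL). intros a b Ha Hb. now apply is_RInt_legendre.
  - apply filterlim_Cmod; [typeclasses eauto|]. intros e He.
    destruct (ccont_on_bounded g 0 1 Hg) as [K [HK0 HK]].
    (* The two missing pieces of [J] have length less than [d], hence contribute at most [2 d K]
       each. *)
    set (d := e / (8 * K)). assert (Hd : 0 < d) by (apply Rdiv_lt_0_compat; lra).
    assert (Hdn : 0 < d ^ n) by now apply pow_lt.
    assert (HR' : at_right 0 (fun x => 0 < x < 1 /\ Rpower x (/ INR n) < d)).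
    { apply (filter_and _ _ HR). apply locally_interval with (-1) (d ^ n); simpl; try lra.
      intros y H1 H2 H3. apply Rpower_root_small; trivial. lra. }
    assert (HL' : at_left 1 (fun x => 0 < x < 1 /\ Rpower (1 - x) (/ INR n) < d)).
    { apply (filter_and _ _ HL). apply locally_interval with (1 - d ^ n) 2; simpl; try lra.
      intros y H1 H2 H3. apply Rpower_root_small; trivial. lra. }
    apply Filter_prod with (1 := HR') (2 := HL'). intros a b [Ha Ha'] [Hb Hb']. simpl.
    destruct (Uinv_bounds n a Hn Ha) as [U1 [U2 _]].
    destruct (Uinv_bounds n b Hn Hb) as [U3 [_ U4]].
    change (J n s) with (cint g 0 1).
    rewrite <- (cint_Chasles g 0 (Uinv n b) 1) by (lra || assumption).
    replace (_ - _ - _)%C with (- (cint g 0 (Uinv n a) + cint g (Uinv n b) 1))%C by ring.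
    rewrite Cmod_opp. eapply Rle_lt_trans; [apply Cmod_triangle|].
    assert (B1 : Cmod (cint g 0 (Uinv n a)) <= 2 * ((Uinv n a - 0) * K)).
    { apply Cmod_cint_le; [lra|intros u Hu; apply Hg; lra|intros u Hu; apply HK; lra]. }
    assert (B2 : Cmod (cint g (Uinv n b) 1) <= 2 * ((1 - Uinv n b) * K)).
    { apply Cmod_cint_le; [lra|intros u Hu; apply Hg; lra|intros u Hu; apply HK; lra]. }
    assert (E : e = 8 * (d * K)) by (unfold d; field; lra).
    assert (Uinv n a * K <= d * K) by (apply Rmult_le_compat_r; lra).
    assert ((1 - Uinv n b) * K <= d * K) by (apply Rmult_le_compat_r; lra).
    assert (0 < d * K) by now apply Rmult_lt_0_compat. lra.
Qed.

(** * Complex power series with real coefficients *)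

Definition CSeries (u : nat -> C) : C :=
  (Series (fun k => Re (u k)), Series (fun k => Im (u k))).

Definition cex (u : nat -> C) : Prop :=
  ex_series (fun k => Re (u k)) /\ ex_series (fun k => Im (u k)).

Definition PS (c : nat -> R) (z : C) : C := CSeries (fun k => c k * z ^ k)%C.

(* Radius of convergence at least [1]. *)
Definition ok (c : nat -> R) : Prop :=
  forall rho, 0 <= rho < 1 -> exists K, forall k, Rabs (c k) * rho ^ k <= K.

Lemma ok_bounded (c : nat -> R) (K : R) : (forall k, Rabs (c k) <= K) -> ok c.
Proof.
  intros H rho Hr. exists K. intros k.
  assert (rho ^ k <= 1).
  { rewrite <- (pow1 k). apply pow_incr; lra. }
  assert (0 <= rho ^ k) by (apply pow_le; lra).
  assert (Hk := H k). assert (Hp := Rabs_pos (c k)). nra.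
Qed.

Lemma ok_plus (c d : nat -> R) : ok c -> ok d -> ok (fun k => c k + d k).
Proof.
  intros Hc Hd rho Hr. destruct (Hc rho Hr) as [K HK], (Hd rho Hr) as [K' HK'].
  exists (K + K'). intros k. assert (0 <= rho ^ k) by (apply pow_le; lra).
  assert (T := Rabs_triang (c k) (d k)). specialize (HK k). specialize (HK' k). nra.
Qed.

Lemma ok_scal (x : R) (c : nat -> R) : ok c -> ok (fun k => x * c k).
Proof.
  intros Hc rho Hr. destruct (Hc rho Hr) as [K HK].
  exists (Rabs x * K). intros k. rewrite Rabs_mult, Rmult_assoc.
  apply Rmult_le_compat_l; [apply Rabs_pos|apply HK].
Qed.

(* Coefficients of [z d/dz]. *)
Definition th (c : nat -> R) (k : nat) : R := INR k * c k.

(** A little radius is traded for the factor [k]: Bernoulli's inequality [poly] gives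
    [k h <= (rho' / rho)^k] with [h = rho' / rho - 1]. *)
Lemma ok_th (c : nat -> R) : ok c -> ok (th c).
Proof.
  intros Hc rho Hr. set (rho' := (1 + rho) / 2).
  destruct (Hc rho' ltac:(unfold rho'; lra)) as [K HK].
  destruct (Req_dec rho 0) as [E|E].
  { exists 0. intros [|k]; unfold th; simpl; [rewrite Rmult_0_l, Rabs_R0; lra|].
    rewrite E. rewrite Rmult_0_l; lra. }
  set (h := rho' / rho - 1).
  assert (Hh : 0 < h).
  { unfold h. apply (proj2 (Rlt_0_minus _ _)). apply Rmult_lt_reg_r with rho; [lra|].
    unfold Rdiv. rewrite Rmult_assoc, Rinv_l by lra. unfold rho'. lra. }
  exists (K / h). intros k.
  assert (HB := poly k h Hh).
  assert (Ep : rho' ^ k = rho ^ k * (1 + h) ^ k).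
  { rewrite <- Rpow_mult_distr. f_equal. unfold h. field. exact E. }
  specialize (HK k). rewrite Ep in HK.
  assert (0 <= rho ^ k) by (apply pow_le; lra).
  unfold th. rewrite Rabs_mult, (Rabs_pos_eq (INR k)) by apply pos_INR.
  apply Rmult_le_reg_r with h; [exact Hh|].
  unfold Rdiv. rewrite Rmult_assoc, (Rmult_assoc K), Rinv_l, Rmult_1_r by lra.
  apply Rle_trans with (2 := HK).
  assert (Hi := pos_INR k). assert (0 <= Rabs (c k) * rho ^ k).
  { apply Rmult_le_pos; [apply Rabs_pos|assumption]. }
  replace (Rabs (c k) * (rho ^ k * (1 + h) ^ k)) with
    (Rabs (c k) * rho ^ k * (1 + h) ^ k) by ring.
  replace (INR k * Rabs (c k) * (rho ^ k * h)) with
    (Rabs (c k) * rho ^ k * (INR k * h)) by ring.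
  apply Rmult_le_compat_l; [assumption|lra].
Qed.

Lemma ok_shift (c : nat -> R) : ok c -> ok (fun k => c (S k)).
Proof.
  (* Keeping [r] at least [1/2] makes the division by [r] caused by the shift cost a factor 2 only,
     even for [rho = 0]. *)
  intros Hc rho Hr. set (r := Rmax rho (/ 2)).
  assert (Hr' : / 2 <= r < 1).
  { unfold r, Rmax. destruct (Rle_dec rho (/ 2)); lra. }
  destruct (Hc r ltac:(lra)) as [K HK]. exists (2 * K). intros k.
  specialize (HK (S k)). simpl in HK.
  assert (rho ^ k <= r ^ k). { apply pow_incr. split; [lra|apply Rmax_l]. }
  assert (0 <= rho ^ k) by (apply pow_le; lra).
  assert (Hp := Rabs_pos (c (S k))).
  apply Rle_trans with (Rabs (c (S k)) * r ^ k).
  - now apply Rmult_le_compat_l.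
  - assert (0 <= Rabs (c (S k)) * r ^ k) by (apply Rmult_le_pos; [assumption|apply pow_le; lra]).
    nra.
Qed.

Lemma ok_ex_series (c : nat -> R) (rho : R) : ok c -> 0 <= rho < 1 ->
  ex_series (fun k => Rabs (c k) * rho ^ k).
Proof.
  intros Hc Hr. set (r := (1 + rho) / 2). assert (Hr' : rho < r < 1) by (unfold r; lra).
  destruct (Hc r ltac:(lra)) as [K HK].
  apply (@ex_series_le R_AbsRing R_CompleteNormedModule) with (fun k => K * (rho / r) ^ k).
  - intros k. change (Rabs (Rabs (c k) * rho ^ k) <= K * (rho / r) ^ k).
    assert (0 <= rho ^ k) by (apply pow_le; lra).
    assert (0 < r ^ k) by (apply pow_lt; lra).
    rewrite Rabs_pos_eq by (apply Rmult_le_pos; [apply Rabs_pos|assumption]).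
    unfold Rdiv. rewrite Rpow_mult_distr, pow_inv.
    specialize (HK k). apply Rmult_le_reg_r with (r ^ k); [assumption|].
    replace (K * (rho ^ k * / r ^ k) * r ^ k) with (K * rho ^ k) by (field; lra).
    nra.
  - apply (@ex_series_scal R_AbsRing R_NormedModule). apply ex_series_geom.
    rewrite Rabs_pos_eq by (apply Rle_mult_inv_pos; lra).
    apply Rmult_lt_reg_r with r; [lra|]. unfold Rdiv. rewrite Rmult_assoc, Rinv_l; lra.
Qed.

Lemma cex_le (u : nat -> C) (b : nat -> R) : (forall k, Cmod (u k) <= b k) -> ex_series b -> cex u.
Proof.
  intros H Hb. split; apply (@ex_series_le R_AbsRing R_CompleteNormedModule) with b; trivial;
    intros k; apply Rle_trans with (2 := H k); [apply re_le_Cmod|apply im_le_Cmod].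
Qed.

Lemma Cmod_CSeries_le (u : nat -> C) (b : nat -> R) :
  (forall k, Cmod (u k) <= b k) -> ex_series b -> Cmod (CSeries u) <= 2 * Series b.
Proof.
  intros H Hb. eapply Rle_trans; [apply Cmod_le_re_im|]. simpl.
  assert (A : forall f : nat -> R, (forall k, Rabs (f k) <= b k) -> Rabs (Series f) <= Series b).
  { intros f Hf. apply Rle_trans with (Series (fun k => Rabs (f k))).
    - apply Series_Rabs. apply (@ex_series_le R_AbsRing R_CompleteNormedModule) with b; trivial.
      intros k. change (Rabs (Rabs (f k)) <= b k). rewrite Rabs_Rabsolu. apply Hf.
    - apply Series_le; trivial. intros k. split; [apply Rabs_pos|apply Hf]. }
  assert (Rabs (Series (fun k => Re (u k))) <= Series b).
  { apply A. intros k. apply Rle_trans with (2 := H k), re_le_Cmod. }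
  assert (Rabs (Series (fun k => Im (u k))) <= Series b).
  { apply A. intros k. apply Rle_trans with (2 := H k), im_le_Cmod. }
  unfold Re, Im in *. lra.
Qed.

Lemma CSeries_ext (u v : nat -> C) : (forall k, u k = v k) -> CSeries u = CSeries v.
Proof. intros H. unfold CSeries. f_equal; apply Series_ext; intros k; now rewrite H. Qed.

Lemma CSeries_plus (u v : nat -> C) : cex u -> cex v ->
  CSeries (fun k => u k + v k)%C = (CSeries u + CSeries v)%C.
Proof. intros [H1 H2] [H3 H4]. apply C_eq; simpl; now apply Series_plus. Qed.

Lemma CSeries_scal (z : C) (u : nat -> C) : cex u -> CSeries (fun k => z * u k)%C = (z * CSeries u)%C.
Proof.
  intros [H1 H2].
  assert (S1 : forall x (f : nat -> R), ex_series f -> ex_series (fun k => x * f k)).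
  { intros x f Hf. now apply (@ex_series_scal R_AbsRing R_NormedModule). }
  apply C_eq; simpl.
  - transitivity (Series (fun k => fst z * Re (u k) - snd z * Im (u k))); [reflexivity|].
    rewrite Series_minus by now apply S1. now rewrite !Series_scal_l.
  - transitivity (Series (fun k => fst z * Im (u k) + snd z * Re (u k))); [reflexivity|].
    rewrite Series_plus by now apply S1. now rewrite !Series_scal_l.
Qed.

Lemma cex_scal (z : C) (u : nat -> C) : cex u -> cex (fun k => z * u k)%C.
Proof.
  intros [H1 H2].
  assert (S1 : forall x (f : nat -> R), ex_series f -> ex_series (fun k => x * f k)).
  { intros x f Hf. now apply (@ex_series_scal R_AbsRing R_NormedModule). }
  split; simpl.
  - apply (@ex_series_minus R_AbsRing R_NormedModule (fun k => fst z * Re (u k)) (fun k => snd z * Im (u k)));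
      now apply S1.
  - apply (@ex_series_plus R_AbsRing R_NormedModule (fun k => fst z * Im (u k)) (fun k => snd z * Re (u k)));
      now apply S1.
Qed.

Lemma Cmod_coef (c : nat -> R) (z : C) (k : nat) : Cmod (c k * z ^ k) = Rabs (c k) * Cmod z ^ k.
Proof. now rewrite Cmod_mult, Cmod_R, Cmod_pow. Qed.

Lemma cex_PS (c : nat -> R) (z : C) : ok c -> Cmod z < 1 -> cex (fun k => c k * z ^ k)%C.
Proof.
  intros Hc Hz. apply cex_le with (fun k => Rabs (c k) * Cmod z ^ k).
  - intros k. right. apply Cmod_coef.
  - apply ok_ex_series; [exact Hc|]. split; [apply Cmod_ge_0|exact Hz].
Qed.

Lemma PS_ext (c d : nat -> R) (z : C) : (forall k, c k = d k) -> PS c z = PS d z.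
Proof. intros H. apply CSeries_ext. intros k. now rewrite H. Qed.

Lemma PSeval_plus (c d : nat -> R) (z : C) : ok c -> ok d -> Cmod z < 1 ->
  PS (fun k => c k + d k) z = (PS c z + PS d z)%C.
Proof.
  intros Hc Hd Hz. unfold PS. rewrite <- CSeries_plus by now apply cex_PS.
  apply CSeries_ext. intros k. rewrite RtoC_plus. ring.
Qed.

Lemma PSeval_scal (x : R) (c : nat -> R) (z : C) : ok c -> Cmod z < 1 ->
  PS (fun k => x * c k) z = (x * PS c z)%C.
Proof.
  intros Hc Hz. unfold PS. rewrite <- CSeries_scal by now apply cex_PS.
  apply CSeries_ext. intros k. rewrite RtoC_mult. ring.
Qed.

Lemma PS_shift (c : nat -> R) (z : C) : ok c -> Cmod z < 1 ->
  PS c z = (c 0%nat + z * PS (fun k => c (S k)) z)%C.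
Proof.
  intros Hc Hz. unfold PS.
  assert (H := cex_PS c z Hc Hz). assert (H' := cex_PS _ z (ok_shift c Hc) Hz). cbv beta in H'.
  rewrite <- CSeries_scal by exact H'. destruct H as [H1 H2].
  apply C_eq; simpl; (rewrite Series_incr_1 by assumption); simpl; f_equal;
    try apply Series_ext; intros; simpl; unfold Re, Im; simpl; ring.
Qed.

(** The remainder obeys [e_(k+1) = w e_k + k z^(k-1) (w - z)^2], which gives the bound by induction.
    The derivative is written [k z^k / z] and the bound is multiplied by [rho^2], so that no
    exponent drops below [0]. *)
Lemma Cpow_remainder (z w : C) (rho : R) (k : nat) : z <> 0 -> 0 < rho ->
  Cmod z <= rho -> Cmod w <= rho ->
  rho * rho * Cmod (w ^ k - z ^ k - INR k * z ^ k / z * (w - z))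
  <= INR k * INR k * rho ^ k * (Cmod (w - z) * Cmod (w - z)).
Proof.
  intros Hz Hr Hzr Hwr. induction k as [|k IH].
  - replace (w ^ 0 - z ^ 0 - INR 0 * z ^ 0 / z * (w - z))%C with (RtoC 0)
      by (simpl; field; exact Hz).
    rewrite Cmod_0. simpl. lra.
  - set (e := (w ^ k - z ^ k - INR k * z ^ k / z * (w - z))%C) in *.
    replace (w ^ S k - z ^ S k - INR (S k) * z ^ S k / z * (w - z))%C
      with (w * e + INR k * z ^ k / z * ((w - z) * (w - z)))%C.
    2: { unfold e. rewrite S_INR, RtoC_plus, !Cpow_S. field. exact Hz. }
    set (d := Cmod (w - z)) in *.
    assert (Hd : 0 <= d) by apply Cmod_ge_0.
    assert (Hi := pos_INR k).
    assert (H1 : rho * rho * Cmod (w * e) <= rho * (INR k * INR k * rho ^ k * (d * d))).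
    { rewrite Cmod_mult. assert (He := Cmod_ge_0 e). assert (Hw := Cmod_ge_0 w).
      apply Rle_trans with (rho * (rho * rho * Cmod e)); [|now apply Rmult_le_compat_l; [lra|]].
      assert (0 <= rho * rho * Cmod e) by (apply Rmult_le_pos; [nra|assumption]). nra. }
    assert (H2 : rho * rho * Cmod (INR k * z ^ k / z * ((w - z) * (w - z)))
      <= INR k * rho * rho ^ k * (d * d)).
    { destruct k as [|k].
      { simpl INR. replace (0 * z ^ 0 / z * ((w - z) * (w - z)))%C with (RtoC 0)
          by (field; exact Hz). rewrite Cmod_0. lra. }
      replace (INR (S k) * z ^ S k / z * ((w - z) * (w - z)))%C
        with (INR (S k) * z ^ k * ((w - z) * (w - z)))%C by (rewrite Cpow_S; field; exact Hz).
      rewrite !Cmod_mult, Cmod_R, Cmod_pow, Rabs_pos_eq by exact Hi. fold d.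
      assert (Cmod z ^ k <= rho ^ k) by (apply pow_incr; split; [apply Cmod_ge_0|assumption]).
      simpl pow.
      replace (INR (S k) * rho * (rho * rho ^ k) * (d * d))
        with (rho * rho * (INR (S k) * rho ^ k * (d * d))) by ring.
      apply Rmult_le_compat_l; [nra|]. apply Rmult_le_compat_r; [nra|].
      now apply Rmult_le_compat_l. }
    assert (T := Cmod_triangle (w * e) (INR k * z ^ k / z * ((w - z) * (w - z)))).
    assert (0 <= rho * rho ^ k * (d * d)).
    { apply Rmult_le_pos; [apply Rmult_le_pos; [lra|apply pow_le; lra]|nra]. }
    rewrite S_INR. simpl pow.
    apply Rle_trans with (rho * rho * Cmod (w * e)
      + rho * rho * Cmod (INR k * z ^ k / z * ((w - z) * (w - z)))); nra.
Qed.

(** A termwise second-order bound; the factors [k^2] are summable because [th (th c)] is again [ok].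
    Differentiability of the series follows by comparison with a quadratic. *)
Lemma PS_quadratic (c : nat -> R) (rho : R) : ok c -> 0 < rho < 1 ->
  exists B, forall z w : C, z <> 0 -> Cmod z <= rho -> Cmod w <= rho ->
  Cmod (PS c w - PS c z - PS (th c) z / z * (w - z))
  <= B * (Cmod (w - z) * Cmod (w - z)).
Proof.
  intros Hc Hr.
  assert (Hok : ok (th c)) by now apply ok_th.
  assert (Hok2 := ok_th _ Hok).
  assert (Hs := ok_ex_series _ rho Hok2 ltac:(lra)).
  exists (2 * Series (fun k => Rabs (th (th c) k) * rho ^ k) / (rho * rho)).
  intros z w Hz Hzr Hwr.
  assert (Cz := cex_PS c z Hc ltac:(lra)). assert (Cw := cex_PS c w Hc ltac:(lra)).
  assert (Ck := cex_PS _ z Hok ltac:(lra)). 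
  set (d := Cmod (w - z)).
  replace (PS c w - PS c z - PS (th c) z / z * (w - z))%C
    with (CSeries (fun k => c k * (w ^ k - z ^ k - INR k * z ^ k / z * (w - z)))%C).
  2: { transitivity (CSeries (fun k => (c k * w ^ k + - (1) * (c k * z ^ k))
         + (- ((w - z) / z) * (th c k * z ^ k)))%C).
       { apply CSeries_ext. intros k. unfold th. rewrite RtoC_mult. field. exact Hz. }
       rewrite CSeries_plus, CSeries_plus, !CSeries_scal; trivial.
       - unfold PS. field. exact Hz.
       - now apply cex_scal.
       - destruct Cw as [P1 P2], (cex_scal (- (1)) _ Cz) as [P3 P4].
         split; [exact (@ex_series_plus R_AbsRing R_NormedModule _ _ P1 P3)
           |exact (@ex_series_plus R_AbsRing R_NormedModule _ _ P2 P4)].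
       - now apply cex_scal. }
  eapply Rle_trans.
  - apply (Cmod_CSeries_le _ (fun k => (d * d / (rho * rho)) *
      (Rabs (th (th c) k) * rho ^ k))).
    + intros k. rewrite Cmod_mult, Cmod_R.
      assert (E := Cpow_remainder z w rho k Hz ltac:(lra) Hzr Hwr). fold d in E.
      unfold th. rewrite !Rabs_mult, !(Rabs_pos_eq (INR k)) by apply pos_INR.
      apply Rmult_le_reg_l with (rho * rho); [nra|].
      replace (rho * rho * (d * d / (rho * rho) * (INR k * (INR k * Rabs (c k)) * rho ^ k)))
        with (Rabs (c k) * (INR k * INR k * rho ^ k * (d * d))) by (field; lra).
      replace (rho * rho * (Rabs (c k) * Cmod (w ^ k - z ^ k - INR k * z ^ k / z * (w - z))))
        with (Rabs (c k) * (rho * rho * Cmod (w ^ k - z ^ k - INR k * z ^ k / z * (w - z)))) by ring.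
      apply Rmult_le_compat_l; [apply Rabs_pos|exact E].
    + now apply (@ex_series_scal R_AbsRing R_NormedModule).
  - rewrite Series_scal_l. right. field. lra.
Qed.

Lemma is_derive_squeeze (h phi : R -> R) (x : R) :
  locally x (fun r => Rabs (h r) <= phi r) -> phi x = 0 -> is_derive phi x 0 -> is_derive h x 0.
Proof.
  intros HL H0 Hphi. apply is_derive_Reals. apply is_derive_Reals in Hphi.
  assert (Hx := locally_singleton _ _ HL). cbv beta in Hx. rewrite H0 in Hx.
  assert (E0 : h x = 0). { assert (P := Rabs_pos (h x)). apply Rabs_eq_0. lra. }
  intros eps He. destruct (Hphi eps He) as [d1 H1]. destruct HL as [d2 H2].
  exists (mkposreal _ (Rmin_pos _ _ (cond_pos d1) (cond_pos d2))). simpl.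
  intros t Ht0 Ht.
  assert (B1 : Rabs t < d1) by (apply Rlt_le_trans with (1 := Ht), Rmin_l).
  assert (B2 : Rabs t < d2) by (apply Rlt_le_trans with (1 := Ht), Rmin_r).
  specialize (H1 t Ht0 B1). rewrite H0, !Rminus_0_r in H1. rewrite E0, !Rminus_0_r.
  apply Rle_lt_trans with (2 := H1). unfold Rdiv. rewrite !Rabs_mult.
  apply Rmult_le_compat_r; [apply Rabs_pos|].
  apply Rle_trans with (phi (x + t)); [|apply Rle_abs].
  apply H2. change (Rabs (x + t - x) < d2). now replace (x + t - x) with t by ring.
Qed.

Lemma cderive_PS (c : nat -> R) (g : R -> C) (x : R) (g' : C) : ok c ->
  Cmod (g x) < 1 -> g x <> 0 -> cderive g x g' ->
  cderive (fun r => PS c (g r)) x (g' * PS (th c) (g x) / g x)%C.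
Proof.
  intros Hc H1 H0 Hg. assert (Hgc := cderive_ccont _ _ _ Hg).
  set (rho := (1 + Cmod (g x)) / 2). assert (Hp := Cmod_ge_0 (g x)).
  assert (Hr : 0 < rho < 1 /\ Cmod (g x) < rho) by (unfold rho; lra).
  destruct (PS_quadratic c rho Hc (proj1 Hr)) as [B HB].
  set (D := (PS (th c) (g x) / g x)%C) in *.
  set (rem := fun r => (PS c (g r) - PS c (g x) - D * (g r - g x))%C).
  assert (HL : locally x (fun r => Cmod (g r) < rho)).
  { exact (ccont_Cmod g x Hgc (fun y => y < rho) (open_lt rho _ (proj2 Hr))). }
  set (phi := fun r => B * ((Re (g r) - Re (g x)) * (Re (g r) - Re (g x))
    + (Im (g r) - Im (g x)) * (Im (g r) - Im (g x)))).
  assert (Hb : locally x (fun r => Cmod (rem r) <= phi r)).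
  { revert HL; apply filter_imp. intros r Hgr. unfold rem, phi.
    eapply Rle_trans; [apply HB; trivial; lra|]. rewrite Cmod_sqr. right. reflexivity. }
  assert (Hphi : is_derive phi x 0).
  { destruct Hg as [D1 D2].
    pose (u := fun r : R => Re (g r)). pose (v := fun r : R => Im (g r)).
    change (is_derive u x (Re g')) in D1. change (is_derive v x (Im g')) in D2.
    apply is_derive_ext with (fun r => B * ((u r - u x) * (u r - u x) + (v r - v x) * (v r - v x))).
    { reflexivity. }
    auto_derive; [repeat split; eexists; eassumption|].
    ring. }
  assert (Hphi0 : phi x = 0) by (unfold phi; ring).
  assert (Hrem : cderive rem x 0).
  { split; (apply is_derive_squeeze with phi; trivial); revert Hb; apply filter_imp; intros r Hrr;
      apply Rle_trans with (2 := Hrr); [apply re_le_Cmod|apply im_le_Cmod]. }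
  apply cderive_ext with (fun r => rem r + (PS c (g x) + D * (g r - g x)))%C.
  { intros r. unfold rem. ring. }
  eapply cderive_eq.
  - apply cderive_plus; [exact Hrem|]. apply cderive_plus; [apply cderive_const|].
    apply cderive_scal. apply cderive_minus; [exact Hg|apply cderive_const].
  - unfold D. field. exact H0.
Qed.

(** * Coefficients and their decay *)

Definition qn (n : nat) : R := / INR n * (1 - / INR n).

Lemma inv_INR_bound (n : nat) : (2 <= n)%nat -> 0 < / INR n <= / 2.
Proof.
  intros Hn. assert (H := INR_ge_2 n Hn).
  split; [apply Rinv_0_lt_compat; lra|apply Rinv_le_contravar; lra].
Qed.

Lemma qn_bound (n : nat) : (2 <= n)%nat -> 0 < qn n <= / 4.
Proof.
  intros Hn. assert (H := inv_INR_bound n Hn). unfold qn. set (p := / INR n) in *. nra.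
Qed.

(** [ca q] are the Taylor coefficients of [P_nu(1-2t)] for [q = - nu (nu + 1)], and
    [cL q k = sum_(j < k) (1/(j - nu) + 1/(j + 1 + nu))]. *)
Fixpoint ca (q : R) (k : nat) : R :=
  match k with
  | O => 1
  | S k => ca q k * (INR k * INR k + INR k + q) / (INR (S k) * INR (S k))
  end.

Fixpoint cL (q : R) (k : nat) : R :=
  match k with
  | O => 0
  | S k => cL q k + (2 * INR k + 1) / (INR k * INR k + INR k + q)
  end.

Definition caL (q : R) (k : nat) : R := ca q k * cL q k.
Definition caH (q : R) (k : nat) : R := ca q k * harmonic k.

Lemma harmonic_S (k : nat) : harmonic (S k) = harmonic k + / INR (S k).
Proof. unfold harmonic. rewrite sum_n_Sm by lia. reflexivity. Qed.

Lemma harmonic_0 : harmonic 0 = 0.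
Proof. unfold harmonic. rewrite sum_n_m_zero by lia. reflexivity. Qed.

Lemma harmonic_1 : harmonic 1 = 1.
Proof. rewrite harmonic_S, harmonic_0. simpl. lra. Qed.

Lemma ca_pos (q : R) (k : nat) : 0 < q -> 0 < ca q k.
Proof.
  intros Hq. induction k as [|k IH]; [simpl; lra|].
  assert (Hi := pos_INR k). cbn [ca]. rewrite S_INR.
  apply Rdiv_lt_0_compat; nra.
Qed.

(** Since [q <= 1/4], the numerator [k^2 + k + q] is at most [(k + 1/2)^2], and the induction closes
    by [(2 k + 1) (2 k + 3) <= (2 k + 2)^2]. *)
Lemma ca_le (q : R) (k : nat) : 0 < q <= / 4 -> ca q k <= / (2 * INR k + 1).
Proof.
  intros Hq. induction k as [|k IH]; [simpl; lra|].
  assert (Hi := pos_INR k). assert (Hp := ca_pos q k (proj1 Hq)). cbn [ca]. rewrite S_INR.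
  set (x := INR k) in *.
  apply Rle_trans with (/ (2 * x + 1) * ((x + / 2) * (x + / 2)) / ((x + 1) * (x + 1))).
  - unfold Rdiv. apply Rmult_le_compat_r.
    { left. apply Rinv_0_lt_compat. nra. }
    apply Rmult_le_compat; try nra. 
  - apply Rmult_le_reg_r with ((2 * x + 1) * (2 * (x + 1) + 1) * ((x + 1) * (x + 1))).
    { repeat apply Rmult_lt_0_compat; lra. }
    field_simplify; [nra|lra|lra].
Qed.

(** The first summand of [cL] is [1 / q], already at least [4]. *)
Lemma cL_S_ge (q : R) (k : nat) : 0 < q <= / 4 -> 4 <= cL q (S k).
Proof.
  intros Hq. induction k as [|k IH].
  - simpl. apply Rmult_le_reg_r with q; [lra|]. field_simplify; lra.
  - cbn [cL]. cbn [cL] in IH. set (y := cL q k + _) in *.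
    assert (Hi := pos_INR (S k)).
    assert (0 < (2 * INR (S k) + 1) / (INR (S k) * INR (S k) + INR (S k) + q)).
    { apply Rdiv_lt_0_compat; nra. }
    lra.
Qed.

Lemma caL_nonneg (q : R) (k : nat) : 0 < q <= / 4 -> 0 <= caL q k.
Proof.
  intros Hq. unfold caL. assert (H := ca_pos q k (proj1 Hq)).
  destruct k; [simpl; lra|]. assert (H' := cL_S_ge q k Hq). nra.
Qed.

(** Amounts to [2 x + 1 <= l (x + 1 - q)], which follows from [l >= 4]. At index [0] the
    monotonicity fails, since [caL] starts with [0] and [1]; hence the shift by one. *)
Lemma caL_decr (q : R) (k : nat) : 0 < q <= / 4 -> caL q (S (S k)) <= caL q (S k).
Proof.
  intros Hq. unfold caL. assert (Ha := ca_pos q (S k) (proj1 Hq)).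
  assert (Hl := cL_S_ge q k Hq). set (m := S k) in *.
  cbn [ca cL]. rewrite S_INR. assert (Hi := pos_INR m).
  set (x := INR m) in *. set (a := ca q m) in *. set (l := cL q m) in *.
  replace (a * (x * x + x + q) / ((x + 1) * (x + 1)) * (l + (2 * x + 1) / (x * x + x + q)))
    with (a * (((x * x + x + q) * l + (2 * x + 1)) / ((x + 1) * (x + 1)))) by (field; nra).
  apply Rmult_le_compat_l; [lra|].
  apply Rmult_le_reg_r with ((x + 1) * (x + 1)); [nra|].
  unfold Rdiv. rewrite Rmult_assoc, Rinv_l by nra. nra.
Qed.

Lemma harmonic_S_ge_1 (k : nat) : 1 <= harmonic (S k).
Proof.
  induction k as [|k IH]; [rewrite harmonic_1; lra|]. rewrite harmonic_S.
  assert (0 < / INR (S (S k))) by (apply Rinv_0_lt_compat, lt_0_INR; lia). lra.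
Qed.

Lemma harmonic_nonneg (k : nat) : 0 <= harmonic k.
Proof. destruct k; [rewrite harmonic_0; lra|]. assert (H := harmonic_S_ge_1 k). lra. Qed.

(** Amounts to [x^2 + x + q <= l (x + 1) (x + 1 - q)], which follows from [l >= 1]. Again the
    sequence starts at [0], so only the terms from index [1] on decrease. *)
Lemma caH_decr (q : R) (k : nat) : 0 < q <= / 4 -> caH q (S (S k)) <= caH q (S k).
Proof.
  intros Hq. unfold caH. assert (Ha := ca_pos q (S k) (proj1 Hq)).
  assert (Hl := harmonic_S_ge_1 k). rewrite (harmonic_S (S k)).
  assert (Hi : 1 <= INR (S k)) by (rewrite S_INR; assert (P := pos_INR k); lra).
  set (m := S k) in *.
  cbn [ca]. rewrite S_INR.
  set (x := INR m) in *. set (a := ca q m) in *. set (l := harmonic m) in *.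
  replace (a * (x * x + x + q) / ((x + 1) * (x + 1)) * (l + / (x + 1)))
    with (a * (((x * x + x + q) * (l * (x + 1) + 1)) / ((x + 1) * (x + 1) * (x + 1))))
    by (field; nra).
  apply Rmult_le_compat_l; [lra|].
  apply Rmult_le_reg_r with ((x + 1) * (x + 1) * (x + 1)).
  { repeat apply Rmult_lt_0_compat; lra. }
  unfold Rdiv. rewrite Rmult_assoc, Rinv_l by (repeat apply Rmult_integral_contrapositive_currified; lra).
  rewrite Rmult_1_r.
  assert (0 <= (l - 1) * ((x + 1) * (x + 1 - q))) by (apply Rmult_le_pos; nra).
  nra.
Qed.

(** A crude bound is enough, because [ca] decays like [1 / k]. It telescopes from
    [1 / (k + 1) <= 2 (sqrt (k + 1) - sqrt k)]. *)
Lemma harmonic_le_sqrt (k : nat) : harmonic k <= 2 * sqrt (INR k).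
Proof.
  induction k as [|k IH].
  - rewrite harmonic_0. simpl. rewrite sqrt_0. lra.
  - rewrite harmonic_S, S_INR. assert (Hi := pos_INR k).
    set (x := INR k) in *.
    assert (H1 := sqrt_sqrt x Hi). assert (H2 := sqrt_sqrt (x + 1) ltac:(lra)).
    assert (H3 := sqrt_pos x). assert (H4 : 0 < sqrt (x + 1)) by (apply sqrt_lt_R0; lra).
    assert (H5 : sqrt x <= sqrt (x + 1)) by (apply sqrt_le_1; lra).
    assert (H6 : / (x + 1) <= 2 * (sqrt (x + 1) - sqrt x)).
    { set (s := sqrt x) in *. set (t := sqrt (x + 1)) in *. rewrite <- H2.
      assert (E : (t - s) * (t + s) = 1) by nra.
      assert (Ht : 1 <= t) by nra.
      apply Rmult_le_reg_r with (t * t); [nra|]. rewrite Rinv_l by nra.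
      assert (0 <= t - s) by lra. nra. }
    lra.
Qed.

Lemma cL_le_harmonic (q : R) (k : nat) : 0 < q <= / 4 -> cL q k <= (2 + / q) * harmonic k.
Proof.
  intros Hq. assert (Hiq : 0 < / q) by (apply Rinv_0_lt_compat; lra).
  induction k as [|k IH]; [simpl; rewrite harmonic_0; lra|].
  cbn [cL]. rewrite harmonic_S, S_INR, Rmult_plus_distr_l.
  apply Rplus_le_compat; [exact IH|].
  assert (Hi := pos_INR k). destruct k as [|k].
  - simpl. unfold Rdiv. rewrite !Rmult_0_r, !Rplus_0_l, Rmult_1_l, Rinv_1. lra.
  - assert (1 <= INR (S k)) by (rewrite S_INR; assert (P := pos_INR k); lra).
    set (x := INR (S k)) in *.
    apply Rle_trans with (2 * / (x + 1) + / q * / (x + 1)); [|lra].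
    apply Rmult_le_reg_r with ((x * x + x + q) * (x + 1) * q).
    { repeat apply Rmult_lt_0_compat; nra. }
    replace ((2 * x + 1) / (x * x + x + q) * ((x * x + x + q) * (x + 1) * q))
      with ((2 * x + 1) * (x + 1) * q) by (field; nra).
    replace ((2 * / (x + 1) + / q * / (x + 1)) * ((x * x + x + q) * (x + 1) * q))
      with ((2 * q + 1) * (x * x + x + q)) by (field; lra).
    nra.
Qed.

Lemma is_lim_seq_inv_sqrt (K : R) : is_lim_seq (fun k => K / sqrt (INR (S k))) 0.
Proof.
  replace (Finite 0) with (Rbar_mult K 0) by (simpl; f_equal; ring).
  apply is_lim_seq_scal_l.
  apply (is_lim_seq_incr_1 (fun k => / sqrt (INR k))).
  replace (Finite 0) with (Rbar_inv p_infty) by reflexivity.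
  apply is_lim_seq_inv; [|discriminate].
  apply (filterlim_comp _ _ _ INR sqrt eventually (Rbar_locally p_infty)).
  - apply is_lim_seq_INR.
  - apply filterlim_sqrt_p.
Qed.

Lemma caH_le (q : R) (k : nat) : 0 < q <= / 4 -> caH q (S k) <= 1 / sqrt (INR (S k)).
Proof.
  intros Hq. unfold caH. assert (H1 := ca_le q (S k) Hq). assert (H2 := harmonic_le_sqrt (S k)).
  assert (H3 := ca_pos q (S k) (proj1 Hq)). assert (H4 := harmonic_nonneg (S k)).
  assert (Hi : 1 <= INR (S k)) by (rewrite S_INR; assert (P := pos_INR k); lra).
  set (x := INR (S k)) in *. assert (Hs : 0 < sqrt x) by (apply sqrt_lt_R0; lra).
  assert (Hss := sqrt_sqrt x ltac:(lra)).
  apply Rle_trans with (/ (2 * x + 1) * (2 * sqrt x)).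
  - apply Rmult_le_compat; lra.
  - apply Rmult_le_reg_r with ((2 * x + 1) * sqrt x); [nra|].
    replace (/ (2 * x + 1) * (2 * sqrt x) * ((2 * x + 1) * sqrt x)) with (2 * (sqrt x * sqrt x))
      by (field; lra).
    replace (1 / sqrt x * ((2 * x + 1) * sqrt x)) with (2 * x + 1) by (field; lra). lra.
Qed.

Lemma caH_lim (q : R) : 0 < q <= / 4 -> is_lim_seq (fun k => caH q (S k)) 0.
Proof.
  intros Hq. apply is_lim_seq_le_le with (fun _ => 0) (fun k => 1 / sqrt (INR (S k))).
  - intros k. split; [|now apply caH_le]. unfold caH.
    assert (H3 := ca_pos q (S k) (proj1 Hq)). assert (H4 := harmonic_nonneg (S k)). nra.
  - apply is_lim_seq_const.
  - apply is_lim_seq_inv_sqrt.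
Qed.

Lemma caL_lim (q : R) : 0 < q <= / 4 -> is_lim_seq (fun k => caL q (S k)) 0.
Proof.
  intros Hq. apply is_lim_seq_le_le with (fun _ => 0) (fun k => (2 + / q) / sqrt (INR (S k))).
  - intros k. split; [now apply caL_nonneg|].
    assert (H := caH_le q k Hq). unfold caH in H. unfold caL.
    assert (Ha := ca_pos q (S k) (proj1 Hq)). assert (HL := cL_le_harmonic q (S k) Hq).
    assert (Hiq : 0 < / q) by (apply Rinv_0_lt_compat; lra).
    apply Rle_trans with ((2 + / q) * (ca q (S k) * harmonic (S k))); [nra|].
    unfold Rdiv in *. apply Rmult_le_compat_l; lra.
  - apply is_lim_seq_const.
  - apply is_lim_seq_inv_sqrt.
Qed.

Lemma decr_le_first (c : nat -> R) : (forall k, c (S k) <= c k) -> forall k, c k <= c 0%nat.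
Proof. intros H k. induction k as [|k IH]; [lra|]. specialize (H k). lra. Qed.

Lemma ok_of_decr (c : nat -> R) : (forall k, 0 <= c k) -> (forall k, c (S (S k)) <= c (S k)) -> ok c.
Proof.
  intros H0 H. apply ok_bounded with (c 0%nat + c 1%nat). intros k.
  rewrite Rabs_pos_eq by apply H0. assert (P0 := H0 0%nat). assert (P1 := H0 1%nat).
  destruct k; [lra|].
  assert (D := decr_le_first (fun k => c (S k)) H k). cbv beta in D. lra.
Qed.

Lemma ok_ca (q : R) : 0 < q <= / 4 -> ok (ca q).
Proof.
  intros Hq. apply ok_bounded with 1. intros k. assert (Ha := ca_pos q k (proj1 Hq)).
  rewrite Rabs_pos_eq by lra. apply Rle_trans with (1 := ca_le q k Hq).
  assert (Hi := pos_INR k). rewrite <- Rinv_1. apply Rinv_le_contravar; lra.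
Qed.

Lemma ok_caL (q : R) : 0 < q <= / 4 -> ok (caL q).
Proof. intros Hq. apply ok_of_decr; intros k; [now apply caL_nonneg|now apply caL_decr]. Qed.

Lemma caH_nonneg (q : R) (k : nat) : 0 < q -> 0 <= caH q k.
Proof.
  intros Hq. apply Rmult_le_pos; [left; now apply ca_pos|apply harmonic_nonneg].
Qed.

Lemma ok_caH (q : R) : 0 < q <= / 4 -> ok (caH q).
Proof. intros Hq. apply ok_of_decr; intros k; [now apply caH_nonneg|now apply caH_decr]. Qed.

(** * The Legendre operator on power series *)

(** The Taylor coefficients of [(t (1 - t) y')'] when [y] has coefficients [c]; [PSz] below is
    [t (1 - t) y']. Solving the equation means [Ec c = q c]. *)
Definition Ec (c : nat -> R) (k : nat) : R :=
  INR (S k) * INR (S k) * c (S k) - (INR k * INR k + INR k) * c k.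

Definition PSz (c : nat -> R) (t : C) : C := ((1 - t) * PS (th c) t)%C.

Lemma PS_lin4 (e c1 c2 c3 c4 : nat -> R) (x1 x2 x3 x4 : R) (t : C) :
  ok c1 -> ok c2 -> ok c3 -> ok c4 -> Cmod t < 1 ->
  (forall k, e k = x1 * c1 k + (x2 * c2 k + (x3 * c3 k + x4 * c4 k))) ->
  PS e t = (x1 * PS c1 t + (x2 * PS c2 t + (x3 * PS c3 t + x4 * PS c4 t)))%C.
Proof.
  intros O1 O2 O3 O4 Ht He. rewrite (PS_ext e _ t He).
  assert (P1 := ok_scal x1 _ O1). assert (P2 := ok_scal x2 _ O2).
  assert (P3 := ok_scal x3 _ O3). assert (P4 := ok_scal x4 _ O4).
  assert (P34 := ok_plus _ _ P3 P4). assert (P234 := ok_plus _ _ P2 P34).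
  rewrite (PSeval_plus _ _ t P1 P234 Ht), (PSeval_plus _ _ t P2 P34 Ht), (PSeval_plus _ _ t P3 P4 Ht).
  rewrite !PSeval_scal by assumption. reflexivity.
Qed.

Lemma PS_Ec (c : nat -> R) (t : C) : ok c -> Cmod t < 1 ->
  ((1 - t) * PS (th (th c)) t - t * PS (th c) t = t * PS (Ec c) t)%C.
Proof.
  intros Hc Ht. assert (H1 := ok_th c Hc). assert (H2 := ok_th _ H1).
  assert (H3 := ok_shift _ H2).
  rewrite (PS_lin4 (Ec c) (fun k => th (th c) (S k)) (th (th c)) (th c) c 1 (-1) (-1) 0 t);
    trivial.
  - rewrite (PS_shift (th (th c)) t) at 1 by trivial.
    replace (th (th c) 0) with 0 by (unfold th; simpl; ring).
    transitivity (t * PS (fun k => th (th c) (S k)) t - t * PS (th (th c)) t - t * PS (th c) t)%C.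
    + rewrite (PS_shift (th (th c)) t) by trivial.
      replace (th (th c) 0) with 0 by (unfold th; simpl; ring). ring.
    + ring.
  - intros k. unfold Ec, th. ring.
Qed.

Lemma cderive_PSz (c : nat -> R) (g : R -> C) (x : R) (g' : C) : ok c ->
  Cmod (g x) < 1 -> g x <> 0 -> cderive g x g' ->
  cderive (fun r => PSz c (g r)) x (g' * PS (Ec c) (g x))%C.
Proof.
  intros Hc H1 H0 Hg. unfold PSz. eapply cderive_eq.
  - apply cderive_mult.
    + apply cderive_minus; [apply cderive_const|exact Hg].
    + apply cderive_PS; [now apply ok_th|exact H1|exact H0|exact Hg].
  - cbv beta. transitivity (g' / g x * ((1 - g x) * PS (th (th c)) (g x) - g x * PS (th c) (g x)))%C.
    + field. exact H0.
    + rewrite PS_Ec by trivial. field. exact H0.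
Qed.

Lemma cderive_PS_PSz (c : nat -> R) (g : R -> C) (x : R) (g' : C) : ok c ->
  Cmod (g x) < 1 -> g x <> 0 -> (1 - g x)%C <> 0 -> cderive g x g' ->
  cderive (fun r => PS c (g r)) x (g' * PSz c (g x) / (g x * (1 - g x)))%C.
Proof.
  intros Hc H1 H0 H1' Hg. eapply cderive_eq; [exact (cderive_PS c g x g' Hc H1 H0 Hg)|].
  unfold PSz. field. split; assumption.
Qed.

Lemma one_minus_neq_0 (t : C) : Cmod t < 1 -> (1 - t)%C <> 0.
Proof.
  intros H E. replace t with (RtoC 1) in H.
  - rewrite Cmod_1 in H. lra.
  - replace t with (1 - (1 - t))%C by ring. rewrite E. ring.
Qed.

Lemma slit_one_minus (t : C) : Cmod t <= 1 -> t <> 1 -> slit (1 - t).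
Proof.
  intros H H1. destruct (Req_dec (Im t) 0) as [E|E].
  - right. assert (R := re_le_Cmod t). assert (A := Rle_abs (Re t)).
    assert (Re t <> 1). { intros F. apply H1. apply C_eq; simpl; assumption. }
    simpl. unfold Re in *. lra.
  - left. simpl. unfold Im in E. lra.
Qed.

Lemma slit_one_minus_lt (t : C) : Cmod t < 1 -> slit (1 - t).
Proof.
  intros H. apply slit_one_minus; [lra|]. intros ->. rewrite Cmod_1 in H. lra.
Qed.

Lemma leg_lin (n : nat) (al : C) (g g' y z y1 z1 : R -> C) (x : R) :
  leg n g g' y z x -> leg n g g' y1 z1 x ->
  leg n g g' (fun r => y r + al * y1 r)%C (fun r => z r + al * z1 r)%C x.
Proof.
  intros [H1 H2] [H3 H4]. split.
  - eapply cderive_eq; [apply cderive_plus; [exact H1|apply cderive_scal, H3]|].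
    unfold Cdiv. ring.
  - eapply cderive_eq; [apply cderive_plus; [exact H2|apply cderive_scal, H4]|]. ring.
Qed.

Section series_solutions.
Context (n : nat) (Hn : (2 <= n)%nat).
Let q := qn n.
Let Hq : 0 < q <= / 4 := qn_bound n Hn.
Context (g g' : R -> C) (x : R) (H1 : Cmod (g x) < 1) (H0 : g x <> 0)
  (Hg : cderive g x (g' x)).

Let H1' : (1 - g x)%C <> 0 := one_minus_neq_0 _ H1.

Lemma leg_P : leg n g g' (fun r => PS (ca q) (g r)) (fun r => PSz (ca q) (g r)) x.
Proof.
  assert (Hok := ok_ca q Hq). split.
  - apply cderive_PS_PSz; eassumption.
  - eapply cderive_eq; [apply cderive_PSz; eassumption|].
    rewrite (PS_ext (Ec (ca q)) (fun k => q * ca q k)).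
    + rewrite PSeval_scal by trivial. fold (qn n). fold q. ring.
    + intros k. unfold Ec. cbn [ca]. field. apply not_0_INR. lia.
Qed.

(** Inside the disk, part (a) says that this function vanishes. It is compared with the zero
    solution, since it and [SLz] both vanish at [0]. *)
Definition SLf (t : C) : C := (PS (caL q) t + PS (ca q) t * Clog (1 - t))%C.
Definition SLz (t : C) : C :=
  (PSz (caL q) t + PSz (ca q) t * Clog (1 - t) - t * PS (ca q) t)%C.

Lemma leg_SL : leg n g g' (fun r => SLf (g r)) (fun r => SLz (g r)) x.
Proof.
  assert (Hok := ok_ca q Hq). assert (HokL := ok_caL q Hq).
  destruct leg_P as [D1 D2].
  assert (DL : cderive (fun r => Clog (1 - g r)) x (- g' x / (1 - g x))%C).
  { eapply cderive_eq.
    - apply (cderive_Clog (fun r => 1 - g r)%C); [now apply slit_one_minus_lt|].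
      apply cderive_minus; [apply cderive_const|exact Hg].
    - field. exact H1'. }
  unfold SLf, SLz. split.
  - eapply cderive_eq.
    + apply cderive_plus; [apply cderive_PS_PSz; eassumption|]. apply cderive_mult; [exact D1|exact DL].
    + cbv beta. field. split; assumption.
  - eapply cderive_eq.
    + apply cderive_minus; [apply cderive_plus; [apply cderive_PSz; eassumption|]|].
      * apply cderive_mult; [exact D2|exact DL].
      * apply cderive_mult; [exact Hg|exact D1].
    + cbv beta. fold (qn n). fold q.
      (* The increments of [cL] contribute [(2 k + 1) a_k] to [Ec], and this source is cancelled by
         the derivative of the logarithm. *)
      rewrite (PS_lin4 (Ec (caL q)) (caL q) (th (ca q)) (ca q) (ca q) q 2 1 0); trivial.
      * unfold PSz. field. split; assumption.
      * now apply ok_th.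
      * intros k. unfold Ec, caL, th. cbn [ca cL]. assert (Hi := pos_INR k).
        field. split; [nra|apply not_0_INR; lia].
Qed.

(* The coefficients [ca (cL - 2 H - kap)] of the regular part of the solution that is
   logarithmic at [t = 0]. *)
Definition cM (kap : R) (k : nat) : R := caL q k + (-2 * caH q k + (- kap) * ca q k).

Lemma ok_cM (kap : R) : ok (cM kap).
Proof.
  apply ok_plus; [now apply ok_caL|]. apply ok_plus; apply ok_scal; [now apply ok_caH|now apply ok_ca].
Qed.

Definition Phi (kap : R) (t : C) : C := (- (PS (ca q) t * Clog t) - PS (cM kap) t)%C.
Definition Phiz (kap : R) (t : C) : C :=
  (- (PSz (ca q) t * Clog t + (1 - t) * PS (ca q) t) - PSz (cM kap) t)%C.

Lemma leg_Phi (kap : R) : slit (g x) ->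
  leg n g g' (fun r => Phi kap (g r)) (fun r => Phiz kap (g r)) x.
Proof.
  intros Hs. assert (Hok := ok_ca q Hq). assert (HokM := ok_cM kap).
  destruct leg_P as [D1 D2].
  assert (DL : cderive (fun r => Clog (g r)) x (g' x / g x)%C) by now apply cderive_Clog.
  unfold Phi, Phiz. split.
  - eapply cderive_eq.
    + apply cderive_minus; [|apply cderive_PS_PSz; eassumption].
      apply cderive_opp, cderive_mult; [exact D1|exact DL].
    + cbv beta. field. split; assumption.
  - eapply cderive_eq.
    + apply cderive_minus; [|apply cderive_PSz; eassumption].
      apply cderive_opp, cderive_plus; [apply cderive_mult; [exact D2|exact DL]|].
      apply cderive_mult; [|exact D1].
      apply cderive_minus; [apply cderive_const|exact Hg].
    + cbv beta. fold (qn n). fold q.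
      assert (Ho2 : ok (fun k => th (ca q) (S k))) by now apply ok_shift, ok_th.
      assert (ES : PS (fun k => th (ca q) (S k)) (g x) = (PS (th (ca q)) (g x) / g x)%C).
      { rewrite (PS_shift (th (ca q)) (g x)) by (trivial; now apply ok_th).
        replace (th (ca q) 0) with 0 by (unfold th; simpl; ring). field. exact H0. }
      (* Compared with [caL], the increments [1 / (k + 1)] of [harmonic] add [-2 (k + 1) a_(k+1)],
         the coefficients of [-2 P']. The constant [kap] drops out, as it only adds a multiple of
         [P]. *)
      rewrite (PS_lin4 (Ec (cM kap)) (cM kap) (th (ca q)) (ca q) (fun k => th (ca q) (S k))
        q 2 1 (-2)); trivial.
      * rewrite ES. unfold PSz. field. split; assumption.
      * now apply ok_th.
      * intros k. unfold Ec, cM, caL, caH, th. rewrite harmonic_S. cbn [ca cL].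
        assert (Hi := pos_INR k). field. split; [apply not_0_INR; lia|nra].
Qed.

End series_solutions.

(** * Gronwall's inequality and the Wronskian *)

Lemma Cauchy_Schwarz_Re (y w : C) : Rabs (Re y * Re w + Im y * Im w) <= Cmod y * Cmod w.
Proof.
  apply Rsqr_incr_0; [|apply Rabs_pos|apply Rmult_le_pos; apply Cmod_ge_0].
  rewrite <- Rsqr_abs. unfold Rsqr.
  replace (Cmod y * Cmod w * (Cmod y * Cmod w)) with (Cmod y * Cmod y * (Cmod w * Cmod w)) by ring.
  rewrite !Cmod_sqr. assert (H := Rle_0_sqr (Re y * Im w - Im y * Re w)). unfold Rsqr in H. nra.
Qed.

Definition energy (y z : C) : R := Cmod y * Cmod y + Cmod z * Cmod z.

(** With [E] the energy, [E' <= 4 K |y| |z| <= 2 K E], so [E x exp (- 2 K x)] does not increase. *)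
Lemma gronwall (y z A D : R -> C) (a b K : R) : a <= b -> 0 <= K ->
  (forall x, a <= x <= b -> cderive y x (A x * z x)%C /\ cderive z x (D x * y x)%C
     /\ Cmod (A x) <= K /\ Cmod (D x) <= K) ->
  energy (y b) (z b) <= energy (y a) (z a) * exp (2 * K * (b - a)).
Proof.
  intros Hab HK H.
  set (E := fun x => Re (y x) * Re (y x) + Im (y x) * Im (y x)
    + (Re (z x) * Re (z x) + Im (z x) * Im (z x))).
  assert (EE : forall x, energy (y x) (z x) = E x).
  { intros x. unfold energy, E. now rewrite !Cmod_sqr. }
  rewrite !EE.
  set (E' := fun x => 2 * (Re (y x) * Re (A x * z x) + Im (y x) * Im (A x * z x))
    + 2 * (Re (z x) * Re (D x * y x) + Im (z x) * Im (D x * y x))).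
  set (f := fun x => E x * exp (- (2 * K * x))).
  set (f' := fun x => (E' x - 2 * K * E x) * exp (- (2 * K * x))).
  assert (Hd : forall x, a <= x <= b -> is_derive f x (f' x)).
  { intros x Hx. destruct (H x Hx) as ([D1 D2] & [D3 D4] & _ & _).
    pose (u1 := fun r : R => Re (y r)). pose (u2 := fun r : R => Im (y r)).
    pose (u3 := fun r : R => Re (z r)). pose (u4 := fun r : R => Im (z r)).
    change (is_derive u1 x (Re (A x * z x))) in D1. change (is_derive u2 x (Im (A x * z x))) in D2.
    change (is_derive u3 x (Re (D x * y x))) in D3. change (is_derive u4 x (Im (D x * y x))) in D4.
    assert (E1 : Derive (fun t : R => u1 t) x = _) by exact (is_derive_unique _ _ _ D1).
    assert (E2 : Derive (fun t : R => u2 t) x = _) by exact (is_derive_unique _ _ _ D2).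
    assert (E3 : Derive (fun t : R => u3 t) x = _) by exact (is_derive_unique _ _ _ D3).
    assert (E4 : Derive (fun t : R => u4 t) x = _) by exact (is_derive_unique _ _ _ D4).
    apply is_derive_ext with (fun x => (u1 x * u1 x + u2 x * u2 x + (u3 x * u3 x + u4 x * u4 x))
      * exp (- (2 * K * x))); [reflexivity|].
    auto_derive; [repeat split; eexists; eassumption|].
    rewrite E1, E2, E3, E4. unfold f', E', E, u1, u2, u3, u4. ring. }
  assert (Hneg : forall x, a <= x <= b -> f' x <= 0).
  { intros x Hx. destruct (H x Hx) as (_ & _ & HA & HD). unfold f'.
    assert (P := exp_pos (- (2 * K * x))).
    assert (C1 := Cauchy_Schwarz_Re (y x) (A x * z x)). rewrite Cmod_mult in C1.
    assert (C2 := Cauchy_Schwarz_Re (z x) (D x * y x)). rewrite Cmod_mult in C2.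
    apply Rabs_le_between in C1. apply Rabs_le_between in C2.
    assert (Ex : E x = Cmod (y x) * Cmod (y x) + Cmod (z x) * Cmod (z x)).
    { unfold E. now rewrite !Cmod_sqr. }
    assert (Py := Cmod_ge_0 (y x)). assert (Pz := Cmod_ge_0 (z x)).
    set (Y := Cmod (y x)) in *. set (Z := Cmod (z x)) in *.
    assert (B1 : Y * (Cmod (A x) * Z) <= K * (Y * Z)).
    { replace (Y * (Cmod (A x) * Z)) with (Cmod (A x) * (Y * Z)) by ring.
      apply Rmult_le_compat_r; [now apply Rmult_le_pos|exact HA]. }
    assert (B2 : Z * (Cmod (D x) * Y) <= K * (Y * Z)).
    { replace (Z * (Cmod (D x) * Y)) with (Cmod (D x) * (Y * Z)) by ring.
      apply Rmult_le_compat_r; [now apply Rmult_le_pos|exact HD]. }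
    assert (B3 : K * (2 * (Y * Z)) <= K * (Y * Y + Z * Z)).
    { apply Rmult_le_compat_l; [exact HK|]. assert (S := Rle_0_sqr (Y - Z)). unfold Rsqr in S. lra. }
    assert (E' x - 2 * K * E x <= 0).
    { unfold E'. rewrite Ex. lra. }
    nra. }
  destruct (MVT_gen f a b f') as [c [Hc Ec]].
  - rewrite Rmin_left, Rmax_right by exact Hab. intros x Hx. apply Hd. lra.
  - rewrite Rmin_left, Rmax_right by exact Hab. intros x Hx.
    apply continuity_pt_filterlim. apply continuous_of_derivable. exists (f' x). now apply Hd.
  - rewrite Rmin_left, Rmax_right in Hc by exact Hab.
    assert (N := Hneg c Hc).
    assert (F : f b <= f a) by nra. unfold f in F.
    assert (Pb := exp_pos (2 * K * b)).
    apply (Rmult_le_compat_r (exp (2 * K * b))) in F; [|lra].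
    rewrite (Rmult_assoc (E b)), (Rmult_assoc (E a)), <- !exp_plus in F.
    rewrite Rplus_opp_l, exp_0, Rmult_1_r in F.
    replace (2 * K * (b - a)) with (- (2 * K * a) + 2 * K * b) by ring. exact F.
Qed.

Lemma energy_0 (y z : C) : energy y z <= 0 -> y = 0 /\ z = 0.
Proof.
  unfold energy. intros H. assert (Py := Cmod_ge_0 y). assert (Pz := Cmod_ge_0 z).
  split; apply Cmod_eq_0; nra.
Qed.

Lemma cderive_0_const (f : R -> C) (a b : R) :
  (forall x, a < x < b -> cderive f x 0) ->
  forall x y, a < x < b -> a < y < b -> f x = f y.
Proof.
  intros H.
  assert (A : forall x y, x < y -> a < x < b -> a < y < b -> f x = f y).
  { intros x y Hxy Hx Hy. apply C_eq.
    - apply (eq_is_derive (fun r => Re (f r)) x y); [|exact Hxy].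
      intros t Ht. refine (proj1 (H t _)); lra.
    - apply (eq_is_derive (fun r => Im (f r)) x y); [|exact Hxy].
      intros t Ht. refine (proj2 (H t _)); lra. }
  intros x y Hx Hy. destruct (Rtotal_order x y) as [L|[E|L]].
  - now apply A.
  - now subst.
  - symmetry. now apply A.
Qed.

Definition real_leg (n : nat) (y z : R -> C) : Prop :=
  forall x, 0 < x < 1 -> leg n RtoC (fun _ => 1) y z x.

Lemma RtoC_neq_0 (x : R) : x <> 0 -> RtoC x <> 0.
Proof. intros H E. apply H. now apply RtoC_inj. Qed.

(* The Wronskian [y Pz - P z] is constant; if it is arbitrarily small it vanishes,
   and then [y / P] is constant. *)
Lemma wronskian_prop (n : nat) (y z P Pz : R -> C) :
  real_leg n y z -> real_leg n P Pz ->
  (forall x, 0 < x < 1 -> P x <> 0) ->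
  (forall e, 0 < e -> exists x, 0 < x < 1 /\ Cmod (y x * Pz x - P x * z x) < e) ->
  exists al : C, forall x, 0 < x < 1 -> y x = (al * P x)%C /\ z x = (al * Pz x)%C.
Proof.
  intros Hy HP HP0 HW.
  assert (HW0 : forall x, 0 < x < 1 -> (y x * Pz x - P x * z x)%C = 0).
  { assert (Hc := cderive_0_const (fun x => y x * Pz x - P x * z x)%C 0 1).
    assert (Hd : forall x, 0 < x < 1 -> cderive (fun x => y x * Pz x - P x * z x)%C x 0).
    { intros x Hx. destruct (Hy x Hx) as [D1 D2], (HP x Hx) as [D3 D4].
      eapply cderive_eq.
      - apply cderive_minus; apply cderive_mult; eassumption.
      - cbv beta. unfold Cdiv. ring. }
    specialize (Hc Hd).
    intros x Hx. apply Cmod_eq_0. apply Rle_antisym; [|apply Cmod_ge_0].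
    apply Rnot_lt_le. intros L. destruct (HW _ L) as [x' [Hx' B]].
    rewrite (Hc x' x Hx' Hx) in B. lra. }
  assert (Hc := cderive_0_const (fun x => y x / P x)%C 0 1).
  assert (Hd : forall x, 0 < x < 1 -> cderive (fun x => y x / P x)%C x 0).
  { intros x Hx. destruct (Hy x Hx) as [D1 D2], (HP x Hx) as [D3 D4].
    assert (N := HP0 x Hx). assert (W := HW0 x Hx).
    assert (N1 : RtoC x <> 0) by (apply RtoC_neq_0; lra).
    assert (N2 : (1 - x)%C <> 0) by (rewrite <- RtoC_minus; apply RtoC_neq_0; lra).
    eapply cderive_eq.
    - apply cderive_div; [exact N|exact D1|exact D3].
    - cbv beta.
      transitivity (- (y x * Pz x - P x * z x) / (x * (1 - x) * (P x * P x)))%C.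
      + field. repeat split; assumption.
      + rewrite W. field. repeat split; assumption. }
  specialize (Hc Hd).
  assert (Hh : 0 < / 2 < 1) by lra.
  exists (y (/ 2)%R / P (/ 2)%R)%C. intros x Hx.
  assert (Hcx := Hc (/ 2) x Hh Hx). cbv beta in Hcx. rewrite Hcx. assert (N := HP0 x Hx). assert (W := HW0 x Hx).
  split; [field; exact N|].
  replace (z x) with ((y x * Pz x - (y x * Pz x - P x * z x)) / P x)%C by (field; exact N).
  rewrite W. field. exact N.
Qed.

(** * Lipschitz bounds and continuity of power series *)

Lemma Cpow_Lipschitz (z w : C) (rho : R) (k : nat) : 0 < rho ->
  Cmod z <= rho -> Cmod w <= rho ->
  rho * Cmod (w ^ k - z ^ k) <= INR k * rho ^ k * Cmod (w - z).
Proof.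
  intros Hr Hz Hw. assert (Hd := Cmod_ge_0 (w - z)). induction k as [|k IH].
  - replace (w ^ 0 - z ^ 0)%C with (RtoC 0) by (simpl; ring). rewrite Cmod_0. simpl. lra.
  - replace (w ^ S k - z ^ S k)%C with (w * (w ^ k - z ^ k) + (w - z) * z ^ k)%C
      by (rewrite !Cpow_S; ring).
    assert (T := Cmod_triangle (w * (w ^ k - z ^ k)) ((w - z) * z ^ k)).
    rewrite !Cmod_mult, Cmod_pow in T.
    assert (Hk : Cmod z ^ k <= rho ^ k) by (apply pow_incr; split; [apply Cmod_ge_0|assumption]).
    assert (He := Cmod_ge_0 (w ^ k - z ^ k)). assert (Hw0 := Cmod_ge_0 w).
    set (e := Cmod (w ^ k - z ^ k)) in *. set (d := Cmod (w - z)) in *.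
    rewrite S_INR. simpl pow.
    apply Rle_trans with (rho * (Cmod w * e + d * Cmod z ^ k)); [apply Rmult_le_compat_l; lra|].
    assert (Cmod w * (rho * e) <= rho * (INR k * rho ^ k * d)).
    { apply Rmult_le_compat; trivial. apply Rmult_le_pos; lra. }
    assert (rho * (d * Cmod z ^ k) <= rho * (d * rho ^ k)).
    { apply Rmult_le_compat_l; [lra|]. now apply Rmult_le_compat_l. }
    nra.
Qed.

Lemma Series_nonneg (a : nat -> R) : (forall k, 0 <= a k) -> ex_series a -> 0 <= Series a.
Proof.
  intros H Ha. rewrite <- (Rmult_0_l (Series a)), <- Series_scal_l.
  apply Series_le; [|exact Ha]. intros k. specialize (H k). lra.
Qed.

Lemma PS_Lipschitz (c : nat -> R) (rho : R) : ok c -> 0 < rho < 1 ->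
  exists B, 0 <= B /\ forall z w : C, Cmod z <= rho -> Cmod w <= rho ->
  Cmod (PS c w - PS c z) <= B * Cmod (w - z).
Proof.
  intros Hc Hr. assert (Hok := ok_th c Hc).
  assert (Hs := ok_ex_series _ rho Hok ltac:(lra)).
  exists (2 * Series (fun k => Rabs (th c k) * rho ^ k) / rho). split.
  - apply Rle_mult_inv_pos; [|lra]. apply Rmult_le_pos; [lra|].
    apply Series_nonneg; [|exact Hs]. intros k. apply Rmult_le_pos; [apply Rabs_pos|apply pow_le; lra].
  - intros z w Hz Hw.
    assert (Cz := cex_PS c z Hc ltac:(lra)). assert (Cw := cex_PS c w Hc ltac:(lra)).
    set (d := Cmod (w - z)).
    replace (PS c w - PS c z)%C with (CSeries (fun k => c k * (w ^ k - z ^ k))%C).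
    2: { transitivity (CSeries (fun k => c k * w ^ k + - (1) * (c k * z ^ k))%C).
         { apply CSeries_ext. intros k. ring. }
         rewrite (CSeries_plus (fun k => c k * w ^ k)%C (fun k => - (1) * (c k * z ^ k))%C);
           [|exact Cw|now apply cex_scal].
         rewrite CSeries_scal by exact Cz. unfold PS. ring. }
    eapply Rle_trans.
    + apply (Cmod_CSeries_le _ (fun k => (d / rho) * (Rabs (th c k) * rho ^ k))).
      * intros k. rewrite Cmod_mult, Cmod_R.
        assert (E := Cpow_Lipschitz z w rho k ltac:(lra) Hz Hw). fold d in E.
        unfold th. rewrite Rabs_mult, (Rabs_pos_eq (INR k)) by apply pos_INR.
        apply Rmult_le_reg_l with rho; [lra|].
        replace (rho * (d / rho * (INR k * Rabs (c k) * rho ^ k)))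
          with (Rabs (c k) * (INR k * rho ^ k * d)) by (field; lra).
        replace (rho * (Rabs (c k) * Cmod (w ^ k - z ^ k)))
          with (Rabs (c k) * (rho * Cmod (w ^ k - z ^ k))) by ring.
        apply Rmult_le_compat_l; [apply Rabs_pos|exact E].
      * now apply (@ex_series_scal R_AbsRing R_NormedModule).
    + rewrite Series_scal_l. right. field. lra.
Qed.

Lemma continuous_squeeze {T : UniformSpace} (h phi : T -> R) (x : T) :
  locally x (fun t => Rabs (h t - h x) <= phi t) -> phi x = 0 -> continuous phi x ->
  continuous h x.
Proof.
  intros HL H0 Hphi P [e He]. unfold filtermap.
  assert (HE : locally x (fun t => phi t < e)).
  { apply (Hphi (fun y => y < e)). rewrite H0. exact (open_lt e 0 (cond_pos e)). }
  generalize (filter_and _ _ HL HE). apply filter_imp. intros t [A B]. apply He.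
  change (Rabs (h t - h x) < e). lra.
Qed.

Lemma ccont_squeeze {T : UniformSpace} (f : T -> C) (phi : T -> R) (x : T) :
  locally x (fun t => Cmod (f t - f x) <= phi t) -> phi x = 0 -> continuous phi x -> ccont f x.
Proof.
  intros HL H0 Hphi. split; (apply continuous_squeeze with phi; [|exact H0|exact Hphi]);
    revert HL; apply filter_imp; intros t Ht; apply Rle_trans with (2 := Ht).
  - exact (re_le_Cmod (f t - f x)).
  - exact (im_le_Cmod (f t - f x)).
Qed.

Lemma ccont_PS {T : UniformSpace} (c : nat -> R) (f : T -> C) (x : T) : ok c ->
  Cmod (f x) < 1 -> ccont f x -> ccont (fun t => PS c (f t)) x.
Proof.
  intros Hc H1 Hf.
  set (rho := (1 + Cmod (f x)) / 2). assert (Hp := Cmod_ge_0 (f x)).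
  assert (Hr : 0 < rho < 1 /\ Cmod (f x) < rho) by (unfold rho; lra).
  destruct (PS_Lipschitz c rho Hc (proj1 Hr)) as [B [HB0 HB]].
  apply ccont_squeeze with (fun t => B * Cmod (f t - f x)).
  - assert (HL : locally x (fun t => Cmod (f t) < rho))
      by exact (ccont_Cmod f x Hf (fun y => y < rho) (open_lt rho _ (proj2 Hr))).
    revert HL; apply filter_imp. intros t Ht. apply HB; lra.
  - replace (f x - f x)%C with (RtoC 0) by ring. rewrite Cmod_0. ring.
  - apply continuous_Rmult; [apply continuous_const|].
    apply (ccont_Cmod (fun t => f t - f x)%C).
    apply (ccont_minus f (fun _ => f x)); [exact Hf|apply ccont_const].
Qed.

Lemma ccont_PSz {T : UniformSpace} (c : nat -> R) (f : T -> C) (x : T) : ok c ->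
  Cmod (f x) < 1 -> ccont f x -> ccont (fun t => PSz c (f t)) x.
Proof.
  intros Hc H1 Hf. unfold PSz.
  apply (ccont_mult (fun t => 1 - f t)%C (fun t => PS (th c) (f t))).
  - apply (ccont_minus (fun _ => RtoC 1) f); [apply ccont_const|exact Hf].
  - apply ccont_PS; [now apply ok_th|exact H1|exact Hf].
Qed.

Lemma PS_0 (c : nat -> R) : ok c -> PS c 0 = c 0%nat.
Proof. intros Hc. rewrite PS_shift by (trivial; rewrite Cmod_0; lra). ring. Qed.

Lemma PSz_0 (c : nat -> R) : ok c -> PSz c 0 = 0.
Proof.
  intros Hc. unfold PSz. rewrite PS_0 by now apply ok_th. unfold th. simpl.
  rewrite Rmult_0_l. ring.
Qed.

Lemma ccont_small (f : R -> C) (x e : R) : ccont f x -> 0 < e ->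
  locally x (fun r => Cmod (f r - f x) < e).
Proof.
  intros Hf He.
  assert (Hc : continuous (fun r => Cmod (f r - f x)) x).
  { apply (ccont_Cmod (fun t => f t - f x)%C).
    apply (ccont_minus f (fun _ => f x)); [exact Hf|apply ccont_const]. }
  apply (Hc (fun y => y < e)). replace (f x - f x)%C with (RtoC 0) by ring.
  rewrite Cmod_0. exact (open_lt e 0 He).
Qed.

Lemma locally_right (x b : R) (P : R -> Prop) : x < b -> locally x P -> exists r, x < r < b /\ P r.
Proof.
  intros Hb [d Hd]. exists (x + Rmin (d / 2) ((b - x) / 2)).
  assert (H1 := cond_pos d).
  assert (A : 0 < Rmin (d / 2) ((b - x) / 2)) by (apply Rmin_pos; lra).
  assert (A1 := Rmin_l (d / 2) ((b - x) / 2)). assert (A2 := Rmin_r (d / 2) ((b - x) / 2)).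
  split; [lra|]. apply Hd. change (Rabs (x + Rmin (d / 2) ((b - x) / 2) - x) < d).
  rewrite Rabs_pos_eq; lra.
Qed.

(** * Solutions regular at [0]: uniqueness on (0,1) and in the disk *)

Lemma Re_P_ge_1 (q x : R) : 0 < q <= / 4 -> 0 <= x < 1 -> 1 <= Re (PS (ca q) x).
Proof.
  intros Hq Hx. assert (Ht : Cmod x < 1) by (rewrite Cmod_R, Rabs_pos_eq; lra).
  assert (Hok := ok_ca q Hq).
  rewrite PS_shift by assumption.
  assert (0 <= Re (PS (fun k => ca q (S k)) x)).
  { apply Series_nonneg.
    - intros k. assert (P := ca_pos q (S k) (proj1 Hq)).
      rewrite <- RtoC_pow, <- RtoC_mult, re_RtoC. apply Rmult_le_pos; [lra|apply pow_le; lra].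
    - exact (proj1 (cex_PS _ x (ok_shift _ Hok) Ht)). }
  set (S1 := PS _ _) in *.
  replace (Re (ca q 0 + x * S1)) with (1 + x * Re S1) by (simpl; unfold Re; ring). nra.
Qed.

Lemma P_neq_0 (q x : R) : 0 < q <= / 4 -> 0 <= x < 1 -> PS (ca q) x <> 0.
Proof.
  intros Hq Hx E. assert (H := Re_P_ge_1 q x Hq Hx). rewrite E in H. simpl in H. lra.
Qed.

Lemma cderive_RtoC_id (r : R) : cderive RtoC r 1.
Proof. apply (cderive_RtoC (fun r => r)). apply @is_derive_id. Qed.

Lemma real_leg_P (n : nat) : (2 <= n)%nat ->
  real_leg n (fun r => PS (ca (qn n)) r) (fun r => PSz (ca (qn n)) r).
Proof.
  intros Hn x Hx. apply (leg_P n Hn RtoC (fun _ => RtoC 1) x).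
  - rewrite Cmod_R, Rabs_pos_eq; lra.
  - apply RtoC_neq_0; lra.
  - apply cderive_RtoC_id.
Qed.

Lemma ccont_PS_at_0 (c : nat -> R) : ok c ->
  ccont (fun r : R => PS c r) 0 /\ ccont (fun r : R => PSz c r) 0.
Proof.
  intros Hc. split; [apply (ccont_PS c RtoC)|apply (ccont_PSz c RtoC)];
    trivial; try apply ccont_RtoC_id; rewrite Cmod_0; lra.
Qed.

(** The Wronskian with [P] is continuous at [0] with value [0], so [y = al P] and [z = al Pz] on
    (0,1); letting [x] tend to [0], where [P] is [1] and [y] is [0], gives [al = 0]. *)
Lemma real_regular_unique (n : nat) (y z : R -> C) : (2 <= n)%nat ->
  real_leg n y z -> ccont y 0 -> ccont z 0 -> y 0 = 0 -> z 0 = 0 ->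
  forall x, 0 < x < 1 -> y x = 0 /\ z x = 0.
Proof.
  intros Hn Hyz Cy Cz Y0 Z0.
  assert (Hq := qn_bound n Hn). set (q := qn n) in *.
  assert (Hok := ok_ca q Hq).
  destruct (ccont_PS_at_0 _ Hok) as [CP CPz].
  destruct (wronskian_prop n y z (fun r => PS (ca q) r) (fun r => PSz (ca q) r)) as [al Hal].
  - exact Hyz.
  - now apply real_leg_P.
  - intros x Hx. apply P_neq_0; [exact Hq|lra].
  - intros e He.
    assert (CW : ccont (fun x : R => y x * PSz (ca q) x - PS (ca q) x * z x)%C 0)
      by (ccont_tac; assumption).
    destruct (locally_right 0 1 _ Rlt_0_1 (ccont_small _ _ e CW He)) as [r [Hr B]].
    exists r. split; [exact Hr|].
    rewrite Y0, Z0 in B.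
    replace (y r * PSz (ca q) r - PS (ca q) r * z r)%C
      with (y r * PSz (ca q) r - PS (ca q) r * z r - (0 * PSz (ca q) 0 - PS (ca q) 0 * 0))%C by ring.
    exact B.
  - assert (Hal0 : al = 0).
    { apply Cmod_eq_0. apply Rle_antisym; [|apply Cmod_ge_0]. apply Rnot_lt_le. intros L.
      assert (CY : ccont (fun x : R => y x - al * PS (ca q) x)%C 0) by (ccont_tac; assumption).
      destruct (locally_right 0 1 _ Rlt_0_1 (ccont_small _ _ _ CY L)) as [r [Hr B]].
      rewrite (proj1 (Hal r Hr)), Y0, PS_0 in B by exact Hok. simpl ca in B.
      replace (al * PS (ca q) r - al * PS (ca q) r - (0 - al * 1))%C with al in B by ring. lra. }
    intros x Hx. destruct (Hal x Hx) as [E1 E2]. rewrite E1, E2, Hal0. split; ring.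
Qed.

(** Transport from the real point [|t|] to [t] along a circular arc. *)
Lemma arc_unique (n : nat) (y z : C -> C) (r th0 : R) : (2 <= n)%nat -> 0 < r < 1 ->
  (forall tau, 0 <= tau <= 1 ->
     leg n (fun tau => r * Cexp (Ci * (tau * th0)%R))%C
           (fun tau => Ci * th0 * (r * Cexp (Ci * (tau * th0)%R)))%C
       (fun tau => y (r * Cexp (Ci * (tau * th0)%R))%C)
       (fun tau => z (r * Cexp (Ci * (tau * th0)%R))%C) tau) ->
  y r = 0 -> z r = 0 ->
  y (r * Cexp (Ci * th0))%C = 0 /\ z (r * Cexp (Ci * th0))%C = 0.
Proof.
  intros Hn Hr HL Y0 Z0. assert (Hq := qn_bound n Hn).
  set (g := fun tau : R => (r * Cexp (Ci * (tau * th0)%R))%C).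
  assert (Hg : forall tau, Cmod (g tau) = r).
  { intros tau. unfold g. rewrite Cmod_mult, Cmod_Cexp, Cmod_R, Rabs_pos_eq by lra.
    replace (Re (Ci * (tau * th0)%R)) with 0 by (simpl; ring). rewrite exp_0. ring. }
  assert (Hg0 : forall tau, g tau <> 0).
  { intros tau. apply Cmod_gt_0. rewrite Hg. lra. }
  assert (Hg1 : forall tau, (1 - g tau)%C <> 0).
  { intros tau. apply one_minus_neq_0. rewrite Hg. lra. }
  (* On the arc [g'] is proportional to [g], so the singular factor [1 / g] cancels: the
     coefficients become [Ci th0 / (1 - g)] and [q Ci th0 g]. Both are bounded by [K], because
     [|1 - g| >= 1 - r] and [q r <= 1]. *)
  set (K := Rabs th0 / (1 - r)).
  assert (HK : 0 <= K) by (apply Rle_mult_inv_pos; [apply Rabs_pos|lra]).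
  assert (HK' : Rabs th0 <= K).
  { apply Rmult_le_reg_r with (1 - r); [lra|]. unfold K, Rdiv.
    rewrite Rmult_assoc, Rinv_l by lra. assert (P := Rabs_pos th0). nra. }
  assert (G := gronwall (fun tau => y (g tau)) (fun tau => z (g tau))
    (fun tau => Ci * th0 / (1 - g tau))%C (fun tau => qn n * (Ci * th0 * g tau))%C 0 1 K
    ltac:(lra) HK).
  assert (E0 : g 0 = r).
  { unfold g. rewrite Rmult_0_l, Cmult_0_r. rewrite Cexp_RtoC, exp_0. ring. }
  assert (E1 : g 1 = (r * Cexp (Ci * th0))%C).
  { unfold g. now rewrite Rmult_1_l. }
  cbv beta in G. rewrite E0, E1, Y0, Z0 in G. apply energy_0.
  eapply Rle_trans; [apply G|].
  - intros tau Ht. destruct (HL tau Ht) as [D1 D2]. fold (g tau) in D1, D2.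
    split; [|split; [|split]].
    + eapply cderive_eq; [exact D1|]. cbv beta. field. split; [apply Hg1|apply Hg0].
    + eapply cderive_eq; [exact D2|]. cbv beta. unfold qn. ring.
    + rewrite Cmod_div by apply Hg1. rewrite Cmod_mult, Cmod_Ci, Cmod_R, Rmult_1_l.
      unfold K, Rdiv. apply Rmult_le_compat_l; [apply Rabs_pos|].
      apply Rinv_le_contravar; [lra|].
      assert (T := Cmod_triangle (1 - g tau) (g tau)).
      replace (1 - g tau + g tau)%C with (RtoC 1) in T by ring.
      rewrite Cmod_1, Hg in T. lra.
    + rewrite !Cmod_mult, Cmod_Ci, !Cmod_R, Hg, (Rabs_pos_eq (qn n)) by lra.
      assert (P := Rabs_pos th0). apply Rle_trans with (2 := HK'). 
      assert (0 <= qn n * r <= 1) by (split; nra). nra.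
  - unfold energy. rewrite Cmod_0. right. ring.
Qed.

Lemma polar (t : C) : t <> 0 -> t = (Cmod t * Cexp (Ci * Carg t))%C.
Proof.
  intros Ht. assert (H := Ht). apply Cmod_gt_0 in H.
  transitivity (Cexp (Clog t)); [symmetry; now apply Cexp_Clog|].
  replace (Clog t) with (RtoC (ln (Cmod t)) + Ci * Carg t)%C.
  - rewrite Cexp_plus, Cexp_RtoC, exp_ln by exact H. reflexivity.
  - apply C_eq; simpl; ring.
Qed.

Lemma cderive_arc (r th0 tau : R) :
  cderive (fun tau => r * Cexp (Ci * (tau * th0)%R))%C tau
    (Ci * th0 * (r * Cexp (Ci * (tau * th0)%R)))%C.
Proof.
  eapply cderive_eq.
  - apply cderive_scal. apply (cderive_Cexp (fun tau => Ci * (tau * th0)%R)%C).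
    apply cderive_scal. apply cderive_RtoC. auto_derive; [trivial|reflexivity].
  - rewrite Rmult_1_l. ring.
Qed.

Lemma ccont_arc (r th0 tau : R) :
  ccont (fun tau => r * Cexp (Ci * (tau * th0)%R))%C tau.
Proof. exact (cderive_ccont _ _ _ (cderive_arc r th0 tau)). Qed.

Lemma Cmod_arc (r th0 : R) : 0 <= r -> Cmod (r * Cexp (Ci * th0)) = r.
Proof.
  intros Hr. rewrite Cmod_mult, Cmod_Cexp, Cmod_R, Rabs_pos_eq by lra.
  replace (Re (Ci * th0)) with 0 by (simpl; ring). rewrite exp_0. ring.
Qed.

(** The predicate [dom] is trivial for solutions regular at [0] and is [slit] for the logarithmic
    one, where the arc from [|t|] to [t] has to avoid the negative axis. *)
Lemma disk_unique (n : nat) (y z : C -> C) (dom : C -> Prop) (t : C) : (2 <= n)%nat ->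
  t <> 0 -> Cmod t < 1 ->
  (forall g g' x, cderive g x (g' x) -> locally x (fun r => cderive g r (g' r)) -> ccont g' x ->
     Cmod (g x) < 1 -> g x <> 0 -> dom (g x) ->
     leg n g g' (fun r => y (g r)) (fun r => z (g r)) x) ->
  (forall tau, 0 <= tau <= 1 -> dom (Cmod t * Cexp (Ci * (tau * Carg t)%R))%C) ->
  (forall x, 0 < x < 1 -> y x = 0 /\ z x = 0) ->
  y t = 0 /\ z t = 0.
Proof.
  intros Hn Ht0 Ht HL Hdom Hreal. assert (Hp := Ht0). apply Cmod_gt_0 in Hp.
  destruct (Hreal (Cmod t) (conj Hp Ht)) as [Y0 Z0].
  assert (A := arc_unique n y z (Cmod t) (Carg t) Hn (conj Hp Ht)).
  rewrite <- (polar t Ht0) in A. apply A; trivial.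
  intros tau Htau. apply HL.
  - apply cderive_arc.
  - apply filter_forall. intros s. apply cderive_arc.
  - apply (ccont_mult (fun _ => Ci * Carg t)%C (fun tau => Cmod t * Cexp (Ci * (tau * Carg t)%R))%C);
      [apply ccont_const|apply ccont_arc].
  - rewrite Cmod_arc; lra.
  - apply Cmod_gt_0. rewrite Cmod_arc; lra.
  - now apply Hdom.
Qed.

(** The hypergeometric expansion of the Euler integral, from uniqueness of the solution regular at
    [0] rather than from termwise integration. *)
Lemma J_eq (n : nat) (t : C) : (2 <= n)%nat -> Cmod t < 1 ->
  J n t = (J n 0 * PS (ca (qn n)) t)%C.
Proof.
  intros Hn Ht. assert (Hq := qn_bound n Hn). assert (Hok := ok_ca _ Hq).
  destruct (Ceq_dec t 0) as [->|Ht0].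
  { rewrite PS_0 by exact Hok. simpl. ring. }
  set (y := fun t => (J n t + - J n 0 * PS (ca (qn n)) t)%C).
  set (z := fun t => (J_z n t + - J n 0 * PSz (ca (qn n)) t)%C).
  assert (HL : forall g g' x, cderive g x (g' x) -> locally x (fun r => cderive g r (g' r)) ->
    ccont g' x -> Cmod (g x) < 1 -> g x <> 0 ->
     leg n g g' (fun r => y (g r)) (fun r => z (g r)) x).
  { intros g g' x H1 H2 H3 H4 H5.
    apply (leg_lin n (- J n 0) g g' (fun r => J n (g r)) (fun r => J_z n (g r))
      (fun r => PS (ca (qn n)) (g r)) (fun r => PSz (ca (qn n)) (g r))).
    - apply leg_J; trivial. now apply slit_one_minus_lt.
    - now apply leg_P. }
  assert (L1 : locally 0 (fun r => cderive RtoC r ((fun _ => RtoC 1) r))).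
  { apply filter_forall. intros r. apply cderive_RtoC_id. }
  assert (S0 : slit (1 - 0)) by (right; simpl; lra).
  destruct (ccont_PS_at_0 _ Hok) as [CP CPz].
  assert (E : y t = 0 /\ z t = 0).
  { apply (disk_unique n y z (fun _ => True)); trivial.
    - intros; now apply HL.
    - apply (real_regular_unique n (fun r : R => y r) (fun r : R => z r) Hn).
      + intros x Hx. apply HL.
        * apply cderive_RtoC_id.
        * apply filter_forall. intros r. apply cderive_RtoC_id.
        * apply ccont_const.
        * rewrite Cmod_R, Rabs_pos_eq; lra.
        * apply RtoC_neq_0; lra.
      + unfold y. ccont_tac; [|exact CP].
        destruct (cderive_J n RtoC (fun _ => RtoC 1) 0 L1 (ccont_const _ _) S0) as [l Hl].
        exact (cderive_ccont _ _ _ Hl).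
      + unfold z. ccont_tac; [|exact CPz].
        destruct (cderive_J_z n RtoC (fun _ => RtoC 1) 0 L1 (ccont_const _ _) S0) as [l Hl].
        exact (cderive_ccont _ _ _ Hl).
      + unfold y. rewrite PS_0 by exact Hok. simpl ca. ring.
      + unfold z. rewrite PSz_0 by exact Hok. unfold J_z. ring. }
  destruct E as [E _]. unfold y in E.
  replace (J n t) with (J n t + - J n 0 * PS (ca (qn n)) t + J n 0 * PS (ca (qn n)) t)%C by ring.
  rewrite E. ring.
Qed.

Lemma SL_eq (n : nat) (t : C) : (2 <= n)%nat -> Cmod t < 1 ->
  PS (caL (qn n)) t = (- PS (ca (qn n)) t * Clog (1 - t))%C.
Proof.
  intros Hn Ht. assert (Hq := qn_bound n Hn). assert (Hok := ok_ca _ Hq). assert (HokL := ok_caL _ Hq).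
  assert (L0 : Clog (1 - 0) = 0).
  { replace (1 - 0)%C with (RtoC 1) by ring. rewrite Clog_RtoC by lra. now rewrite ln_1. }
  assert (S0 : slit (1 - 0)) by (right; simpl; lra).
  assert (E : SLf n t = 0).
  { destruct (Ceq_dec t 0) as [->|Ht0].
    { unfold SLf. rewrite L0, PS_0 by exact HokL. unfold caL. simpl. rewrite Rmult_0_r. ring. }
    refine (proj1 (disk_unique n (SLf n) (SLz n) (fun _ => True) t Hn Ht0 Ht _ _ _)); trivial.
    - intros g g' x H1 H2 H3 H4 H5 _. now apply leg_SL.
    - assert (CL : ccont (fun r : R => Clog (1 - r)) 0) by (ccont_tac; exact S0).
      destruct (ccont_PS_at_0 _ Hok) as [CP CPz]. destruct (ccont_PS_at_0 _ HokL) as [CPL CPLz].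
      apply (real_regular_unique n (fun r : R => SLf n r) (fun r : R => SLz n r) Hn).
      + intros x Hx. apply leg_SL; trivial.
        * rewrite Cmod_R, Rabs_pos_eq; lra.
        * apply RtoC_neq_0; lra.
        * apply cderive_RtoC_id.
      + unfold SLf. ccont_tac; assumption.
      + unfold SLz. ccont_tac; assumption.
      + unfold SLf. rewrite L0, PS_0 by exact HokL. unfold caL. simpl. rewrite Rmult_0_r. ring.
      + unfold SLz. rewrite L0, !PSz_0 by assumption. ring. }
  unfold SLf in E.
  replace (PS (caL (qn n)) t) with
    (PS (caL (qn n)) t + PS (ca (qn n)) t * Clog (1 - t) - PS (ca (qn n)) t * Clog (1 - t))%C by ring.
  rewrite E. ring.
Qed.

(** * The Euler integral near its singular point [1] *)

Lemma kern_real (n : nat) (s X : R) : 0 < 1 - s * X ->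
  kern n s X = Rpower (1 - s * X) (- / INR n).
Proof.
  intros H. unfold kern. rewrite <- RtoC_mult, <- RtoC_minus. now apply Cpower_RtoC.
Qed.

(** The exponent [1/n] is at most [1/2], so one bound by an inverse square root covers every [n]. *)
Lemma Rpower_neg_le (n : nat) (b x : R) : (2 <= n)%nat -> 0 < x <= b -> x <= 1 ->
  Rpower b (- / INR n) <= / sqrt x.
Proof.
  intros Hn Hb Hx. assert (Hp := inv_INR_bound n Hn).
  rewrite <- (Rpower_sqrt x) by lra. rewrite <- Rpower_Ropp.
  apply Rle_trans with (Rpower x (- / INR n)).
  - rewrite !Rpower_Ropp. apply Rinv_le_contravar; [apply exp_pos|].
    apply Rle_Rpower_l; lra.
  - unfold Rpower. apply exp_le. assert (L : ln x <= 0) by (apply ln_nonpos; lra). nra.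
Qed.

Lemma mw_nonneg (n : nat) (u : R) : 0 <= u <= 1 -> 0 <= mw n u.
Proof.
  intros Hu. unfold mw. apply Rle_mult_inv_pos; [|now apply Qd_pos].
  apply Rmult_le_pos; [apply pos_INR|apply pow_le; lra].
Qed.

Lemma mw_bounded (n : nat) : exists K, 0 < K /\ forall u, 0 <= u <= 1 -> mw n u <= K.
Proof.
  destruct (ccont_on_bounded (fun u => RtoC (mw n u)) 0 1) as [K [H0 H]].
  - intros u Hu. apply (ccont_RtoC (mw n)). now apply continuous_mw.
  - exists K. split; [exact H0|]. intros u Hu. specialize (H u Hu).
    rewrite Cmod_R in H. apply Rle_trans with (2 := H), Rle_abs.
Qed.

Lemma slit_s (x : R) : 0 < x -> slit (1 - (1 - x)).
Proof. intros H. right. simpl. lra. Qed.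

(** The true growth is logarithmic. The bound [x^(-1/2)] suffices, since in the Wronskian
    [J n (1 - x)] is multiplied by [PSz], which is [O(x)]. *)
Lemma J_bound (n : nat) : (2 <= n)%nat -> exists K, 0 <= K /\ forall x, 0 < x < 1 ->
  Cmod (J n (1 - x)) <= K * / sqrt x.
Proof.
  intros Hn. destruct (mw_bounded n) as [K [HK0 HK]]. exists (2 * K). split; [lra|].
  intros x Hx. unfold J.
  assert (Hsx : 0 < / sqrt x) by (apply Rinv_0_lt_compat, sqrt_lt_R0; lra).
  replace (2 * K * / sqrt x) with (2 * ((1 - 0) * (K * / sqrt x))) by ring.
  apply Cmod_cint_le; [lra|apply ccont_mw_kern, slit_s; lra|].
  intros u Hu. assert (HX := Xf_bound n u Hu). assert (Hm := mw_nonneg n u Hu).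
  rewrite <- RtoC_minus. rewrite kern_real by nra.
  rewrite Cmod_mult, !Cmod_R, !Rabs_pos_eq; [|left; apply exp_pos|exact Hm].
  apply Rmult_le_compat; [exact Hm|left; apply exp_pos|now apply HK|].
  apply Rpower_neg_le; [exact Hn|nra|lra].
Qed.

(* [(1 - X)^(1 - 1/n)] times the weight, extended continuously to [u = 1]. *)
Definition h1 (n : nat) (u : R) : R :=
  INR n * u ^ (n - 2) * (1 - u) ^ (n - 1) * Rpower (Qd n u) (/ INR n - 2).

(** In the variable [X] this is the integral of [X^(-1/n)] over [0,1], with primitive
    [n / (n - 1) X^(1 - 1/n)]. *)
Lemma h1_integral (n : nat) : (2 <= n)%nat ->
  cint (fun u => RtoC (h1 n u)) 0 1 = RtoC (INR n / (INR n - 1)) /\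
  ccont_on (fun u => RtoC (h1 n u)) 0 1.
Proof.
  intros Hn. assert (Hn2 := INR_ge_2 n Hn).
  assert (Hc : ccont_on (fun u => RtoC (h1 n u)) 0 1).
  { intros u Hu. assert (P := Qd_pos n u Hu). apply (ccont_RtoC (h1 n)).
    apply continuous_of_derivable. unfold h1, Qd, Rpower in *. auto_derive. exact P. }
  split; [|exact Hc].
  rewrite (cint_derive (fun u => RtoC (INR n / (INR n - 1) * u ^ (n - 1) * Rpower (Qd n u) (/ INR n - 1)))
    _ 0 1).
  - replace (Qd n 1) with 1.
    2: { unfold Qd. rewrite pow1, Rminus_diag, pow_i by lia. ring. }
    rewrite pow1, (pow_i (n - 1)) by lia. unfold Rpower at 1. rewrite ln_1, Rmult_0_r, exp_0.
    rewrite <- RtoC_minus. f_equal. ring.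
  - lra.
  - intros u Hu. assert (P := Qd_pos n u Hu).
    apply (cderive_RtoC (fun u => INR n / (INR n - 1) * u ^ (n - 1) * Rpower (Qd n u) (/ INR n - 1))).
    unfold h1, Qd, Rpower in *. auto_derive; [exact P|].
    change (1 + - u) with (1 - u).
    replace (/ INR n - 2) with (/ INR n + - 1 - 1) by ring.
    set (Q := u ^ n + (1 - u) ^ n) in *.
    replace ((/ INR n + - 1 - 1) * ln Q) with ((/ INR n + - 1) * ln Q + - ln Q) by ring.
    rewrite exp_plus, exp_Ropp, exp_ln by exact P.
    set (e := exp _).
    replace (pred n) with (n - 1)%nat by lia.
    replace (pred (n - 1)) with (n - 2)%nat by lia.
    rewrite (minus_INR n 1) by lia. change (INR 1) with 1.
    destruct (pow_split n u Hn) as [E1 E3]. destruct (pow_split n (1 - u) Hn) as [E2 E4].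
    apply Rmult_eq_reg_r with (Q * (INR n - 1)); [|nra].
    transitivity (INR n * e * (u ^ (n - 2) * (INR n - 1) * Q
      + (1 - INR n) * u ^ (n - 1) * (u ^ (n - 1) - (1 - u) ^ (n - 1)))).
    { field. lra. }
    transitivity (INR n * u ^ (n - 2) * (1 - u) ^ (n - 1) * e * (INR n - 1)).
    2: { field. lra. }
    unfold Q. rewrite E1, E2, E3, E4. ring.
  - exact Hc.
Qed.

(* With [a = 1 - X] and [b = 1 - sX]: [a^(1-p) - a b^(-p) <= sqrt x] when [s = 1 - x]. *)
Lemma power_gap (p a b x : R) : 0 < p <= / 2 -> 0 < x -> 0 < a <= 1 -> a <= b <= a + x ->
  0 <= a * Rpower a (- p) - a * Rpower b (- p) <= sqrt x.
Proof.
  intros Hp Hx Ha Hb.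
  assert (Hsa : a * Rpower a (- p) <= sqrt a).
  { rewrite <- (Rpower_sqrt a) by lra. rewrite <- (Rpower_1 a) at 1 by lra.
    rewrite <- Rpower_plus. unfold Rpower. apply exp_le.
    assert (L : ln a <= 0) by now apply ln_nonpos. nra. }
  assert (Hab : Rpower b (- p) <= Rpower a (- p)).
  { rewrite !Rpower_Ropp. apply Rinv_le_contravar; [apply exp_pos|]. apply Rle_Rpower_l; lra. }
  assert (Hpos : 0 < Rpower a (- p)) by apply exp_pos.
  split; [nra|].
  assert (Hratio : a / b * Rpower a (- p) <= Rpower b (- p)).
  { replace (a / b) with (Rpower (a / b) 1) by (apply Rpower_1, Rdiv_lt_0_compat; lra).
    apply Rle_trans with (Rpower (a / b) p * Rpower a (- p)).
    - apply Rmult_le_compat_r; [lra|]. unfold Rpower.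
      assert (L : ln (a / b) <= 0).
      { apply ln_nonpos. split; [apply Rdiv_lt_0_compat; lra|].
        apply Rmult_le_reg_r with b; [lra|]. unfold Rdiv. rewrite Rmult_assoc, Rinv_l; lra. }
      apply exp_le. nra.
    - right. unfold Rpower. rewrite <- exp_plus. f_equal. rewrite ln_div by lra. ring. }
  assert (Sa := sqrt_sqrt a ltac:(lra)). assert (Sx := sqrt_sqrt x ltac:(lra)).
  assert (Pa : 0 < sqrt a) by (apply sqrt_lt_R0; lra).
  assert (Px : 0 < sqrt x) by (apply sqrt_lt_R0; lra).
  (* If [a <= x], the first term alone is at most [sqrt a <= sqrt x]. Otherwise the gap is at most
     [sqrt a (b - a) / b], hence at most [x / sqrt a <= sqrt x]. *)
  destruct (Rle_dec a x) as [L|L].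
  - assert (sqrt a <= sqrt x) by (apply sqrt_le_1; lra).
    assert (0 <= a * Rpower b (- p)) by (apply Rmult_le_pos; [lra|left; apply exp_pos]). lra.
  - assert (sqrt x <= sqrt a) by (apply sqrt_le_1; lra).
    apply Rle_trans with (sqrt a * (1 - a / b)).
    + apply Rle_trans with (a * Rpower a (- p) * (1 - a / b)).
      * replace (a * Rpower a (- p) * (1 - a / b))
          with (a * Rpower a (- p) - a * (a / b * Rpower a (- p))) by ring.
        assert (a * (a / b * Rpower a (- p)) <= a * Rpower b (- p)).
        { apply Rmult_le_compat_l; lra. }
        lra.
      * apply Rmult_le_compat_r; [|exact Hsa].
        replace (1 - a / b) with ((b - a) / b) by (field; lra). apply Rle_mult_inv_pos; lra.
    + apply Rmult_le_reg_r with b; [lra|].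
      replace (sqrt a * (1 - a / b) * b) with (sqrt a * (b - a)) by (field; lra).
      apply Rle_trans with (sqrt a * x); [apply Rmult_le_compat_l; lra|].
      apply Rle_trans with (sqrt x * a); [|apply Rmult_le_compat_l; lra].
      set (sa := sqrt a) in *. set (sx := sqrt x) in *.
      assert (0 <= sa * sx * (sa - sx)) by (repeat apply Rmult_le_pos; lra).
      replace (sa * x) with (sa * sx * sx) by (rewrite <- Sx; ring).
      replace (sx * a) with (sa * sx * sa) by (rewrite <- Sa; ring). lra.
Qed.

(** At [s = 1] the kernel meets the branch point, so continuity cannot be taken from
    [cderive_kern_int] and the integrands are compared directly. The limit [n / (n - 1)] makes
    [- J_z n (1 - x)] tend to [-1], like [Phiz]. *)
Lemma M_lim (n : nat) : (2 <= n)%nat -> exists K, 0 <= K /\ forall x, 0 < x < 1 ->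
  Cmod (M n (1 - x) - INR n / (INR n - 1)) <= K * sqrt x.
Proof.
  intros Hn. destruct (mw_bounded n) as [K [HK0 HK]]. exists (2 * K). split; [lra|].
  intros x Hx. assert (Hn2 := INR_ge_2 n Hn).
  destruct (h1_integral n Hn) as [HI HC].
  rewrite RtoC_div, RtoC_minus in HI by lra. rewrite <- HI. unfold M.
  assert (CM : ccont_on (fun u => (mw n u * (1 - Xf n u))%R * kern n (1 - x) (Xf n u))%C 0 1).
  { apply (ccont_int_kern n (1 - x) (slit_s x (proj1 Hx)) (fun u => RtoC (mw n u * (1 - Xf n u)))).
    intros u Hu. apply (ccont_RtoC (fun u => mw n u * (1 - Xf n u))). now apply continuous_weight. }
  replace (cint _ 0 1 - cint _ 0 1)%C with
   (cint (fun u => (mw n u * (1 - Xf n u))%R * kern n (1 - x) (Xf n u) + - (1) * h1 n u)%C 0 1).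
  2: { rewrite (cint_plus (fun u => (mw n u * (1 - Xf n u))%R * kern n (1 - x) (Xf n u))%C
         (fun u => - (1) * h1 n u)%C); [|lra|exact CM|now apply ccont_on_scal].
       rewrite cint_scal by (lra || exact HC). ring. }
  replace (2 * K * sqrt x) with (2 * ((1 - 0) * (K * sqrt x))) by ring.
  apply Cmod_cint_le; [lra| |].
  { apply (ccont_on_plus (fun u => (mw n u * (1 - Xf n u))%R * kern n (1 - x) (Xf n u))%C
         (fun u => - (1) * h1 n u)%C); [exact CM|now apply ccont_on_scal]. }
  intros u Hu. assert (HX := Xf_bound n u Hu). assert (Hm := mw_nonneg n u Hu).
  assert (HQ := Qd_pos n u Hu). assert (Hsx := sqrt_pos x).
  rewrite <- RtoC_minus, kern_real by nra.
  rewrite <- RtoC_opp, <- !RtoC_mult, <- RtoC_plus, Cmod_R.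
  (* At [u = 1] the power of [1 - X = 0] is a junk value, so this endpoint is treated apart; both
     integrands vanish there. *)
  destruct (Req_dec u 1) as [E|E].
  { assert (EX : 1 - Xf n u = 0).
    { unfold Xf, Qd. rewrite E, pow1, Rminus_diag, pow_i by lia. field. }
    assert (Eh : h1 n u = 0).
    { unfold h1. replace ((1 - u) ^ (n - 1)) with 0; [ring|].
      rewrite E, Rminus_diag, pow_i by lia. reflexivity. }
    rewrite EX, Eh, !Rmult_0_r, Rmult_0_l, Rplus_0_l, Rabs_R0. apply Rmult_le_pos; lra. }
  assert (Ea : 1 - Xf n u = (1 - u) ^ n / Qd n u) by (unfold Xf; unfold Qd in *; field; lra).
  assert (Ha : 0 < 1 - Xf n u).
  { rewrite Ea. apply Rdiv_lt_0_compat; [apply pow_lt; lra|exact HQ]. }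
  assert (Eh : h1 n u = mw n u * ((1 - Xf n u) * Rpower (1 - Xf n u) (- / INR n))).
  { rewrite Ea. unfold h1, mw. 
    assert (ER : Rpower ((1 - u) ^ n / Qd n u) (- / INR n) = Rpower (Qd n u) (/ INR n) / (1 - u)).
    { rewrite Rpower_Ropp. unfold Rpower at 1. rewrite ln_div by (try apply pow_lt; lra).
      rewrite <- Rpower_pow by lra. unfold Rpower at 1. rewrite ln_exp.
      replace (/ INR n * (INR n * ln (1 - u) - ln (Qd n u)))
        with (ln (1 - u) + - (/ INR n * ln (Qd n u))) by (field; lra).
      rewrite exp_plus, exp_Ropp, exp_ln by lra. unfold Rpower.
      assert (EP := exp_pos (/ INR n * ln (Qd n u))). field. lra. }
    rewrite ER.
    replace (Rpower (Qd n u) (/ INR n - 2)) with (Rpower (Qd n u) (/ INR n) / (Qd n u * Qd n u)).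
    - destruct (pow_split n (1 - u) Hn) as [E2 E4]. rewrite E2, E4. field. lra.
    - unfold Rpower. replace ((/ INR n - 2) * ln (Qd n u))
        with (/ INR n * ln (Qd n u) + - (ln (Qd n u) + ln (Qd n u))) by ring.
      rewrite exp_plus, exp_Ropp, exp_plus, exp_ln by exact HQ. reflexivity. }
  rewrite Eh.
  assert (G := power_gap (/ INR n) (1 - Xf n u) (1 - (1 - x) * Xf n u) x
    (inv_INR_bound n Hn) (proj1 Hx) ltac:(lra) ltac:(nra)).
  set (A := (1 - Xf n u) * Rpower (1 - Xf n u) (- / INR n)) in *.
  set (Bv := (1 - Xf n u) * Rpower (1 - (1 - x) * Xf n u) (- / INR n)) in *.
  replace (mw n u * (1 - Xf n u) * Rpower (1 - (1 - x) * Xf n u) (- / INR n) + - (1) * (mw n u * A))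
    with (- (mw n u * (A - Bv))) by (unfold Bv; ring).
  rewrite Rabs_Ropp, Rabs_pos_eq by (apply Rmult_le_pos; lra).
  apply Rmult_le_compat; try lra. now apply HK.
Qed.

(** * Orders of magnitude as [x = s^2] tends to [0+] *)
Definition bo (w : R -> R) (f : R -> C) : Prop :=
  exists K, 0 <= K /\ forall s, 0 < s <= / 2 -> Cmod (f (s * s)) <= K * w s.

Lemma bo_plus (w : R -> R) (f g : R -> C) : bo w f -> bo w g -> bo w (fun x => f x + g x)%C.
Proof.
  intros [K [HK H]] [K' [HK' H']]. exists (K + K'). split; [lra|]. intros s Hs.
  eapply Rle_trans; [apply Cmod_triangle|]. specialize (H s Hs). specialize (H' s Hs). lra.
Qed.

Lemma bo_mult (w w' : R -> R) (f g : R -> C) : bo w f -> bo w' g ->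
  bo (fun s => w s * w' s) (fun x => f x * g x)%C.
Proof.
  intros [K [HK H]] [K' [HK' H']]. exists (K * K'). split; [now apply Rmult_le_pos|]. intros s Hs.
  rewrite Cmod_mult. replace (K * K' * (w s * w' s)) with ((K * w s) * (K' * w' s)) by ring.
  apply Rmult_le_compat; try apply Cmod_ge_0; auto.
Qed.

Lemma bo_le (w w' : R -> R) (f g : R -> C) :
  (forall s, 0 < s <= / 2 -> w s <= w' s) -> (forall x, 0 < x < 1 -> f x = g x) ->
  bo w f -> bo w' g.
Proof.
  intros Hw Hfg [K [HK H]]. exists K. split; [exact HK|]. intros s Hs.
  rewrite <- Hfg by nra. apply Rle_trans with (1 := H s Hs).
  apply Rmult_le_compat_l; [exact HK|now apply Hw].
Qed.

Lemma bo_const (c : C) : bo (fun _ => 1) (fun _ => c).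
Proof. exists (Cmod c). split; [apply Cmod_ge_0|]. intros; lra. Qed.

Lemma bo_id : bo (fun s => s * s) (fun x => RtoC x).
Proof.
  exists 1. split; [lra|]. intros s Hs. rewrite Cmod_R, Rabs_pos_eq by nra. lra.
Qed.

Lemma bo_PS0 (c : nat -> R) : ok c -> bo (fun s => s * s) (fun x => PS c x - c 0%nat)%C.
Proof.
  intros Hc. destruct (PS_Lipschitz c (/ 2) Hc ltac:(lra)) as [B [HB0 HB]].
  exists B. split; [exact HB0|]. intros s Hs.
  rewrite <- PS_0 by exact Hc. eapply Rle_trans.
  - apply HB; [rewrite Cmod_0; lra|rewrite Cmod_R, Rabs_pos_eq by nra; nra].
  - replace (RtoC (s * s) - 0)%C with (RtoC (s * s)) by ring.
    rewrite Cmod_R, Rabs_pos_eq by nra. lra.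
Qed.

Lemma bo_PS (c : nat -> R) : ok c -> bo (fun _ => 1) (fun x => PS c x).
Proof.
  intros Hc. apply bo_le with (fun _ => 1) (fun x => (PS c x - c 0%nat) + c 0%nat)%C.
  - intros; lra.
  - intros; ring.
  - apply (bo_plus _ (fun x => PS c x - c 0%nat)%C (fun _ => RtoC (c 0%nat))).
    + apply bo_le with (fun s => s * s) (fun x => PS c x - c 0%nat)%C; [intros; nra|trivial|now apply bo_PS0].
    + apply bo_const.
Qed.

Lemma bo_one_minus : bo (fun _ => 1) (fun x => 1 - x)%C.
Proof.
  exists 1. split; [lra|]. intros s Hs. rewrite <- RtoC_minus, Cmod_R, Rabs_pos_eq; nra.
Qed.

Lemma bo_PSz (c : nat -> R) : ok c -> bo (fun s => s * s) (fun x => PSz c x).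
Proof.
  intros Hc. apply bo_le with (fun s => 1 * (s * s)) (fun x => (1 - x) * (PS (th c) x - th c 0))%C.
  - intros; lra.
  - intros x _. unfold PSz. replace (th c 0) with 0 by (unfold th; simpl; ring). ring.
  - apply (bo_mult _ _ (fun x => 1 - x)%C (fun x => PS (th c) x - th c 0)%C); [apply bo_one_minus|].
    now apply bo_PS0, ok_th.
Qed.

Lemma bo_Clog : bo (fun s => / s) (fun x => Clog x).
Proof.
  exists 2. split; [lra|]. intros s Hs. rewrite Clog_RtoC by nra. rewrite Cmod_R, ln_mult by lra.
  assert (L : ln s <= 0) by (apply ln_nonpos; lra).
  rewrite Rabs_left1 by lra.
  assert (Hi : 0 < / s) by (apply Rinv_0_lt_compat; lra).
  assert (E : - ln s < / s).
  { rewrite <- ln_Rinv by lra.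
    assert (X := exp_ineq1_le (ln (/ s))). rewrite exp_ln in X by exact Hi. lra. }
  lra.
Qed.

Lemma bo_J (n : nat) : (2 <= n)%nat -> bo (fun s => / s) (fun x => J n (1 - x)).
Proof.
  intros Hn. destruct (J_bound n Hn) as [K [HK H]]. exists K. split; [exact HK|]. intros s Hs.
  assert (E : sqrt (s * s) = s) by (apply sqrt_square; lra).
  assert (Hss : 0 < s * s < 1) by nra. specialize (H _ Hss). rewrite E in H. exact H.
Qed.

Lemma bo_Jz (n : nat) : (2 <= n)%nat -> bo (fun s => s) (fun x => - J_z n (1 - x) + 1)%C.
Proof.
  intros Hn. assert (Hn2 := INR_ge_2 n Hn).
  assert (HM : bo (fun s => s) (fun x => M n (1 - x) - INR n / (INR n - 1))%C).
  { destruct (M_lim n Hn) as [K [HK H]]. exists K. split; [exact HK|]. intros s Hs.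
    assert (E : sqrt (s * s) = s) by (apply sqrt_square; lra).
    assert (Hss : 0 < s * s < 1) by nra. specialize (H _ Hss). rewrite E in H. exact H. }
  apply bo_le with (fun s => s) (fun x =>
    - (1 - / INR n)%R * ((1 - x) * (M n (1 - x) - INR n / (INR n - 1))) + x)%C.
  - intros; lra.
  - intros x _. unfold J_z.
    assert (N1 : RtoC (INR n) <> 0) by (apply RtoC_neq_0; lra).
    assert (N2 : (INR n - 1)%C <> 0) by (rewrite <- RtoC_minus; apply RtoC_neq_0; lra).
    rewrite RtoC_minus, RtoC_inv by lra. field. split; assumption.
  - apply (bo_plus _ (fun x => - (1 - / INR n)%R * ((1 - x) * (M n (1 - x) - INR n / (INR n - 1))))%C
      (fun x => RtoC x)).
    + apply bo_le with (fun s => 1 * (1 * s)) (fun x => - (1 - / INR n)%R * ((1 - x) * (M n (1 - x) - INR n / (INR n - 1))))%C;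
        [intros; lra|trivial|].
      apply (bo_mult _ _ (fun _ => - (1 - / INR n)%R)%C); [apply bo_const|].
      apply (bo_mult _ _ (fun x => 1 - x)%C); [apply bo_one_minus|exact HM].
    + apply bo_le with (fun s => s * s) (fun x => RtoC x); [intros; nra|trivial|apply bo_id].
Qed.

(** * Growth of [P] at [1] and the connection formula *)

Lemma Series_pow_unbounded (q A : R) : 0 < q <= / 4 ->
  exists d, 0 < d < 1 /\ forall x, d < x < 1 -> A <= Re (PS (ca q) x).
Proof.
  intros Hq.
  (* The sequence [k a_k] is nondecreasing and starts with [q], so the partial sums of [a_k]
     dominate [q] times the harmonic numbers. *)
  assert (Hk : forall k, q * / INR (S k) <= ca q (S k)).
  { intros k. induction k as [|k IH].
    - simpl. field_simplify; lra.
    - set (m := S k) in *. cbn [ca]. rewrite (S_INR m).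
      assert (Hi : 1 <= INR m) by (unfold m; rewrite S_INR; assert (P := pos_INR k); lra).
      set (x := INR m) in *.
      apply Rle_trans with (q * / x * (x * x + x + q) / ((x + 1) * (x + 1))).
      + apply Rmult_le_reg_r with (x * ((x + 1) * (x + 1))); [apply Rmult_lt_0_compat; nra|].
        field_simplify; nra.
      + unfold Rdiv. rewrite (Rmult_assoc (q * / x)), (Rmult_assoc (ca q m)).
        apply Rmult_le_compat_r; [|exact IH]. apply Rle_mult_inv_pos; nra. }
  assert (HS : forall N, q * harmonic N <= sum_f_R0 (ca q) N).
  { intros N. induction N as [|N IH].
    - simpl. rewrite harmonic_0. lra.
    - rewrite harmonic_S, tech5. specialize (Hk N). lra. }
  assert (HH : forall N, ln (INR (S N)) <= harmonic N).
  { intros N. induction N as [|N IH].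
    - rewrite harmonic_0. simpl. rewrite ln_1. lra.
    - rewrite harmonic_S. rewrite (S_INR (S N)).
      assert (Hi : 0 < INR (S N)) by (apply lt_0_INR; lia).
      set (x := INR (S N)) in *.
      assert (L : ln (x + 1) = ln x + ln ((x + 1) / x)).
      { rewrite <- ln_mult; [f_equal; field; lra|lra|apply Rdiv_lt_0_compat; lra]. }
      assert (X := exp_ineq1_le (ln ((x + 1) / x))). rewrite exp_ln in X by (apply Rdiv_lt_0_compat; lra).
      replace ((x + 1) / x) with (1 + / x) in * by (field; lra).
      rewrite L. lra. }
  set (A' := Rmax A 1). assert (HA' : 1 <= A' /\ A <= A') by (unfold A'; split; [apply Rmax_r|apply Rmax_l]).
  (* For this [N] the partial sum of the coefficients is at least [q ln (N + 1) >= 2 A'], and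
     [x^N > 1/2] near [1] keeps half of it. *)
  destruct (nfloor_ex (exp (2 * A' / q))) as [N [_ HN]]; [left; apply exp_pos|].
  assert (HN' : 2 * A' <= sum_f_R0 (ca q) N).
  { apply Rle_trans with (2 := HS N).
    assert (L : 2 * A' / q <= ln (INR (S N))).
    { rewrite <- (ln_exp (2 * A' / q)). rewrite S_INR. left. apply ln_increasing; [apply exp_pos|exact HN]. }
    apply Rle_trans with (q * (2 * A' / q)); [right; field; lra|].
    apply Rmult_le_compat_l; [lra|]. apply Rle_trans with (1 := L), HH. }
  assert (HC : continuous (fun x : R => x ^ N) 1) by apply continuous_pow_id.
  assert (HL : locally 1 (fun x => / 2 < x ^ N)).
  { apply (HC (fun y => / 2 < y)). rewrite pow1. apply (open_gt (/ 2)). lra. }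
  destruct HL as [d0 Hd0].
  set (d := Rmax (/ 2) (1 - d0)).
  assert (Hd : 0 < d < 1).
  { unfold d, Rmax. assert (P := cond_pos d0). destruct (Rle_dec (/ 2) (1 - d0)); lra. }
  exists d. split; [exact Hd|]. intros x Hx.
  assert (Hx1 : / 2 < x ^ N).
  { apply Hd0. change (Rabs (x - 1) < d0). assert (1 - d0 <= d) by apply Rmax_r.
    rewrite Rabs_left1 by lra. lra. }
  assert (Hok := ok_ca q Hq).
  assert (Ht : Cmod x < 1) by (rewrite Cmod_R, Rabs_pos_eq; lra).
  assert (Hex := proj1 (cex_PS _ x Hok Ht)).
  assert (ER : forall k, Re (ca q k * x ^ k) = ca q k * x ^ k).
  { intros k. rewrite <- RtoC_pow, <- RtoC_mult. apply re_RtoC. }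
  change (Re (PS (ca q) x)) with (Series (fun k => Re (ca q k * x ^ k))).
  assert (Hpart : forall N, sum_f_R0 (ca q) N * x ^ N <= sum_f_R0 (fun k => ca q k * x ^ k) N).
  { intros m. induction m as [|m IH]; [simpl; lra|].
    rewrite !tech5, Rmult_plus_distr_r. apply Rplus_le_compat; [|right; reflexivity].
    apply Rle_trans with (2 := IH). simpl pow.
    assert (0 <= sum_f_R0 (ca q) m).
    { apply cond_pos_sum. intros k. left; now apply ca_pos. }
    assert (0 <= x ^ m) by (apply pow_le; lra). 
    assert (0 <= sum_f_R0 (ca q) m * x ^ m) by now apply Rmult_le_pos. nra. }
  assert (Hle : sum_f_R0 (fun k => ca q k * x ^ k) N <= Series (fun k => Re (ca q k * x ^ k))).
  { rewrite <- (Series_ext (fun k => ca q k * x ^ k)).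
    2: { intros k. symmetry. apply ER. }
    assert (Hex' : ex_series (fun k => ca q k * x ^ k)).
    { eapply ex_series_ext; [|exact Hex]. exact ER. }
    rewrite (Series_incr_n _ (S N)) by (trivial; lia). simpl pred.
    assert (0 <= Series (fun k => ca q (S N + k) * x ^ (S N + k))).
    { apply Series_nonneg.
      - intros k. apply Rmult_le_pos; [left; now apply ca_pos|apply pow_le; lra].
      - now apply (ex_series_incr_n (fun k => ca q k * x ^ k)). }
    lra. }
  specialize (Hpart N). nra.
Qed.

Lemma bo_opp (w : R -> R) (f : R -> C) : bo w f -> bo w (fun x => - f x)%C.
Proof.
  intros [K [HK H]]. exists K. split; [exact HK|]. intros s Hs. rewrite Cmod_opp. now apply H.
Qed.

Lemma bo_small (f : R -> C) (e : R) : bo (fun s => s) f -> 0 < e ->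
  exists x, 0 < x < 1 /\ Cmod (f x) < e.
Proof.
  intros [K [HK H]] He. set (s := Rmin (/ 2) (e / (2 * (K + 1)))).
  assert (P : 0 < e / (2 * (K + 1))) by (apply Rdiv_lt_0_compat; lra).
  assert (Hs : 0 < s <= / 2). { split; [apply Rmin_pos; lra|apply Rmin_l]. }
  assert (Hs' : s <= e / (2 * (K + 1))) by apply Rmin_r.
  exists (s * s). split; [nra|]. apply Rle_lt_trans with (1 := H s Hs).
  apply Rle_lt_trans with (K * (e / (2 * (K + 1)))); [now apply Rmult_le_compat_l|].
  apply Rmult_lt_reg_r with (2 * (K + 1)); [lra|].
  replace (K * (e / (2 * (K + 1))) * (2 * (K + 1))) with (K * e) by (field; lra). nra.
Qed.

Lemma bo_Phi (n : nat) (kap : R) : (2 <= n)%nat ->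
  bo (fun s => / s) (fun x => Phi n kap x) /\
  bo (fun s => s) (fun x => Phiz n kap x + 1)%C.
Proof.
  intros Hn. assert (Hq := qn_bound n Hn). assert (Hok := ok_ca _ Hq).
  assert (HM := ok_cM n Hn kap).
  assert (B1 : bo (fun s => / s) (fun x => PS (ca (qn n)) x * Clog x)%C).
  { apply bo_le with (fun s => 1 * / s) (fun x => PS (ca (qn n)) x * Clog x)%C; [intros; lra|trivial|].
    apply (bo_mult _ _ (fun x : R => PS (ca (qn n)) x) (fun x : R => Clog x));
      [now apply bo_PS|apply bo_Clog]. }
  split.
  - apply (bo_plus _ (fun x => - (PS (ca (qn n)) x * Clog x))%C (fun x => - PS (cM n kap) x)%C).
    + now apply (bo_opp _ (fun x => PS (ca (qn n)) x * Clog x)%C).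
    + apply (bo_opp _ (fun x : R => PS (cM n kap) x)).
      apply bo_le with (fun _ => 1) (fun x : R => PS (cM n kap) x); [|trivial|now apply bo_PS].
      intros s Hs. rewrite <- Rinv_1. apply Rinv_le_contravar; lra.
  - apply bo_le with (fun s => s) (fun x => - (PSz (ca (qn n)) x * Clog x)
      + (- PSz (cM n kap) x + (- ((1 - x) * (PS (ca (qn n)) x - ca (qn n) 0)) + x)))%C.
    + intros; lra.
    + intros x _. unfold Phiz. simpl ca. ring.
    + assert (W : forall f : R -> C, bo (fun s => s * s) f -> bo (fun s => s) f).
      { intros f. apply bo_le; [intros; nra|trivial]. }
      apply (bo_plus _ (fun x => - (PSz (ca (qn n)) x * Clog x))%C); [|apply (bo_plus _ (fun x => - PSz (cM n kap) x)%C); [|apply (bo_plus _ (fun x => - ((1 - x) * (PS (ca (qn n)) x - ca (qn n) 0)))%C (fun x => RtoC x))]].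
      * apply (bo_opp _ (fun x => PSz (ca (qn n)) x * Clog x)%C).
        apply bo_le with (fun s => (s * s) * / s) (fun x => PSz (ca (qn n)) x * Clog x)%C;
          [|trivial|].
        -- intros s Hs. right. field. lra.
        -- apply (bo_mult _ _ (fun x : R => PSz (ca (qn n)) x) (fun x : R => Clog x));
             [now apply bo_PSz|apply bo_Clog].
      * apply (bo_opp _ (fun x : R => PSz (cM n kap) x)). apply W. now apply bo_PSz.
      * apply (bo_opp _ (fun x => (1 - x) * (PS (ca (qn n)) x - ca (qn n) 0))%C). apply W.
        apply bo_le with (fun s => 1 * (s * s)) (fun x => (1 - x) * (PS (ca (qn n)) x - ca (qn n) 0))%C;
          [intros; lra|trivial|].
        apply (bo_mult _ _ (fun x => 1 - x)%C (fun x => PS (ca (qn n)) x - ca (qn n) 0)%C);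
          [apply bo_one_minus|now apply bo_PS0].
      * apply W, bo_id.
Qed.

Lemma bounded_prefix (c : nat -> R) (N : nat) : exists K, 0 <= K /\ forall k, (k < N)%nat -> Rabs (c k) <= K.
Proof.
  induction N as [|N [K [HK H]]]; [exists 0; split; [lra|lia]|].
  exists (K + Rabs (c N)). assert (P := Rabs_pos (c N)). split; [lra|].
  intros k Hk. destruct (Nat.eq_dec k N) as [->|E]; [lra|].
  specialize (H k ltac:(lia)). lra.
Qed.

(** Coefficients that are [o(a_k)] give a sum that is [o(P)] as [x] tends to [1], since [P] is
    unbounded there: [K] absorbs the head and [e P] the tail. *)
Lemma PS_small_o (q : R) (c d : nat -> R) (e : R) : 0 < q <= / 4 -> 0 < e ->
  (forall k, c k = ca q k * d k) -> is_lim_seq d 0 ->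
  exists K, 0 <= K /\ forall x : R, 0 < x < 1 -> Cmod (PS c x) <= K + e * Re (PS (ca q) x).
Proof.
  intros Hq He Hc Hd.
  apply is_lim_seq_spec in Hd. destruct (Hd (mkposreal (e / 2) ltac:(lra))) as [N HN]. simpl in HN.
  (* The factor [2 ^ k] turns the bound on the first [N] terms into the summable [K (1/2)^k]. The
     tolerance [e / 2] above makes up for the factor 2 in [Cmod_CSeries_le]. *)
  destruct (bounded_prefix (fun k => c k * 2 ^ k) N) as [K [HK HKb]].
  exists (2 * (K * Series (fun k => (/ 2) ^ k))).
  assert (HG : ex_series (fun k => (/ 2) ^ k)) by (apply ex_series_geom; rewrite Rabs_pos_eq; lra).
  split.
  { apply Rmult_le_pos; [lra|]. apply Rmult_le_pos; [exact HK|].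
    apply Series_nonneg; [intros k; apply pow_le; lra|exact HG]. }
  intros x Hx.
  assert (Hok := ok_ca q Hq).
  assert (Ht : Cmod x < 1) by (rewrite Cmod_R, Rabs_pos_eq; lra).
  assert (Hex := proj1 (cex_PS _ x Hok Ht)).
  assert (ER : forall k, Re (ca q k * x ^ k) = ca q k * x ^ k).
  { intros k. rewrite <- RtoC_pow, <- RtoC_mult. apply re_RtoC. }
  assert (E1 : ex_series (fun k => K * (/ 2) ^ k)) by now apply (@ex_series_scal R_AbsRing R_NormedModule).
  assert (E2 : ex_series (fun k => e / 2 * Re (ca q k * x ^ k)))
    by now apply (@ex_series_scal R_AbsRing R_NormedModule).
  eapply Rle_trans.
  - apply (Cmod_CSeries_le _ (fun k => K * (/ 2) ^ k + e / 2 * Re (ca q k * x ^ k))).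
    + intros k. rewrite Cmod_coef, Cmod_R, (Rabs_pos_eq x) by lra. rewrite ER.
      assert (Pa := ca_pos q k (proj1 Hq)).
      assert (Px : 0 <= x ^ k) by (apply pow_le; lra).
      assert (Px1 : x ^ k <= 1) by (rewrite <- (pow1 k); apply pow_incr; lra).
      assert (P2 : 0 < (/ 2) ^ k) by (apply pow_lt; lra).
      assert (P3 : 0 <= ca q k * x ^ k) by (apply Rmult_le_pos; lra).
      destruct (Nat.le_gt_cases N k) as [L|L].
      * specialize (HN k L). rewrite Rminus_0_r in HN.
        rewrite Hc, Rabs_mult, (Rabs_pos_eq (ca q k)) by lra.
        assert (0 <= K * (/ 2) ^ k) by (apply Rmult_le_pos; lra). nra.
      * specialize (HKb k L). rewrite Rabs_mult, (Rabs_pos_eq (2 ^ k)) in HKb by (apply pow_le; lra).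
        assert (E : (/ 2) ^ k * 2 ^ k = 1) by (rewrite <- Rpow_mult_distr, Rinv_l, pow1; lra).
        assert (Rabs (c k) <= K * (/ 2) ^ k).
        { replace (Rabs (c k)) with (Rabs (c k) * 2 ^ k * (/ 2) ^ k).
          - apply Rmult_le_compat_r; lra.
          - rewrite Rmult_assoc, (Rmult_comm (2 ^ k)), E. ring. }
        assert (Pc := Rabs_pos (c k)). nra.
    + now apply (@ex_series_plus R_AbsRing R_NormedModule).
  - rewrite Series_plus, !Series_scal_l by assumption.
    change (Re (PS (ca q) x)) with (Series (fun k => Re (ca q k * x ^ k))). right.
    change (Series (pow (/ 2))) with (Series (fun k => (/ 2) ^ k)). field.
Qed.

Lemma Phi_real (n : nat) (kap : R) : (2 <= n)%nat ->
  is_lim_seq (fun k => cL (qn n) k - 2 * harmonic k) kap ->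
  forall x, 0 < x < 1 -> J n (1 - x) = Phi n kap x /\ (- J_z n (1 - x))%C = Phiz n kap x.
Proof.
  intros Hn Hkap. assert (Hq := qn_bound n Hn). assert (Hok := ok_ca _ Hq).
  assert (HM := ok_cM n Hn kap).
  destruct (bo_Phi n kap Hn) as [BP BPz].
  set (y := fun x : R => (J n (1 - x) + - (1) * Phi n kap x)%C).
  set (z := fun x : R => (- J_z n (1 - x) + - (1) * Phiz n kap x)%C).
  destruct (wronskian_prop n y z (fun r => PS (ca (qn n)) r) (fun r => PSz (ca (qn n)) r)) as [al Hal].
  - intros x Hx.
    assert (N0 : RtoC x <> 0) by (apply RtoC_neq_0; lra).
    assert (N1 : (1 - x)%C <> 0) by (rewrite <- RtoC_minus; apply RtoC_neq_0; lra).
    apply (leg_lin n (- (1)) RtoC (fun _ => RtoC 1) (fun x => J n (1 - x)) (fun x => - J_z n (1 - x))%C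
      (fun x : R => Phi n kap x) (fun x : R => Phiz n kap x)).
    + apply (leg_J_reflected n RtoC (fun _ => RtoC 1)); trivial.
      * apply filter_forall. intros r. apply cderive_RtoC_id.
      * apply ccont_const.
      * right; simpl; lra.
    + apply (leg_Phi n Hn RtoC (fun _ => RtoC 1)); trivial.
      * rewrite Cmod_R, Rabs_pos_eq; lra.
      * apply cderive_RtoC_id.
      * right; simpl; lra.
  - now apply real_leg_P.
  - intros x Hx. apply P_neq_0; [exact Hq|lra].
  (* With [x = s^2]: [y] is [O(1/s)] against [PSz = O(s^2)], and [z] is [O(s)] against the bounded
     [P], because [- J_z] and [Phiz] both tend to [-1]. *)
  - intros e He. apply (bo_small (fun x => y x * PSz (ca (qn n)) x - PS (ca (qn n)) x * z x)%C); [|exact He].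
    apply (bo_plus _ (fun x => y x * PSz (ca (qn n)) x)%C (fun x : R => - (PS (ca (qn n)) x * z x))%C).
    + apply bo_le with (fun s => / s * (s * s)) (fun x => y x * PSz (ca (qn n)) x)%C; [|trivial|].
      * intros s Hs. right. field. lra.
      * apply (bo_mult _ _ y (fun x : R => PSz (ca (qn n)) x)); [|now apply bo_PSz].
        apply (bo_plus _ (fun x => J n (1 - x)) (fun x => - (1) * Phi n kap x)%C); [now apply bo_J|].
        apply bo_le with (fun s => 1 * / s) (fun x => - (1) * Phi n kap x)%C; [intros; lra|trivial|].
        apply (bo_mult _ _ (fun _ => - (1))%C (fun x => Phi n kap x)); [apply bo_const|exact BP].
    + apply (bo_opp _ (fun x : R => PS (ca (qn n)) x * z x)%C).
      apply bo_le with (fun s => 1 * s) (fun x : R => PS (ca (qn n)) x * z x)%C; [intros; lra|trivial|].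
      apply (bo_mult _ _ (fun x : R => PS (ca (qn n)) x) z); [now apply bo_PS|].
      apply bo_le with (fun s => s) (fun x => (- J_z n (1 - x) + 1) + - (Phiz n kap x + 1))%C.
      * intros; lra.
      * intros x _. unfold z. ring.
      * apply (bo_plus _ (fun x => - J_z n (1 - x) + 1)%C (fun x => - (Phiz n kap x + 1))%C);
          [now apply bo_Jz|]. now apply (bo_opp _ (fun x => Phiz n kap x + 1)%C).
  (* Near [1], [|al| P] is at most [|J n 0| + 1], plus [P |ln x| <= |al| P / 4], plus
     [K + |al| P / 4] for the series with coefficients [cM]. As [P] is unbounded, this forces
     [al = 0]. The hypothesis on [kap] is what makes the last series small against [P]. *)
  - assert (Hal0 : al = 0).
    { apply Cmod_eq_0. apply Rle_antisym; [|apply Cmod_ge_0]. apply Rnot_lt_le. intros L.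
      set (A := Cmod al) in *.
      destruct (PS_small_o (qn n) (cM n kap) (fun k => cL (qn n) k - 2 * harmonic k - kap) (A / 4) Hq
        ltac:(lra)) as [K [HK HKb]].
      { intros k. unfold cM, caL, caH. ring. }
      { replace (Finite 0) with (Rbar_minus kap kap) by (simpl; f_equal; ring).
        apply is_lim_seq_minus'; [exact Hkap|apply is_lim_seq_const]. }
      assert (HJ : locally 1 (fun r : R => Cmod (J n (1 - r) - J n (1 - 1)) < 1)).
      { apply (ccont_small (fun r : R => J n (1 - r)) 1 1); [|lra].
        assert (LL : locally 1 (fun r : R => cderive (fun r => 1 - r)%C r ((fun _ => - (1))%C r))).
        { apply filter_forall. intros r. eapply cderive_eq.
          - apply cderive_minus; [apply cderive_const|apply cderive_RtoC_id].
          - ring. }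
        destruct (cderive_J n (fun r : R => 1 - r)%C (fun _ => - (1))%C 1 LL (ccont_const _ _)) as [l Hl].
        { right; simpl; lra. }
        exact (cderive_ccont _ _ _ Hl). }
      assert (Hln : locally 1 (fun r : R => Rabs (ln r) < A / 4)).
      { assert (CL : continuous ln 1) by (apply continuous_of_derivable; auto_derive; lra).
        assert (CA : continuous (fun r => Rabs (ln r)) 1).
        { apply (continuous_comp ln Rabs); [exact CL|apply continuous_Rabs]. }
        apply (CA (fun y => y < A / 4)). rewrite ln_1, Rabs_R0. apply (open_lt (A / 4) 0). lra. }
      set (K' := Cmod (J n (1 - 1)) + 1 + K).
      destruct (Series_pow_unbounded (qn n) (4 * K' / A) Hq) as [d [Hd HP]].
      destruct (filter_and _ _ HJ Hln) as [d1 Hd1].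
      set (x := 1 - Rmin (d1 / 2) ((1 - d) / 2)).
      assert (C1 := cond_pos d1).
      assert (M0 : 0 < Rmin (d1 / 2) ((1 - d) / 2)) by (apply Rmin_pos; lra).
      assert (M1 := Rmin_l (d1 / 2) ((1 - d) / 2)). assert (M2 := Rmin_r (d1 / 2) ((1 - d) / 2)).
      assert (Hx : d < x < 1) by (unfold x; lra).
      assert (Hx0 : 0 < x < 1) by lra.
      destruct (Hd1 x) as [B1 B2].
      { change (Rabs (x - 1) < d1). unfold x. rewrite Rabs_left1; lra. }
      specialize (HP x Hx). specialize (HKb x Hx0).
      destruct (Hal x Hx0) as [E _]. cbv beta in E. unfold y, Phi in E.
      assert (Q1 := Re_P_ge_1 (qn n) x Hq ltac:(lra)).
      assert (EP : PS (ca (qn n)) x = Re (PS (ca (qn n)) x)).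
      { assert (Ht : Cmod x < 1) by (rewrite Cmod_R, Rabs_pos_eq; lra).
        apply C_eq; [reflexivity|]. simpl.
        rewrite (Series_ext _ (fun k => 0 * Re (ca (qn n) k * x ^ k))).
        - rewrite Series_scal_l. ring.
        - intros k. rewrite <- RtoC_pow, <- RtoC_mult. simpl. ring. }
      set (Pr := Re (PS (ca (qn n)) x)) in *.
      rewrite EP, Clog_RtoC in E by lra.
      assert (E' : (al * Pr)%C = ((J n (1 - x) - J n (1 - 1)) + J n (1 - 1) + (Pr * ln x + PS (cM n kap) x))%C).
      { rewrite <- E. ring. }
      assert (F : A * Pr <= 1 + Cmod (J n (1 - 1)) + (Pr * Rabs (ln x) + Cmod (PS (cM n kap) x))).
      { replace (A * Pr) with (Cmod (al * Pr)).
        2: { rewrite Cmod_mult, Cmod_R, Rabs_pos_eq by lra. reflexivity. }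
        rewrite E'. eapply Rle_trans; [apply Cmod_triangle|]. apply Rplus_le_compat.
        - eapply Rle_trans; [apply Cmod_triangle|]. lra.
        - eapply Rle_trans; [apply Cmod_triangle|]. rewrite Cmod_mult, !Cmod_R, (Rabs_pos_eq Pr) by lra. lra. }
      assert (G : 4 * K' <= A * Pr).
      { replace (4 * K') with (A * (4 * K' / A)) by (field; lra). apply Rmult_le_compat_l; lra. }
      assert (Pr * Rabs (ln x) <= Pr * (A / 4)) by (apply Rmult_le_compat_l; lra).
      assert (0 < A * Pr) by nra.
      unfold K' in G. lra. }
    intros x Hx. destruct (Hal x Hx) as [E1 E2]. cbv beta in E1, E2. rewrite Hal0 in E1, E2.
    unfold y in E1. unfold z in E2. split.
    + replace (J n (1 - x)) with (J n (1 - x) + - (1) * Phi n kap x + Phi n kap x)%C by ring.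
      rewrite E1. ring.
    + replace (- J_z n (1 - x))%C with (- J_z n (1 - x) + - (1) * Phiz n kap x + Phiz n kap x)%C by ring.
      rewrite E2. ring.
Qed.

Lemma slit_arc (r phi : R) : 0 < r -> - PI < phi < PI -> slit (r * Cexp (Ci * phi)).
Proof.
  intros Hr Hp. apply slit_scal; [exact Hr|].
  assert (E : (Ci * phi)%C = (0, phi)) by (apply C_eq; simpl; ring). rewrite E.
  unfold Cexp; simpl. rewrite exp_0. unfold slit; simpl.
  destruct (Req_dec (sin phi) 0) as [S|S]; [right|left; lra].
  assert (P := PI_RGT_0).
  destruct (Rtotal_order phi 0) as [L|[L|L]].
  - exfalso. assert (0 < sin (- phi)) by (apply sin_gt_0; lra). rewrite sin_neg in H. lra.
  - rewrite L, cos_0. lra.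
  - exfalso. assert (0 < sin phi) by (apply sin_gt_0; lra). lra.
Qed.

(** The second component is kept because both components serve as initial data on the rays near the
    cut. *)
Lemma Phi_eq (n : nat) (kap : R) (t : C) : (2 <= n)%nat ->
  is_lim_seq (fun k => cL (qn n) k - 2 * harmonic k) kap ->
  Cmod t < 1 -> slit t ->
  J n (1 - t) = Phi n kap t /\ (- J_z n (1 - t))%C = Phiz n kap t.
Proof.
  intros Hn Hkap Ht Hs. assert (Ht0 := slit_neq_0 t Hs).
  assert (Hp : 0 < Cmod t) by now apply Cmod_gt_0.
  set (y := fun t : C => (J n (1 - t) + - (1) * Phi n kap t)%C).
  set (z := fun t : C => (- J_z n (1 - t) + - (1) * Phiz n kap t)%C).
  assert (E : y t = 0 /\ z t = 0).
  { apply (disk_unique n y z slit); trivial.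
    - intros g g' x H1 H2 H3 H4 H5 H6.
      apply (leg_lin n (- (1)) g g' (fun r => J n (1 - g r)) (fun r => - J_z n (1 - g r))%C
        (fun r => Phi n kap (g r)) (fun r => Phiz n kap (g r))).
      + apply leg_J_reflected; trivial. now apply one_minus_neq_0.
      + now apply leg_Phi.
    - intros tau Htau. apply slit_arc; [exact Hp|].
      assert (B := Carg_slit_bound t Hs). assert (PI_RGT_0 := PI_RGT_0). nra.
    - intros x Hx. destruct (Phi_real n kap Hn Hkap x Hx) as [E1 E2].
      unfold y, z. rewrite E1, E2. split; ring. }
  destruct E as [E1 E2]. unfold y in E1. unfold z in E2. split.
  - replace (J n (1 - t)) with (J n (1 - t) + - (1) * Phi n kap t + Phi n kap t)%C by ring.
    rewrite E1. ring.
  - replace (- J_z n (1 - t))%C with (- J_z n (1 - t) + - (1) * Phiz n kap t + Phiz n kap t)%C by ring.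
    rewrite E2. ring.
Qed.

(** * Blocks of partial sums and convergence of complex series *)

Fixpoint csum (u : nat -> C) (n j : nat) : C :=
  match j with
  | O => u n
  | S j => (csum u n j + u (n + S j)%nat)%C
  end.

Lemma Re_csum (u : nat -> C) (n j : nat) : Re (csum u n j) = sum_n_m (fun k => Re (u k)) n (n + j).
Proof.
  induction j as [|j IH]; simpl csum.
  - now rewrite Nat.add_0_r, sum_n_n.
  - rewrite <- plus_n_Sm, sum_n_Sm by lia. rewrite <- IH. reflexivity.
Qed.

Lemma Im_csum (u : nat -> C) (n j : nat) : Im (csum u n j) = sum_n_m (fun k => Im (u k)) n (n + j).
Proof.
  induction j as [|j IH]; simpl csum.
  - now rewrite Nat.add_0_r, sum_n_n.
  - rewrite <- plus_n_Sm, sum_n_Sm by lia. rewrite <- IH. reflexivity.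
Qed.

Lemma cex_of_csum (u : nat -> C) (B : nat -> R) :
  (forall n j, Cmod (csum u n j) <= B n) -> is_lim_seq B 0 -> cex u.
Proof.
  intros H HB. apply is_lim_seq_spec in HB.
  assert (A : forall f : nat -> R, (forall n j, Rabs (sum_n_m f n (n + j)) <= B n) -> ex_series f).
  { intros f Hf. apply (@ex_series_Cauchy R_AbsRing R_CompleteNormedModule).
    intros e. destruct (HB e) as [N HN]. exists N. intros n m Hn Hm.
    specialize (HN n Hn). rewrite Rminus_0_r in HN.
    destruct (Nat.le_gt_cases n m) as [L|L].
    - replace m with (n + (m - n))%nat by lia.
      apply Rle_lt_trans with (1 := Hf n (m - n)%nat).
      apply Rle_lt_trans with (2 := HN), Rle_abs.
    - rewrite sum_n_m_zero by lia. rewrite norm_zero. apply cond_pos. }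
  split; apply A; intros n j.
  - rewrite <- Re_csum. apply Rle_trans with (2 := H n j), re_le_Cmod.
  - rewrite <- Im_csum. apply Rle_trans with (2 := H n j), im_le_Cmod.
Qed.

Lemma CSeries_tail (u : nat -> C) (N : nat) (B : R) : cex u ->
  (forall j, Cmod (csum u (S N) j) <= B) -> Cmod (CSeries u - csum u 0 N) <= 2 * B.
Proof.
  intros [H1 H2] HB.
  assert (A : forall f : nat -> R, ex_series f -> (forall j, Rabs (sum_n_m f (S N) (S N + j)) <= B) ->
     Rabs (Series f - sum_n_m f 0 N) <= B).
  { intros f Hf Hj. apply Series_correct in Hf.
    assert (L : is_lim_seq (fun j => Rabs (sum_n f (S N + j) - sum_n f N)) (Rabs (Series f - sum_n f N))).
    { apply (is_lim_seq_abs _ (Finite _)). apply is_lim_seq_minus'; [|apply is_lim_seq_const].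
      apply is_lim_seq_ext with (fun j => sum_n f (j + S N)); [intros j; f_equal; lia|].
      apply (is_lim_seq_incr_n (sum_n f)). exact Hf. }
    change (sum_n_m f 0 N) with (sum_n f N).
    apply (is_lim_seq_le _ (fun _ => B) (Finite _) (Finite B)) with (2 := L); [|apply is_lim_seq_const].
    intros j. apply Rle_trans with (2 := Hj j). right. f_equal.
    unfold sum_n. rewrite (sum_n_m_Chasles f 0 N (S N + j)) by lia.
    unfold plus; simpl. ring. }
  eapply Rle_trans; [apply Cmod_le_re_im|].
  assert (R1 : Rabs (Re (CSeries u - csum u 0 N)) <= B).
  { replace (Re (CSeries u - csum u 0 N)) with (Series (fun k => Re (u k)) - Re (csum u 0 N)) by reflexivity.
    rewrite Re_csum. apply (A (fun k => Re (u k)) H1). intros j. rewrite <- Re_csum.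
    apply Rle_trans with (2 := HB j), re_le_Cmod. }
  assert (R2 : Rabs (Im (CSeries u - csum u 0 N)) <= B).
  { replace (Im (CSeries u - csum u 0 N)) with (Series (fun k => Im (u k)) - Im (csum u 0 N)) by reflexivity.
    rewrite Im_csum. apply (A (fun k => Im (u k)) H2). intros j. rewrite <- Im_csum.
    apply Rle_trans with (2 := HB j), im_le_Cmod. }
  lra.
Qed.

Lemma is_series_CSeries (u : nat -> C) : cex u -> @is_series C_AbsRing C_NormedModule u (CSeries u).
Proof.
  intros [H1 H2]. apply Series_correct in H1. apply Series_correct in H2.
  change (is_lim_seq (sum_n (fun k => Re (u k))) (Series (fun k => Re (u k)))) in H1.
  change (is_lim_seq (sum_n (fun k => Im (u k))) (Series (fun k => Im (u k)))) in H2.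
  assert (E1 : forall N, Re (@sum_n C_NormedModule u N) = sum_n (fun k => Re (u k)) N).
  { intros N. induction N as [|N IH]; [now rewrite !sum_O|].
    rewrite !sum_Sn. rewrite <- IH. reflexivity. }
  assert (E2 : forall N, Im (@sum_n C_NormedModule u N) = sum_n (fun k => Im (u k)) N).
  { intros N. induction N as [|N IH]; [now rewrite !sum_O|].
    rewrite !sum_Sn. rewrite <- IH. reflexivity. }
  unfold is_series. apply (filterlim_Cmod eventually). intros e He.
  assert (L1 := proj2 (is_lim_seq_spec _ _) H1 (mkposreal (e / 2) ltac:(lra))).
  assert (L2 := proj2 (is_lim_seq_spec _ _) H2 (mkposreal (e / 2) ltac:(lra))).
  generalize (filter_and _ _ L1 L2). apply filter_imp. simpl. intros N [A B].
  rewrite <- E1 in A. rewrite <- E2 in B.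
  eapply Rle_lt_trans; [apply Cmod_le_re_im|].
  change (Rabs (Re (@sum_n C_NormedModule u N) - Series (fun k => Re (u k)))
    + Rabs (Im (@sum_n C_NormedModule u N) - Series (fun k => Im (u k))) < e). lra.
Qed.

(** * Dirichlet's test on the closed unit disk *)

Definition dirichlet_coef (c : nat -> R) : Prop :=
  (forall k, 0 <= c k) /\ (forall k, c (S k) <= c k) /\ is_lim_seq c 0.

Lemma one_minus_neq_0' (z : C) : z <> 1 -> 0 < Cmod (1 - z).
Proof.
  intros H. apply Cmod_gt_0. intros E. apply H.
  replace z with (1 - (1 - z))%C by ring. rewrite E. ring.
Qed.

Lemma dirichlet_csum (c : nat -> R) (z : C) (n j : nat) : dirichlet_coef c ->
  Cmod z <= 1 -> z <> 1 ->
  Cmod (csum (fun k => c k * z ^ k)%C n j) <= 2 * c n / Cmod (1 - z).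
Proof.
  intros (H0 & Hd & _) Hz Hz1. assert (P := one_minus_neq_0' z Hz1).
  assert (Hpow : forall k, Cmod (z ^ k) <= 1).
  { intros k. rewrite Cmod_pow, <- (pow1 k). apply pow_incr. split; [apply Cmod_ge_0|exact Hz]. }
  set (u := fun k => (c k * z ^ k)%C).
  (* Summation by parts: with this boundary term, one more summand changes the expression by exactly
     [(c (m+1) - c m) z^(m+1)]. Monotonicity makes these changes telescope in modulus, which
     explains the bound [2 c n - c (n + j)]. *)
  assert (A : Cmod ((1 - z) * csum u n j + c (n + j)%nat * z ^ S (n + j)) <= 2 * c n - c (n + j)%nat).
  { induction j as [|j IH].
    - simpl csum. rewrite Nat.add_0_r.
      replace ((1 - z) * u n + c n * z ^ S n)%C with (c n * z ^ n)%C.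
      2: { unfold u. rewrite Cpow_S. ring. }
      rewrite Cmod_mult, Cmod_R, Rabs_pos_eq by apply H0.
      specialize (Hpow n). specialize (H0 n). nra.
    - rewrite <- plus_n_Sm in *. simpl csum.
      rewrite <- plus_n_Sm. set (m := (n + j)%nat) in *.
      replace ((1 - z) * (csum u n j + u (S m)) + c (S m) * z ^ S (S m))%C
        with (((1 - z) * csum u n j + c m * z ^ S m) + (c (S m) - c m)%R * z ^ S m)%C.
      2: { unfold u. rewrite RtoC_minus, (Cpow_S z (S m)). ring. }
      eapply Rle_trans; [apply Cmod_triangle|].
      assert (Cmod ((c (S m) - c m)%R * z ^ S m) <= c m - c (S m)).
      { rewrite Cmod_mult, Cmod_R, Rabs_left1 by (specialize (Hd m); lra).
        specialize (Hpow (S m)). specialize (Hd m). nra. }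
      lra. }
  assert (B : Cmod ((1 - z) * csum u n j) <= 2 * c n).
  { replace ((1 - z) * csum u n j)%C with
      (((1 - z) * csum u n j + c (n + j)%nat * z ^ S (n + j)) + - (c (n + j)%nat * z ^ S (n + j)))%C by ring.
    eapply Rle_trans; [apply Cmod_triangle|]. rewrite Cmod_opp.
    assert (Cmod (c (n + j)%nat * z ^ S (n + j)) <= c (n + j)%nat).
    { rewrite Cmod_mult, Cmod_R, Rabs_pos_eq by apply H0.
      assert (X := Hpow (S (n + j))). assert (Y := H0 (n + j)%nat). nra. }
    lra. }
  rewrite Cmod_mult in B.
  apply Rmult_le_reg_r with (Cmod (1 - z)); [exact P|].
  unfold Rdiv. rewrite Rmult_assoc, Rinv_l, Rmult_1_r by lra. lra.
Qed.

Lemma dirichlet_cex (c : nat -> R) (z : C) : dirichlet_coef c ->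
  Cmod z <= 1 -> z <> 1 -> cex (fun k => c k * z ^ k)%C.
Proof.
  intros Hc Hz Hz1. apply cex_of_csum with (fun n => 2 / Cmod (1 - z) * c n).
  - intros n j. eapply Rle_trans; [now apply dirichlet_csum|]. right. unfold Rdiv. ring.
  - replace (Finite 0) with (Rbar_mult (2 / Cmod (1 - z)) 0) by (simpl; f_equal; ring).
    apply is_lim_seq_scal_l. apply Hc.
Qed.

Lemma csum_Lipschitz (c : nat -> R) (N : nat) : exists L, 0 <= L /\ forall z w : C,
  Cmod z <= 1 -> Cmod w <= 1 ->
  Cmod (csum (fun k => c k * w ^ k)%C 0 N - csum (fun k => c k * z ^ k)%C 0 N) <= L * Cmod (w - z).
Proof.
  induction N as [|N [L [HL H]]].
  - exists 0. split; [lra|]. intros z w Hz Hw. 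
    match goal with |- Cmod ?X <= _ => replace X with (RtoC 0) by (simpl; ring) end.
    rewrite Cmod_0. lra.
  - exists (L + Rabs (c (S N)) * INR (S N)). split.
    { assert (0 <= Rabs (c (S N)) * INR (S N)) by (apply Rmult_le_pos; [apply Rabs_pos|apply pos_INR]). lra. }
    intros z w Hz Hw.
    set (A := csum (fun k => c k * w ^ k)%C 0 N). set (B := csum (fun k => c k * z ^ k)%C 0 N).
    change (Cmod (A + c (S N) * w ^ S N - (B + c (S N) * z ^ S N))
      <= (L + Rabs (c (S N)) * INR (S N)) * Cmod (w - z)).
    replace (A + c (S N) * w ^ S N - (B + c (S N) * z ^ S N))%C
      with ((A - B) + c (S N) * (w ^ S N - z ^ S N))%C by ring.
    eapply Rle_trans; [apply Cmod_triangle|]. rewrite Rmult_plus_distr_r.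
    apply Rplus_le_compat; [now apply H|].
    rewrite Cmod_mult, Cmod_R, Rmult_assoc. apply Rmult_le_compat_l; [apply Rabs_pos|].
    assert (X := Cpow_Lipschitz z w 1 (S N) Rlt_0_1 Hz Hw). rewrite pow1 in X. lra.
Qed.

Lemma dirichlet_continuous (c : nat -> R) (z0 : C) : dirichlet_coef c ->
  Cmod z0 <= 1 -> z0 <> 1 -> forall e, 0 < e ->
  exists d, 0 < d /\ forall z, Cmod z <= 1 -> Cmod (z - z0) < d -> Cmod (PS c z - PS c z0) < e.
Proof.
  intros Hc Hz0 Hz1 e He. assert (P := one_minus_neq_0' z0 Hz1).
  set (h := Cmod (1 - z0)) in *.
  assert (Hlim := proj2 (is_lim_seq_spec _ _) (proj2 (proj2 Hc))).
  (* At distance at least [h / 2] from [1], a tail is at most [4 c (N+1) / (h / 2)], hence at most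
     [e / 5]. Two tails and a head of at most [e / 4] stay below [e]. *)
  assert (He' : 0 < e * h / 40) by nra.
  destruct (Hlim (mkposreal _ He')) as [N HN]. simpl in HN.
  specialize (HN (S N) ltac:(lia)). rewrite Rminus_0_r, Rabs_pos_eq in HN by apply Hc.
  destruct (csum_Lipschitz c N) as [L [HL HLip]].
  assert (Hq : 0 < e / (4 * (L + 1))) by (apply Rdiv_lt_0_compat; lra).
  exists (Rmin (h / 2) (e / (4 * (L + 1)))). split; [apply Rmin_pos; lra|].
  intros z Hz Hd.
  assert (D1 := Rlt_le_trans _ _ _ Hd (Rmin_l _ _)).
  assert (D2 := Rlt_le_trans _ _ _ Hd (Rmin_r _ _)).
  assert (T := Cmod_triangle (1 - z) (z - z0)).
  replace (1 - z + (z - z0))%C with (1 - z0)%C in T by ring. fold h in T.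
  assert (Hh : h / 2 <= Cmod (1 - z)) by lra.
  assert (Hzne : z <> 1).
  { intros ->. replace (1 - 1)%C with (RtoC 0) in Hh by ring. rewrite Cmod_0 in Hh. lra. }
  assert (Tail : forall w, Cmod w <= 1 -> w <> 1 -> h / 2 <= Cmod (1 - w) ->
    Cmod (PS c w - csum (fun k => c k * w ^ k)%C 0 N) <= e / 5).
  { intros w Hw Hw1 Hwh. apply Rle_trans with (2 * (2 * c (S N) / Cmod (1 - w))).
    - apply CSeries_tail; [now apply dirichlet_cex|]. intros j. now apply dirichlet_csum.
    - apply Rmult_le_reg_r with (Cmod (1 - w)); [lra|].
      replace (2 * (2 * c (S N) / Cmod (1 - w)) * Cmod (1 - w)) with (4 * c (S N)) by (field; lra). nra. }
  assert (T1 := Tail z Hz Hzne Hh). assert (T2 := Tail z0 Hz0 Hz1 ltac:(unfold h in *; lra)).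
  set (A := csum _ 0 N) in T1. set (B := csum _ 0 N) in T2.
  assert (T3 : Cmod (A - B) <= L * Cmod (z - z0)) by now apply HLip.
  assert (T4 : L * Cmod (z - z0) <= e / 4).
  { apply Rle_trans with (L * (e / (4 * (L + 1)))); [apply Rmult_le_compat_l; lra|].
    apply Rmult_le_reg_r with (4 * (L + 1)); [lra|].
    replace (L * (e / (4 * (L + 1))) * (4 * (L + 1))) with (L * e) by (field; lra).
    replace (e / 4 * (4 * (L + 1))) with (e * (L + 1)) by field. nra. }
  replace (PS c z - PS c z0)%C with ((PS c z - A) + ((A - B) + - (PS c z0 - B)))%C by ring.
  eapply Rle_lt_trans; [apply Cmod_triangle|].
  assert (T5 := Cmod_triangle (A - B) (- (PS c z0 - B))). rewrite Cmod_opp in T5. lra.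
Qed.

Lemma dirichlet_boundary (c : nat -> R) (t : C) (G : C -> C) : dirichlet_coef c ->
  Cmod t <= 1 -> t <> 1 ->
  (forall rho, 0 < rho < 1 -> PS c (rho * t) = G (rho * t)%C) ->
  ccont (fun rho : R => G (rho * t)%C) 1 ->
  PS c t = G t.
Proof.
  intros Hc Ht Ht1 HG HC.
  assert (D : (PS c t - G t)%C = 0).
  { apply Cmod_eq_0. apply Rle_antisym; [|apply Cmod_ge_0]. apply Rnot_lt_le. intros L.
    set (e := Cmod (PS c t - G t)) in *.
    destruct (dirichlet_continuous c t Hc Ht Ht1 (e / 2) ltac:(lra)) as [d [Hd HP]].
    destruct (ccont_small _ _ (e / 2) HC ltac:(lra)) as [d' Hd'].
    assert (C1 := cond_pos d').
    set (rho := 1 - Rmin (/ 2) (Rmin (d / 2) (d' / 2))).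
    assert (M0 : 0 < Rmin (/ 2) (Rmin (d / 2) (d' / 2))) by (repeat apply Rmin_pos; lra).
    assert (M1 := Rmin_l (/ 2) (Rmin (d / 2) (d' / 2))).
    assert (M2 := Rmin_r (/ 2) (Rmin (d / 2) (d' / 2))).
    assert (M3 := Rmin_l (d / 2) (d' / 2)). assert (M4 := Rmin_r (d / 2) (d' / 2)).
    assert (Hrho : 0 < rho < 1) by (unfold rho; lra).
    assert (P1 : Cmod (PS c (rho * t) - PS c t) < e / 2).
    { assert (Hct := Cmod_ge_0 t). apply HP.
      - rewrite Cmod_mult, Cmod_R, Rabs_pos_eq by lra. nra.
      - replace (rho * t - t)%C with ((rho - 1)%R * t)%C by (rewrite RtoC_minus; ring).
        rewrite Cmod_mult, Cmod_R, Rabs_left1 by lra. unfold rho in *. nra. }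
    assert (P2 : Cmod (G (rho * t)%C - G (1 * t)%C) < e / 2).
    { apply Hd'. change (Rabs (rho - 1) < d'). unfold rho. rewrite Rabs_left1; lra. }
    replace (1 * t)%C with t in P2 by ring. rewrite HG in P1 by exact Hrho.
    set (Gr := G (rho * t)%C) in *.
    assert (T := Cmod_triangle (- (Gr - PS c t))%C (Gr - G t)%C).
    rewrite Cmod_opp in T.
    replace (- (Gr - PS c t) + (Gr - G t))%C with (PS c t - G t)%C in T by ring.
    fold e in T. lra. }
  replace (PS c t) with (PS c t - G t + G t)%C by ring. rewrite D. ring.
Qed.

(** Dropping the zero coefficient at index [0] makes [caL] and [caH] decreasing, as Dirichlet's test
    requires; multiplication by [t] restores the series. *)
Definition sh (c : nat -> R) (k : nat) : R := c (S k).

Lemma PS_sh (c : nat -> R) (t : C) : ok c -> c 0%nat = 0 -> Cmod t < 1 ->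
  PS c t = (t * PS (sh c) t)%C.
Proof. intros Hc H0 Ht. rewrite PS_shift, H0 by assumption. unfold sh. ring. Qed.

Lemma is_sum_from1_PS (c : nat -> R) (t : C) : dirichlet_coef (sh c) ->
  Cmod t <= 1 -> t <> 1 -> is_sum_from1 (fun k => c k * t ^ k)%C (t * PS (sh c) t)%C.
Proof.
  intros Hc Ht Ht1. assert (Hx := dirichlet_cex _ t Hc Ht Ht1).
  unfold is_sum_from1, PS. rewrite <- CSeries_scal by exact Hx.
  apply (@is_series_ext C_AbsRing C_NormedModule (fun k => t * (sh c k * t ^ k))%C).
  - intros k. unfold sh. rewrite Cpow_S. 
    change (t * (c (S k) * t ^ k) = c (S k) * (t * t ^ k))%C. ring.
  - apply is_series_CSeries. now apply cex_scal.
Qed.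

Lemma dirichlet_caL (q : R) : 0 < q <= / 4 -> dirichlet_coef (sh (caL q)).
Proof.
  intros Hq. unfold sh. split; [|split].
  - intros k. now apply caL_nonneg.
  - intros k. now apply caL_decr.
  - now apply caL_lim.
Qed.

Lemma dirichlet_caH (q : R) : 0 < q <= / 4 -> dirichlet_coef (sh (caH q)).
Proof.
  intros Hq. unfold sh. split; [|split].
  - intros k. now apply caH_nonneg.
  - intros k. now apply caH_decr.
  - now apply caH_lim.
Qed.

(** * Closed forms on the closed disk *)

Lemma ccont_J_curve (n : nat) (g g' : R -> C) (x : R) :
  locally x (fun r => cderive g r (g' r)) -> ccont g' x -> slit (1 - g x) ->
  ccont (fun r => J n (g r)) x.
Proof.
  intros H1 H2 H3. destruct (cderive_J n g g' x H1 H2 H3) as [l Hl].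
  exact (cderive_ccont _ _ _ Hl).
Qed.

Lemma cderive_ray (t : C) (r : R) : cderive (fun rho : R => rho * t)%C r t.
Proof.
  eapply cderive_eq; [apply cderive_mult; [apply cderive_RtoC_id|apply cderive_const]|]. cbv beta. ring.
Qed.

Lemma ccont_J_ray (n : nat) (t : C) : slit (1 - t) -> ccont (fun rho : R => J n (rho * t)) 1.
Proof.
  intros Hs. apply (ccont_J_curve n (fun rho : R => rho * t)%C (fun _ => t)).
  - apply filter_forall. intros r. apply cderive_ray.
  - apply ccont_const.
  - replace (1 * t)%C with t by ring. exact Hs.
Qed.

Lemma ccont_J_ray' (n : nat) (t : C) : slit t -> ccont (fun rho : R => J n (1 - rho * t)) 1.
Proof.
  intros Hs. apply (ccont_J_curve n (fun rho : R => 1 - rho * t)%C (fun _ => - t)%C).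
  - apply filter_forall. intros r. eapply cderive_eq.
    + apply cderive_minus; [apply cderive_const|apply cderive_ray].
    + ring.
  - apply ccont_const.
  - replace (1 - (1 - 1 * t))%C with t by ring. exact Hs.
Qed.

Lemma Cmod_ray (rho : R) (t : C) : 0 < rho < 1 -> Cmod t <= 1 -> Cmod (rho * t) < 1.
Proof.
  intros Hr Ht. rewrite Cmod_mult, Cmod_R, Rabs_pos_eq by lra. assert (H := Cmod_ge_0 t). nra.
Qed.

Lemma main_SL (n : nat) (t : C) : (2 <= n)%nat -> J n 0 <> 0 -> Cmod t <= 1 -> t <> 1 ->
  is_sum_from1 (fun k => caL (qn n) k * t ^ k)%C (- (J n t / J n 0) * Clog (1 - t))%C.
Proof.
  intros Hn HB Ht Ht1. assert (Hq := qn_bound n Hn).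
  assert (Hd := dirichlet_caL _ Hq).
  assert (H := is_sum_from1_PS (caL (qn n)) t Hd Ht Ht1).
  (* The shifted series equals the closed form divided by [t], so [t = 0] is treated apart. *)
  destruct (Ceq_dec t 0) as [E|Ht0].
  { rewrite E in *. replace (Clog (1 - 0)) with (RtoC 0).
    - replace (- (J n 0 / J n 0) * 0)%C with (0 * PS (sh (caL (qn n))) 0)%C by ring. exact H.
    - replace (1 - 0)%C with (RtoC 1) by ring. rewrite Clog_RtoC by lra. now rewrite ln_1. }
  assert (Hs := slit_one_minus t Ht Ht1).
  rewrite (dirichlet_boundary _ t (fun t => - (J n t / J n 0) * Clog (1 - t) / t)%C Hd Ht Ht1) in H.
  - replace (t * (- (J n t / J n 0) * Clog (1 - t) / t))%C
      with (- (J n t / J n 0) * Clog (1 - t))%C in H by (field; split; assumption).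
    exact H.
  - intros rho Hr. assert (Hrt := Cmod_ray rho t Hr Ht).
    assert (Hr0 : RtoC rho <> 0) by (apply RtoC_neq_0; lra).
    assert (E := SL_eq n (rho * t) Hn Hrt). rewrite (J_eq n _ Hn Hrt).
    rewrite PS_sh in E; [|now apply ok_caL|unfold caL; simpl; ring|exact Hrt].
    apply (f_equal (fun z => z / (rho * t))%C) in E.
    transitivity (rho * t * PS (sh (caL (qn n))) (rho * t) / (rho * t))%C.
    + field. split; assumption.
    + rewrite E. field. repeat split; assumption.
  - cbv beta. ccont_tac; replace (1 * t)%C with t by ring; trivial.
  exact (ccont_J_ray n t Hs).
Qed.

(** The result of solving [J n (1 - t) = Phi n kap t] for the sum of the [- a_k H_k t^k], after
    [SL_eq] has replaced the sum of the [a_k L_k t^k] and [J_eq] has replaced [P] by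
    [J n t / J n 0]. *)
Definition SLt_closed (n : nat) (kap : R) (t : C) : C :=
  ((J n t / J n 0 * (kap + Clog (1 - t) - Clog t) - J n (1 - t)) / 2)%C.

Lemma SLt_PS (n : nat) (kap : R) (t : C) : (2 <= n)%nat -> J n 0 <> 0 ->
  is_lim_seq (fun k => cL (qn n) k - 2 * harmonic k) kap ->
  Cmod t <= 1 -> slit t -> t <> 1 ->
  (- (t * PS (sh (caH (qn n))) t))%C = SLt_closed n kap t.
Proof.
  intros Hn HB Hk Ht Hst Ht1. assert (Hq := qn_bound n Hn).
  assert (Hd := dirichlet_caH _ Hq). assert (Ht0 := slit_neq_0 t Hst).
  assert (Hs := slit_one_minus t Ht Ht1).
  rewrite (dirichlet_boundary _ t (fun t => - SLt_closed n kap t / t)%C Hd Ht Ht1).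
  - field. exact Ht0.
  - intros rho Hr. assert (Hrt := Cmod_ray rho t Hr Ht).
    assert (Hr0 : RtoC rho <> 0) by (apply RtoC_neq_0; lra).
    assert (Hrs : slit (rho * t)) by (apply slit_scal; [lra|exact Hst]).
    destruct (Phi_eq n kap (rho * t) Hn Hk Hrt Hrs) as [E _].
    assert (E2 := SL_eq n (rho * t) Hn Hrt).
    assert (OL := ok_caL _ Hq). assert (OH := ok_caH _ Hq). assert (OA := ok_ca _ Hq).
    unfold Phi in E.
    rewrite (PS_lin4 (cM n kap) (caL (qn n)) (caH (qn n)) (ca (qn n)) (ca (qn n)) 1 (-2) (- kap) 0) in E;
      trivial.
    2: { intros k. unfold cM. ring. }
    rewrite E2, (PS_sh (caH (qn n))) in E; [|exact OH|unfold caH; rewrite harmonic_0; ring|exact Hrt].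
    unfold SLt_closed. rewrite E, (J_eq n _ Hn Hrt), RtoC_opp.
    assert (H2 : RtoC 2 <> 0) by (apply RtoC_neq_0; lra).
    replace (RtoC (-2)) with (- RtoC 2)%C by (rewrite <- RtoC_opp; f_equal; ring).
    field. repeat split; assumption.
  - unfold SLt_closed. ccont_tac; try (replace (1 * t)%C with t by ring); trivial.
    + apply RtoC_neq_0; lra.
    + exact (ccont_J_ray n t Hs).
    + exact (ccont_J_ray' n t Hst).
Qed.

(** * Limits on the cut *)

Lemma PS_bounded (c : nat -> R) (rho : R) : ok c -> 0 < rho < 1 ->
  exists K, 0 <= K /\ forall z : C, Cmod z <= rho -> Cmod (PS c z) <= K.
Proof.
  intros Hc Hr. destruct (PS_Lipschitz c rho Hc Hr) as [B [HB0 HB]].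
  exists (B * rho + Rabs (c 0%nat)). split.
  { assert (P := Rabs_pos (c 0%nat)). assert (0 <= B * rho) by (apply Rmult_le_pos; lra). lra. }
  intros z Hz. replace (PS c z) with (PS c z - PS c 0 + c 0%nat)%C by (rewrite PS_0 by exact Hc; ring).
  eapply Rle_trans; [apply Cmod_triangle|]. rewrite Cmod_R. apply Rplus_le_compat_r.
  eapply Rle_trans.
  - apply HB; [rewrite Cmod_0; lra|exact Hz].
  - replace (z - 0)%C with z by ring. now apply Rmult_le_compat_l.
Qed.

Lemma Cmod_Clog_le (m : R) (z : C) : 0 < m -> slit z -> m <= Cmod z <= 1 ->
  Cmod (Clog z) <= - ln m + PI.
Proof.
  intros Hm Hs Hz. eapply Rle_trans; [apply Cmod_le_re_im|]. simpl.
  assert (B := Carg_slit_bound z Hs).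
  assert (L1 : ln m <= ln (Cmod z)).
  { destruct (proj1 Hz) as [H|H]; [left; now apply ln_increasing|rewrite H; lra]. }
  assert (L2 : ln (Cmod z) <= 0) by (apply ln_nonpos; lra).
  apply Rplus_le_compat; [rewrite Rabs_left1; lra|].
  apply Rabs_le. lra.
Qed.

(** Bounds, uniform up to the cut, for the initial data at the midpoint of a ray: [3/4] is half of
    the bound [3/2] for [|t|], and [m] keeps away from the logarithmic singularity. *)
Lemma Phi_bounded (n : nat) (kap m : R) : (2 <= n)%nat -> 0 < m ->
  exists K, 0 <= K /\ forall z, slit z -> m <= Cmod z <= 3 / 4 ->
    Cmod (Phi n kap z) <= K /\ Cmod (Phiz n kap z) <= K.
Proof.
  intros Hn Hm. assert (Hq := qn_bound n Hn). assert (Hok := ok_ca _ Hq).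
  assert (HM := ok_cM n Hn kap).
  destruct (PS_bounded _ (3 / 4) Hok ltac:(lra)) as [K1 [P1 B1]].
  destruct (PS_bounded _ (3 / 4) (ok_th _ Hok) ltac:(lra)) as [K2 [P2 B2]].
  destruct (PS_bounded _ (3 / 4) HM ltac:(lra)) as [K3 [P3 B3]].
  destruct (PS_bounded _ (3 / 4) (ok_th _ HM) ltac:(lra)) as [K4 [P4 B4]].
  set (l := Rmax 0 (- ln m + PI)). assert (Hl0 : 0 <= l) by apply Rmax_l.
  exists (K1 * l + K3 + (2 * K2 * l + 2 * K1 + 2 * K4)). split.
  { assert (0 <= K1 * l) by now apply Rmult_le_pos. assert (0 <= K2 * l) by now apply Rmult_le_pos. lra. }
  intros z Hs Hz.
  assert (HL : Cmod (Clog z) <= l).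
  { apply Rle_trans with (- ln m + PI); [|apply Rmax_r]. apply Cmod_Clog_le; trivial. lra. }
  specialize (B1 z (proj2 Hz)). specialize (B2 z (proj2 Hz)).
  specialize (B3 z (proj2 Hz)). specialize (B4 z (proj2 Hz)).
  assert (H1z : Cmod (1 - z) <= 2).
  { assert (T := Cmod_triangle 1 (- z)). rewrite Cmod_opp, Cmod_1 in T. unfold Cminus. lra. }
  assert (0 <= K1 * l) by now apply Rmult_le_pos. assert (0 <= K2 * l) by now apply Rmult_le_pos.
  assert (M : forall a b A B, Cmod a <= A -> Cmod b <= B -> Cmod (a * b) <= A * B).
  { intros a b A B Ha Hb. rewrite Cmod_mult. apply Rmult_le_compat; trivial; apply Cmod_ge_0. }
  split.
  - unfold Phi. eapply Rle_trans; [apply Cmod_triangle|]. rewrite !Cmod_opp.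
    assert (X := M _ _ _ _ B1 HL). lra.
  - unfold Phiz, PSz. eapply Rle_trans; [apply Cmod_triangle|]. rewrite !Cmod_opp.
    assert (T := Cmod_triangle ((1 - z) * PS (th (ca (qn n))) z * Clog z) ((1 - z) * PS (ca (qn n)) z)).
    assert (X1 := M _ _ _ _ (M _ _ _ _ H1z B2) HL). assert (X2 := M _ _ _ _ H1z B1).
    assert (X3 := M _ _ _ _ H1z B4). lra.
Qed.

Lemma cderive_increment_le (f f' : R -> C) (a b K : R) : a <= b ->
  (forall x, a <= x <= b -> cderive f x (f' x) /\ Cmod (f' x) <= K) ->
  Cmod (f b - f a) <= 2 * (K * (b - a)).
Proof.
  intros Hab H.
  assert (A : forall g g' : R -> R, (forall x, a <= x <= b -> is_derive g x (g' x) /\ Rabs (g' x) <= K) ->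
    Rabs (g b - g a) <= K * (b - a)).
  { intros g g' Hg. destruct (MVT_gen g a b g') as [c [Hc Ec]].
    - rewrite Rmin_left, Rmax_right by exact Hab. intros x Hx. apply Hg. lra.
    - rewrite Rmin_left, Rmax_right by exact Hab. intros x Hx.
      apply continuity_pt_filterlim. apply continuous_of_derivable. exists (g' x). now apply Hg.
    - rewrite Rmin_left, Rmax_right in Hc by exact Hab.
      rewrite Ec, Rabs_mult, (Rabs_pos_eq (b - a)) by lra.
      apply Rmult_le_compat_r; [lra|]. now apply Hg. }
  eapply Rle_trans; [apply Cmod_le_re_im|].
  assert (A1 := A (fun x => Re (f x)) (fun x => Re (f' x))).
  assert (A2 := A (fun x => Im (f x)) (fun x => Im (f' x))).
  assert (R1 : Rabs (Re (f b) - Re (f a)) <= K * (b - a)).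
  { apply A1. intros x Hx. destruct (H x Hx) as [[D1 D2] HK]. split; [exact D1|].
    apply Rle_trans with (2 := HK), re_le_Cmod. }
  assert (R2 : Rabs (Im (f b) - Im (f a)) <= K * (b - a)).
  { apply A2. intros x Hx. destruct (H x Hx) as [[D1 D2] HK]. split; [exact D2|].
    apply Rle_trans with (2 := HK), im_le_Cmod. }
  change (Rabs (Re (f b) - Re (f a)) + Rabs (Im (f b) - Im (f a)) <= 2 * (K * (b - a))). lra.
Qed.

(* The system along the ray through [t] is regular up to [rho = 1] with bounds that do not
   depend on [Im t], and its data at [rho = 1/2] are given by [Phi_eq]. *)
Lemma J_ray_Lipschitz (n : nat) (kap x : R) : (2 <= n)%nat ->
  is_lim_seq (fun k => cL (qn n) k - 2 * harmonic k) kap -> -1 <= x < 0 ->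
  exists L, 0 <= L /\ forall w rho, w <> 0 -> -1 <= w <= 1 -> / 2 <= rho <= 1 ->
    Cmod (J n (1 - (x, w)) - J n (1 - rho * (x, w))) <= L * (1 - rho).
Proof.
  intros Hn Hk Hx. assert (Hq := qn_bound n Hn).
  destruct (Phi_bounded n kap (- x / 2) Hn ltac:(lra)) as [K [HK HKb]].
  (* The energy at [rho = 1/2] is at most [2 K^2]; Gronwall's inequality with constant [2] over a
     length of at most [1/2] multiplies it by at most [exp 2]; finally [|z| <= 1 + |z|^2]. *)
  set (Z := 1 + 2 * (K * K) * exp 2).
  assert (He2 := exp_pos 2).
  assert (HZ : 0 <= Z).
  { unfold Z. assert (0 <= K * K * exp 2) by (apply Rmult_le_pos; nra). lra. }
  exists (4 * Z). split; [lra|].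
  intros w rho Hw Hw1 Hrho. set (t := (x, w) : C).
  assert (Hsl : forall r : R, 0 < r -> slit (r * t)).
  { intros r Hr. left. simpl. intros E. apply Hw.
    destruct (Rmult_integral r w); [lra|lra|assumption]. }
  assert (Hsq : Cmod t * Cmod t = x * x + w * w) by apply Cmod_sqr.
  assert (Ht0 := Cmod_ge_0 t).
  assert (Ht2 : Cmod t <= 3 / 2) by nra.
  assert (Htx : - x <= Cmod t) by nra.
  (* The real part of [t] is negative, so the ray stays at distance at least [1] from the singular
     point [1], whatever the imaginary part. *)
  assert (H1t : forall r : R, 0 < r -> 1 <= Cmod (1 - r * t)).
  { intros r Hr. apply Rle_trans with (2 := re_le_Cmod _). simpl.
    apply Rle_trans with (2 := Rle_abs _). nra. }
  clearbody t.
  set (g := fun r : R => (r * t)%C).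
  set (y := fun r : R => J n (1 - g r)). set (z := fun r : R => (- J_z n (1 - g r))%C).
  set (A := fun r : R => (/ (r * (1 - r * t)))%C). set (D := fun _ : R => (qn n * t)%C).
  assert (HA : forall r, / 2 <= r <= 1 -> Cmod (A r) <= 2).
  { intros r Hr. unfold A. assert (H := H1t r ltac:(lra)).
    rewrite Cmod_inv.
    - rewrite Cmod_mult, Cmod_R, Rabs_pos_eq by lra.
      rewrite <- (Rinv_inv 2). apply Rinv_le_contravar; [lra|nra].
    - apply Cmod_gt_0. rewrite Cmod_mult, Cmod_R, Rabs_pos_eq by lra. nra. }
  assert (HD : Cmod (qn n * t) <= 2).
  { rewrite Cmod_mult, Cmod_R, Rabs_pos_eq by lra. nra. }
  assert (Hsys : forall r, / 2 <= r <= 1 ->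
     cderive y r (A r * z r)%C /\ cderive z r (D r * y r)%C).
  { intros r Hr. assert (H := H1t r ltac:(lra)).
    assert (Hne : (1 - r * t)%C <> 0) by (apply Cmod_gt_0; lra).
    assert (Hrt := slit_neq_0 _ (Hsl r ltac:(lra))).
    destruct (leg_J_reflected n g (fun _ => t) r Hn) as [D1 D2].
    - apply filter_forall. intros s. apply cderive_ray.
    - apply ccont_const.
    - apply Hsl. lra.
    - exact Hne.
    - assert (Hr0 : RtoC r <> 0) by (apply RtoC_neq_0; lra).
      assert (Ht00 : t <> 0) by (intros E; apply Hrt; rewrite E; ring).
      split.
      + eapply cderive_eq; [exact D1|]. unfold A, z, g. cbv beta. field. repeat split; assumption.
      + eapply cderive_eq; [exact D2|]. unfold D, y, qn. cbv beta. ring. }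
  assert (Hz : forall r, / 2 <= r <= 1 -> Cmod (z r) <= Z).
  { intros r Hr.
    assert (G : energy (y r) (z r) <= energy (y (/ 2)) (z (/ 2)) * exp (2 * 2 * (r - / 2))).
    { apply (gronwall y z A D (/ 2) r 2); [lra|lra|].
      intros s Hs. destruct (Hsys s ltac:(lra)) as [S1 S2].
      split; [exact S1|]. split; [exact S2|]. split; [apply HA; lra|exact HD]. }
    assert (Hs2 := Hsl (/ 2) ltac:(lra)).
    assert (Hm2 : Cmod ((/ 2)%R * t) = Cmod t / 2).
    { rewrite Cmod_mult, Cmod_R, Rabs_pos_eq by lra. field. }
    destruct (Phi_eq n kap ((/ 2)%R * t) Hn Hk ltac:(lra) Hs2) as [E1 E2].
    destruct (HKb ((/ 2)%R * t)%C Hs2 ltac:(lra)) as [K1 K2].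
    assert (Eh : energy (y (/ 2)) (z (/ 2)) <= 2 * (K * K)).
    { unfold y, z, g. rewrite E1, E2. unfold energy.
      assert (P1 := Cmod_ge_0 (Phi n kap ((/ 2)%R * t))).
      assert (P2 := Cmod_ge_0 (Phiz n kap ((/ 2)%R * t))). nra. }
    assert (Ee : exp (2 * 2 * (r - / 2)) <= exp 2) by (apply exp_le; lra).
    assert (F : energy (y r) (z r) <= 2 * (K * K) * exp 2).
    { apply Rle_trans with (1 := G). apply Rmult_le_compat; trivial.
      - unfold energy. assert (P := Rle_0_sqr (Cmod (y (/ 2)))).
        assert (P' := Rle_0_sqr (Cmod (z (/ 2)))). unfold Rsqr in *. lra.
      - left; apply exp_pos. }
    unfold energy in F. assert (P := Rle_0_sqr (Cmod (y r))). unfold Rsqr in P.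
    assert (P' := Rle_0_sqr (Cmod (z r) - 1)). unfold Rsqr in P'.
    assert (P'' := Rle_0_sqr (Cmod (z r))). unfold Rsqr in P''. unfold Z. nra. }
  assert (I := cderive_increment_le y (fun r => A r * z r)%C rho 1 (2 * Z) ltac:(lra)).
  replace (J n (1 - t)) with (y 1).
  2: { unfold y, g. replace (1 * t)%C with t by ring. reflexivity. }
  change (J n (1 - rho * t)) with (y rho).
  eapply Rle_trans; [apply I|].
  - intros r Hr. split; [apply Hsys; lra|]. rewrite Cmod_mult.
    apply Rmult_le_compat; try apply Cmod_ge_0; [apply HA; lra|apply Hz; lra].
  - right. ring.
Qed.

(** Near the cut the logarithm is expressed by [Clog (- t)], which is continuous there; the sign
    [sg] of the half plane carries the jump. *)
Lemma Clog_opp (t : C) (sg : R) : Re t < 0 -> (sg = 1 \/ sg = -1) -> 0 < sg * Im t ->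
  Clog t = (Clog (- t) + Ci * (sg * PI)%R)%C.
Proof.
  intros Hr Hsg Hi. assert (P := PI_RGT_0).
  assert (Hs : slit (- t)) by (right; simpl; unfold Re in Hr; lra).
  assert (Hn : t <> 0) by (intros ->; simpl in Hr; lra).
  assert (Hb := Carg_slit_bound _ Hs). assert (Hsgn := Carg_sign _ Hs).
  apply Clog_unique.
  - rewrite Cexp_plus, Cexp_Clog by now apply slit_neq_0.
    replace (Cexp (Ci * (sg * PI)%R)) with ((- (1))%C).
    + ring.
    + replace (Ci * (sg * PI)%R)%C with ((0, sg * PI) : C) by (apply C_eq; simpl; ring).
      unfold Cexp. simpl. rewrite exp_0.
      destruct Hsg as [-> | ->].
      * replace (1 * PI) with PI by ring. rewrite cos_PI, sin_PI. apply C_eq; simpl; ring.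
      * replace (-1 * PI) with (- PI) by ring. rewrite cos_neg, sin_neg, cos_PI, sin_PI.
        apply C_eq; simpl; ring.
  - replace (Im (Clog (- t) + Ci * (sg * PI)%R)) with (Carg (- t) + sg * PI) by (simpl; ring).
    assert (EI : Im (- t) = - Im t) by (simpl; unfold Im; ring). rewrite EI in Hsgn.
    destruct Hsg as [-> | ->].
    + assert (Carg (- t) < 0) by (apply Hsgn; lra). lra.
    + assert (0 < Carg (- t)) by (apply Hsgn; lra). lra.
Qed.

Definition cut_pt (x sg e : R) : C := (x, sg * e).

Lemma cderive_cut_pt (x sg e : R) : cderive (cut_pt x sg) e (0, sg).
Proof.
  split; simpl.
  - apply @is_derive_const.
  - apply is_derive_ext with (fun e => sg * e); [reflexivity|]. auto_derive; [trivial|]. simpl. ring.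
Qed.

(* [N] is the part of [SLt_closed] that extends continuously to the cut from the side [sg]. *)
Definition cut_N (n : nat) (kap sg : R) (t : C) : C :=
  (J n t / J n 0 * (kap + Clog (1 - t) - (Clog (- t) + Ci * (sg * PI)%R)))%C.

Lemma ccont_cut_N (n : nat) (kap sg : R) (h h' : R -> C) :
  locally 0 (fun r => cderive h r (h' r)) -> ccont h' 0 -> Re (h 0) < 0 ->
  ccont (fun e => cut_N n kap sg (h e)) 0.
Proof.
  intros H1 H2 H3. assert (Hc := cderive_ccont _ _ _ (locally_singleton _ _ H1)).
  assert (S1 : slit (1 - h 0)) by (right; simpl; unfold Re in H3; lra).
  assert (S2 : slit (- h 0)) by (right; simpl; unfold Re in H3; lra).
  unfold cut_N, Cdiv. ccont_tac; trivial. now apply (ccont_J_curve n h h').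
Qed.

Lemma SLt_closed_cut_N (n : nat) (kap sg : R) (t : C) :
  Re t < 0 -> (sg = 1 \/ sg = -1) -> 0 < sg * Im t ->
  SLt_closed n kap t = ((cut_N n kap sg t - J n (1 - t)) / 2)%C.
Proof.
  intros H1 H2 H3. unfold SLt_closed, cut_N. now rewrite (Clog_opp t sg H1 H2 H3).
Qed.

Lemma Cmod_mult_diff_le (a b c d : C) : Cmod a <= 1 ->
  Cmod (a * c - b * d) <= Cmod (c - d) + Cmod (a - b) * Cmod d.
Proof.
  intros Ha. replace (a * c - b * d)%C with (a * (c - d) + (a - b) * d)%C by ring.
  eapply Rle_trans; [apply Cmod_triangle|]. rewrite !Cmod_mult.
  assert (P := Cmod_ge_0 (c - d)). nra.
Qed.

Lemma locally_at_right (P : R -> Prop) : locally 0 P -> at_right 0 P.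
Proof. intros [d H]. exists d. intros y Hy _. now apply H. Qed.

(** The point [h1 e = x + i sg e] may lie outside the disk, but [h2 e = h1 e / (1 + e)] does not,
    and there the closed form equals the series, which is continuous on the closed disk off [1].
    Passing from [h1 e] to [h2 e] costs little: [cut_N] has the same limit along both curves, and
    [J n (1 - t)] is Lipschitz along the ray. *)
Lemma cut_limit (n : nat) (kap x sg : R) : (2 <= n)%nat -> J n 0 <> 0 ->
  is_lim_seq (fun k => cL (qn n) k - 2 * harmonic k) kap ->
  -1 <= x < 0 -> (sg = 1 \/ sg = -1) ->
  filterlim (fun e : R => SLt_closed n kap (cut_pt x sg e)) (at_right 0)
    (@locally C_UniformSpace (- (x * PS (sh (caH (qn n))) x))%C).
Proof.
  intros Hn HB Hk Hx Hsg. assert (Hq := qn_bound n Hn).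
  assert (Hd := dirichlet_caH _ Hq).
  assert (Hxm : Cmod x <= 1) by (rewrite Cmod_R, Rabs_left1; lra).
  assert (Hx1 : RtoC x <> 1) by (intros E; apply RtoC_inj in E; lra).
  destruct (J_ray_Lipschitz n kap x Hn Hk Hx) as [L [HL HLip]].
  set (h1 := cut_pt x sg). set (h2 := fun e : R => (/ (1 + e) * h1 e)%C).
  set (i2 := fun e : R => RtoC (/ (1 + e))).
  set (di2 := fun e : R => RtoC (- / ((1 + e) * (1 + e)))).
  assert (Hloc : locally 0 (fun e => -1 < e < 1)) by (apply locally_interval with (-1) 1; simpl; lra || tauto).
  assert (E2 : forall e, -1 < e -> h2 e = (i2 e * h1 e)%C).
  { intros e He. unfold h2, i2. rewrite RtoC_inv, RtoC_plus by lra. reflexivity. }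
  assert (Hi2 : forall e, -1 < e -> cderive i2 e (di2 e)).
  { intros e He. apply (cderive_RtoC (fun e => / (1 + e))). auto_derive; [lra|]. field. lra. }
  set (h2' := fun e : R => (di2 e * h1 e + i2 e * (0, sg))%C).
  assert (D1 : forall e, cderive h1 e ((fun _ => (0, sg) : C) e)) by (intros e; apply cderive_cut_pt).
  assert (D2 : locally 0 (fun e => cderive h2 e (h2' e))).
  { assert (Hl2 : locally 0 (fun e => locally e (fun e => -1 < e < 1))).
    { apply locally_locally. exact Hloc. }
    generalize (filter_and _ _ Hloc Hl2). apply filter_imp. intros e [He Hle].
    apply cderive_ext_loc with (fun e => i2 e * h1 e)%C.
    - revert Hle; apply filter_imp. intros s Hs. symmetry. apply E2. lra.
    - apply cderive_mult; [apply Hi2; lra|apply D1]. }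
  assert (Ch2' : ccont h2' 0).
  { apply (ccont_plus (fun e => di2 e * h1 e)%C (fun e => i2 e * (0, sg))%C).
    - apply (ccont_mult di2 h1); [|exact (cderive_ccont _ _ _ (D1 0))].
      apply (ccont_RtoC (fun e => - / ((1 + e) * (1 + e)))). apply continuous_of_derivable.
      auto_derive. lra.
    - apply (ccont_mult i2 (fun _ => (0, sg) : C)); [|apply ccont_const].
      exact (cderive_ccont _ _ _ (Hi2 0 ltac:(lra))). }
  assert (h10 : h1 0 = x) by (unfold h1, cut_pt; apply C_eq; simpl; ring).
  assert (h20 : h2 0 = x).
  { rewrite E2, h10 by lra. unfold i2. rewrite Rplus_0_r, Rinv_1. ring. }
  assert (N1 : ccont (fun e => cut_N n kap sg (h1 e)) 0).
  { apply (ccont_cut_N n kap sg h1 (fun _ => (0, sg) : C)).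
    - apply filter_forall. exact D1.
    - apply ccont_const.
    - rewrite h10. simpl. lra. }
  assert (N2 : ccont (fun e => cut_N n kap sg (h2 e)) 0).
  { apply (ccont_cut_N n kap sg h2 h2'); [exact D2|exact Ch2'|]. rewrite h20. simpl. lra. }
  assert (Ch2 := cderive_ccont _ _ _ (locally_singleton _ _ D2)).
  apply filterlim_Cmod; [typeclasses eauto|]. intros e He.
  set (c := sh (caH (qn n))) in *.
  destruct (dirichlet_continuous c x Hd Hxm Hx1 (e / 8) ltac:(lra)) as [d [Hd0 Hdc]].
  set (B := Cmod (PS c x)). assert (HB0 : 0 <= B) by apply Cmod_ge_0.
  assert (He8 : 0 < e / (8 * (B + 1))) by (apply Rdiv_lt_0_compat; lra).
  assert (S1 := locally_at_right _ (ccont_small _ _ (e / 4) N1 ltac:(lra))).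
  assert (S2 := locally_at_right _ (ccont_small _ _ (e / 4) N2 ltac:(lra))).
  assert (S3 := locally_at_right _ (ccont_small _ _ _ Ch2 (Rmin_pos _ _ Hd0 He8))).
  assert (S4 : at_right 0 (fun r => 0 < r < 1 /\ L * r < e / 4)).
  { assert (Hp : 0 < Rmin 1 (e / (4 * (L + 1)))) by (apply Rmin_pos; [lra|apply Rdiv_lt_0_compat; lra]).
    apply locally_interval with (-1) (Rmin 1 (e / (4 * (L + 1)))); simpl; [lra|lra|].
    intros r Hr1 Hr2 Hr3.
    assert (A1 := Rlt_le_trans _ _ _ Hr2 (Rmin_l _ _)). assert (A2 := Rlt_le_trans _ _ _ Hr2 (Rmin_r _ _)).
    split; [lra|].
    apply Rle_lt_trans with (L * (e / (4 * (L + 1)))); [apply Rmult_le_compat_l; lra|].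
    apply Rmult_lt_reg_r with (4 * (L + 1)); [lra|].
    replace (L * (e / (4 * (L + 1))) * (4 * (L + 1))) with (L * e) by (field; lra).
    replace (e / 4 * (4 * (L + 1))) with (e * (L + 1)) by field. nra. }
  generalize (filter_and _ _ (filter_and _ _ S1 S2) (filter_and _ _ S3 S4)). apply filter_imp.
  clear S1 S2 S3 S4. intros r [[S1 S2] [S3 [Hr S4]]].
  rewrite h10 in S1. rewrite h20 in S2, S3.
  set (rho := / (1 + r)).
  assert (Hrho : / 2 <= rho < 1).
  { unfold rho. split; [apply Rinv_le_contravar; lra|].
    rewrite <- Rinv_1. apply Rinv_lt_contravar; lra. }
  assert (Hrho1 : 1 - rho <= r).
  { unfold rho. apply Rmult_le_reg_r with (1 + r); [lra|]. rewrite Rmult_minus_distr_r, Rinv_l by lra. nra. }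
  assert (Eh2 : h2 r = (rho * h1 r)%C) by (apply E2; lra).
  assert (Ht : h1 r = (x, sg * r)) by reflexivity.
  assert (Hsr : sg * r <> 0 /\ -1 <= sg * r <= 1 /\ 0 < sg * (sg * r)).
  { destruct Hsg as [-> | ->]; repeat split; lra. }
  assert (Hw : Cmod (h2 r) <= 1).
  { rewrite Eh2, Cmod_mult, Cmod_R, Rabs_pos_eq by lra.
    assert (Q : Cmod (h1 r) <= 1 + r).
    { apply Rle_trans with (1 := Cmod_le_re_im _). rewrite Ht. simpl.
      rewrite (Rabs_left1 x), Rabs_mult, (Rabs_pos_eq r) by lra.
      assert (Rabs sg = 1).
      { destruct Hsg as [-> | ->]; [apply Rabs_R1|rewrite Rabs_left1; lra]. }
      rewrite H. lra. }
    apply Rle_trans with (rho * (1 + r)); [apply Rmult_le_compat_l; lra|].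
    unfold rho. rewrite Rinv_l; lra. }
  assert (Re1 : Re (h1 r) < 0) by (rewrite Ht; simpl; lra).
  assert (Im1 : 0 < sg * Im (h1 r)) by (rewrite Ht; simpl; lra).
  assert (Re2 : Re (h2 r) < 0).
  { rewrite Eh2. replace (Re (rho * h1 r)) with (rho * Re (h1 r)) by (simpl; unfold Re; ring). nra. }
  assert (Im2 : 0 < sg * Im (h2 r)).
  { rewrite Eh2. replace (sg * Im (rho * h1 r)) with (rho * (sg * Im (h1 r))) by (simpl; unfold Im; ring).
    apply Rmult_lt_0_compat; lra. }
  assert (Hw1 : h2 r <> 1) by (intros E; rewrite E in Re2; simpl in Re2; lra).
  assert (Hws : slit (h2 r)).
  { left. intros E. rewrite E, Rmult_0_r in Im2. lra. }
  assert (C2 := SLt_PS n kap (h2 r) Hn HB Hk Hw Hws Hw1). fold c in C2.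
  rewrite (SLt_closed_cut_N n kap sg (h2 r) Re2 Hsg Im2) in C2.
  rewrite (SLt_closed_cut_N n kap sg (h1 r) Re1 Hsg Im1).
  assert (J1 := HLip (sg * r) rho (proj1 Hsr) (proj1 (proj2 Hsr)) ltac:(lra)).
  rewrite <- Ht, <- Eh2 in J1.
  assert (J2 : Cmod (J n (1 - h1 r) - J n (1 - h2 r)) < e / 4).
  { apply Rle_lt_trans with (1 := J1). apply Rle_lt_trans with (2 := S4). apply Rmult_le_compat_l; lra. }
  set (a1 := cut_N n kap sg (h1 r)) in *. set (a2 := cut_N n kap sg (h2 r)) in *.
  set (a0 := cut_N n kap sg x) in *. set (b1 := J n (1 - h1 r)) in *. set (b2 := J n (1 - h2 r)) in *.
  assert (V : Cmod (h2 r * PS c (h2 r) - x * PS c x) < e / 4).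
  { eapply Rle_lt_trans; [apply Cmod_mult_diff_le; exact Hw|]. fold B.
    assert (T1 := Hdc (h2 r) Hw (Rlt_le_trans _ _ _ S3 (Rmin_l _ _))).
    assert (T2 := Rlt_le_trans _ _ _ S3 (Rmin_r _ _)).
    assert (Cmod (h2 r - x) * B <= e / (8 * (B + 1)) * B) by (apply Rmult_le_compat_r; lra).
    assert (e / (8 * (B + 1)) * B <= e / 8).
    { apply Rmult_le_reg_r with (8 * (B + 1)); [lra|].
      replace (e / (8 * (B + 1)) * B * (8 * (B + 1))) with (e * B) by (field; lra).
      replace (e / 8 * (8 * (B + 1))) with (e * (B + 1)) by field. nra. }
    lra. }
  assert (H2 : RtoC 2 <> 0) by (apply RtoC_neq_0; lra).
  (* Comparison with the closed form at [h2 r], which [C2] identifies with the series; [a0] is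
     inserted as the common limit of the two [cut_N] terms. *)
  replace ((a1 - b1) / 2 - - (x * PS c x))%C
    with (/ 2 * ((a1 - a0) + - (a2 - a0)) + (- (/ 2 * (b1 - b2)) + - (h2 r * PS c (h2 r) - x * PS c x)))%C.
  2: { transitivity (/ 2 * (a1 - a2) - / 2 * (b1 - b2) + (- (h2 r * PS c (h2 r))) + x * PS c x)%C; [ring|].
       rewrite C2. field. }
  assert (Hhalf : Cmod (/ 2) = / 2).
  { rewrite Cmod_inv by exact H2. rewrite Cmod_R, Rabs_pos_eq; lra. }
  eapply Rle_lt_trans; [apply Cmod_triangle|].
  assert (T1 := Cmod_triangle (a1 - a0) (- (a2 - a0))). rewrite Cmod_opp in T1.
  assert (T2 := Cmod_triangle (- (/ 2 * (b1 - b2))) (- (h2 r * PS c (h2 r) - x * PS c x))).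
  rewrite !Cmod_opp in T2. rewrite !Cmod_mult, Hhalf in *. lra.
Qed.

(** * The values [J n 0] *)

Lemma J_0 (n : nat) : (2 <= n)%nat -> J n 0 = RInt (mw n) 0 1.
Proof.
  intros Hn. unfold J.
  rewrite (cint_ext _ (fun u => RtoC (mw n u)) 0 1).
  - apply C_eq; simpl; [reflexivity|].
    change (RInt (fun _ : R => 0) 0 1 = 0). rewrite RInt_const. unfold scal; simpl. unfold mult; simpl. ring.
  - lra.
  - intros u Hu. rewrite kern_real by lra.
    replace (1 - 0 * Xf n u) with 1 by ring. unfold Rpower. rewrite ln_1, Rmult_0_r, exp_0. ring.
Qed.

(** Adding the reflected weight gives a function that is even in [2 u - 1]; for the four values of
    [n] its primitive is a sum of arctangents. *)
Lemma RInt_mw_sym (n : nat) (F : R -> R) :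
  (forall u, 0 <= u <= 1 -> is_derive F u (mw n u + mw n (1 - u))) ->
  2 * RInt (mw n) 0 1 = F 1 - F 0.
Proof.
  intros HF.
  assert (Hc : forall u, 0 <= u <= 1 -> continuous (mw n) u) by (intros; now apply continuous_mw).
  assert (Hc' : forall u, 0 <= u <= 1 -> continuous (fun u => mw n (1 - u)) u).
  { intros u Hu. apply (continuous_comp (fun u => 1 - u) (mw n)).
    - apply continuous_of_derivable. auto_derive. trivial.
    - apply Hc. lra. }
  assert (E1 : ex_RInt (mw n) 0 1).
  { apply (@ex_RInt_continuous R_CompleteNormedModule). rewrite Rmin_left, Rmax_right by lra. exact Hc. }
  assert (E2 : ex_RInt (fun u => mw n (1 - u)) 0 1).
  { apply (@ex_RInt_continuous R_CompleteNormedModule). rewrite Rmin_left, Rmax_right by lra. exact Hc'. }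
  assert (E3 : RInt (fun u => mw n (1 - u)) 0 1 = RInt (mw n) 0 1).
  { assert (E4 : ex_RInt (mw n) (-1 * 0 + 1) (-1 * 1 + 1)).
    { replace (-1 * 0 + 1) with 1 by ring. replace (-1 * 1 + 1) with 0 by ring. now apply ex_RInt_swap. }
    assert (X := RInt_comp_lin (mw n) (-1) 1 0 1 E4).
    replace (-1 * 0 + 1) with 1 in X by ring. replace (-1 * 1 + 1) with 0 in X by ring.
    rewrite <- (opp_RInt_swap (mw n)) in X by exact E1.
    rewrite (RInt_ext _ (fun u => scal (-1) (mw n (1 - u)))) in X.
    2: { intros u _. do 2 f_equal. ring. }
    rewrite (@RInt_scal R_CompleteNormedModule) in X by exact E2.
    change (-1 * RInt (fun u => mw n (1 - u)) 0 1 = - RInt (mw n) 0 1) in X. lra. }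
  assert (I : is_RInt (fun u => mw n u + mw n (1 - u)) 0 1 (F 1 - F 0)).
  { apply (is_RInt_derive F (fun u => mw n u + mw n (1 - u)));
      rewrite Rmin_left, Rmax_right by lra; intros u Hu; [now apply HF|].
    apply continuous_Rplus; auto. }
  apply (@is_RInt_unique R_CompleteNormedModule) in I. rewrite <- I.
  transitivity (RInt (mw n) 0 1 + RInt (fun u => mw n (1 - u)) 0 1); [lra|].
  symmetry. now apply (@RInt_plus R_CompleteNormedModule).
Qed.

Lemma atan_pair (a b : R) : 0 < a -> a * b = 1 -> atan a + atan b = PI / 2.
Proof.
  intros Ha Hab. replace b with (/ a).
  - rewrite atan_inv by exact Ha. ring.
  - apply Rmult_eq_reg_l with a; [rewrite Hab; field; lra|lra].
Qed.

(** With [w = v^2], the left side is the derivative of [atan (a v) + atan (b v)]. Reciprocal slopes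
    produce the palindromic quartic [1 + (c^2 - 2) v^2 + v^4], the form met for [n = 4] and
    [n = 6]. *)
Lemma atan_pair_derive (a b c w : R) : 0 < a -> 0 < b -> a * b = 1 -> a + b = c -> 0 <= w ->
  a / (1 + a * a * w) + b / (1 + b * b * w) = c * (1 + w) / (1 + (c * c - 2) * w + w * w).
Proof.
  intros Ha Hb Hab Hc Hw. subst c.
  assert (E : (1 + a * a * w) * (1 + b * b * w) = 1 + ((a + b) * (a + b) - 2) * w + w * w).
  { transitivity (1 + (a * a + b * b) * w + (a * b) * (a * b) * w * w); [ring|].
    rewrite Hab. replace 2 with (2 * (a * b)) by (rewrite Hab; ring). ring. }
  assert (P1 : 0 < 1 + a * a * w) by (assert (0 <= a * a * w) by (repeat apply Rmult_le_pos; lra); lra).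
  assert (P2 : 0 < 1 + b * b * w) by (assert (0 <= b * b * w) by (repeat apply Rmult_le_pos; lra); lra).
  rewrite <- E.
  apply Rmult_eq_reg_r with ((1 + a * a * w) * (1 + b * b * w)); [|nra].
  field_simplify; [|lra|lra].
  transitivity ((a + b) + (a * b) * (a + b) * w); [ring|]. rewrite Hab. ring.
Qed.

Lemma J2_0 : J 2 0 = PI.
Proof.
  rewrite J_0 by lia. f_equal.
  assert (H := RInt_mw_sym 2 (fun u => 4 * atan (2 * u - 1))).
  assert (E : 2 * RInt (mw 2) 0 1 = 4 * atan (2 * 1 - 1) - 4 * atan (2 * 0 - 1)).
  { apply H. intros u Hu. auto_derive; [trivial|]. unfold mw, Qd. simpl. field.
    repeat split; nra. }
  replace (2 * 1 - 1) with 1 in E by ring. replace (2 * 0 - 1) with (- (1)) in E by ring.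
  rewrite atan_opp, atan_1 in E. lra.
Qed.

Lemma J3_0 : J 3 0 = 2 * PI / sqrt 3.
Proof.
  rewrite J_0 by lia. f_equal.
  assert (S3 : sqrt 3 * sqrt 3 = 3) by (apply sqrt_sqrt; lra).
  assert (P3 : 0 < sqrt 3) by (apply sqrt_lt_R0; lra).
  assert (H := RInt_mw_sym 3 (fun u => 2 * sqrt 3 * atan (sqrt 3 * (2 * u - 1)))).
  assert (E : 2 * RInt (mw 3) 0 1 = 2 * sqrt 3 * atan (sqrt 3 * (2 * 1 - 1)) - 2 * sqrt 3 * atan (sqrt 3 * (2 * 0 - 1))).
  { apply H. intros u Hu. auto_derive; [trivial|]. unfold mw, Qd.
    set (r := sqrt 3) in *.
    transitivity (2 * (r * r) * 2 / (1 + (r * r) * ((2 * u - 1) * (2 * u - 1)))).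
    - assert (Hsq := Rle_0_sqr (r * (2 * u - 1))). unfold Rsqr in Hsq. field. repeat split; lra.
    - rewrite S3. assert (HQ := Qd_pos 3 u Hu). unfold Qd in HQ. simpl in *.
      assert (Hsq := Rle_0_sqr (2 * u - 1)). unfold Rsqr in Hsq. field. repeat split; lra. }
  replace (sqrt 3 * (2 * 1 - 1)) with (sqrt 3) in E by ring.
  replace (sqrt 3 * (2 * 0 - 1)) with (- sqrt 3) in E by ring.
  assert (EA : atan (sqrt 3) = PI / 3).
  { rewrite <- tan_PI3. apply atan_tan. assert (P := PI_RGT_0). lra. }
  rewrite atan_opp, EA in E.
  apply Rmult_eq_reg_r with (2 * sqrt 3); [|lra].
  replace (2 * PI / sqrt 3 * (2 * sqrt 3)) with (4 * PI) by (field; lra).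
  replace (RInt (mw 3) 0 1 * (2 * sqrt 3)) with (2 * RInt (mw 3) 0 1 * sqrt 3) by ring.
  rewrite E. transitivity (4 / 3 * PI * (sqrt 3 * sqrt 3)); [field|]. rewrite S3. field.
Qed.

Lemma J4_0 : J 4 0 = 2 * PI / sqrt 2.
Proof.
  rewrite J_0 by lia. f_equal.
  assert (S2 : sqrt 2 * sqrt 2 = 2) by (apply sqrt_sqrt; lra).
  assert (P2 : 1 < sqrt 2) by (rewrite <- sqrt_1; apply sqrt_lt_1; lra).
  (* These slopes are reciprocal with sum [c = 2 sqrt 2], and [c^2 - 2 = 6] is the coefficient in
     [8 (u^4 + (1 - u)^4) = 1 + 6 w + w^2], where [w = (2 u - 1)^2]. *)
  set (r := sqrt 2) in *. set (a := r + 1). set (b := r - 1).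
  assert (Ha : 0 < a) by (unfold a; lra). assert (Hb : 0 < b) by (unfold b; lra).
  assert (Hab : a * b = 1) by (unfold a, b; lra).
  set (F := fun u => 2 * r * (atan (a * (2 * u - 1)) + atan (b * (2 * u - 1)))).
  assert (E : 2 * RInt (mw 4) 0 1 = F 1 - F 0).
  { apply (RInt_mw_sym 4 F). intros u Hu. unfold F. auto_derive; [trivial|]. unfold mw, Qd.
    set (w := (2 * u - 1) * (2 * u - 1)). assert (Hw : 0 <= w) by apply Rle_0_sqr.
    assert (X := atan_pair_derive a b (2 * r) w Ha Hb Hab ltac:(unfold a, b; ring) Hw).
    transitivity (4 * r * (a / (1 + a * a * w) + b / (1 + b * b * w))).
    - assert (Q1 := Rle_0_sqr (a * (2 * u - 1))). assert (Q2 := Rle_0_sqr (b * (2 * u - 1))).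
      assert (Q3 := Rle_0_sqr (2 * u - 1)). unfold Rsqr in *.
      clearbody a b. unfold w. field. repeat split; lra.
    - rewrite X. replace (2 * r * (2 * r)) with 8 by nra.
      transitivity (8 * (r * r) * (1 + w) / (1 + (8 - 2) * w + w * w)).
      { unfold Rdiv. ring. }
      rewrite S2.
      assert (HQ : u ^ 4 + (1 - u) ^ 4 = (1 + 6 * w + w * w) / 8) by (unfold w; field).
      replace (1 - (1 - u)) with u by ring.
      replace ((1 - u) ^ 4 + u ^ 4) with (u ^ 4 + (1 - u) ^ 4) by ring.
      assert (HN : u ^ (4 - 2) + (1 - u) ^ (4 - 2) = (1 + w) / 2) by (unfold w; simpl; field).
      assert (P0 : 0 < 1 + 6 * w + w * w) by nra.
      transitivity (INR 4 * (u ^ (4 - 2) + (1 - u) ^ (4 - 2)) / (u ^ 4 + (1 - u) ^ 4)).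
      + rewrite HQ, HN. clearbody w. simpl INR. field. lra.
      + rewrite HQ. clearbody w. field. lra. }
  assert (G := atan_pair a b Ha Hab).
  unfold F in E.
  replace (a * (2 * 1 - 1)) with a in E by ring. replace (a * (2 * 0 - 1)) with (- a) in E by ring.
  replace (b * (2 * 1 - 1)) with b in E by ring. replace (b * (2 * 0 - 1)) with (- b) in E by ring.
  rewrite !atan_opp in E.
  replace (2 * r * (atan a + atan b) - 2 * r * (- atan a + - atan b)) with (4 * r * (atan a + atan b)) in E by ring.
  rewrite G in E. apply Rmult_eq_reg_r with (2 * r); [|lra].
  replace (2 * PI / r * (2 * r)) with (4 * PI) by (field; lra).
  replace (RInt (mw 4) 0 1 * (2 * r)) with (2 * RInt (mw 4) 0 1 * r) by ring.
  rewrite E. transitivity (2 * PI * (r * r)); [field|]. rewrite S2. ring.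
Qed.

Lemma J6_0 : J 6 0 = 2 * PI.
Proof.
  rewrite J_0 by lia. f_equal.
  assert (S3 : sqrt 3 * sqrt 3 = 3) by (apply sqrt_sqrt; lra).
  assert (P3 : 0 < sqrt 3 < 2).
  { split; [apply sqrt_lt_R0; lra|]. rewrite <- (sqrt_square 2) by lra. apply sqrt_lt_1; lra. }
  (* Here the sum of the slopes is [4], and [4^2 - 2 = 14] appears in [32 (u^6 + (1 - u)^6) = (1 +
     w) (1 + 14 w + w^2)]; the factor [1 + w] accounts for the third arctangent. *)
  set (r := sqrt 3) in *. set (a := 2 + r). set (b := 2 - r).
  assert (Ha : 0 < a) by (unfold a; lra). assert (Hb : 0 < b) by (unfold b; lra).
  assert (Hab : a * b = 1) by (unfold a, b; lra).
  set (F := fun u => 4 * atan (2 * u - 1) + 2 * (atan (a * (2 * u - 1)) + atan (b * (2 * u - 1)))).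
  assert (E : 2 * RInt (mw 6) 0 1 = F 1 - F 0).
  { apply (RInt_mw_sym 6 F). intros u Hu. unfold F. auto_derive; [repeat split|]. unfold mw, Qd.
    set (w := (2 * u - 1) * (2 * u - 1)). assert (Hw : 0 <= w) by apply Rle_0_sqr.
    assert (X := atan_pair_derive a b 4 w Ha Hb Hab ltac:(unfold a, b; ring) Hw).
    transitivity (8 / (1 + w) + 4 * (a / (1 + a * a * w) + b / (1 + b * b * w))).
    - assert (Q1 := Rle_0_sqr (a * (2 * u - 1))). assert (Q2 := Rle_0_sqr (b * (2 * u - 1))).
      assert (Q3 := Rle_0_sqr (2 * u - 1)). unfold Rsqr in *.
      clearbody a b. unfold w. field. repeat split; lra.
    - rewrite X. replace (4 * 4 - 2) with 14 by ring.
      assert (HQ : u ^ 6 + (1 - u) ^ 6 = (1 + w) * (1 + 14 * w + w * w) / 32) by (unfold w; field).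
      replace (1 - (1 - u)) with u by ring.
      replace ((1 - u) ^ 6 + u ^ 6) with (u ^ 6 + (1 - u) ^ 6) by ring.
      assert (HN : u ^ (6 - 2) + (1 - u) ^ (6 - 2) = (1 + 6 * w + w * w) / 8) by (unfold w; simpl; field).
      assert (P0 : 0 < 1 + 14 * w + w * w) by nra.
      transitivity (INR 6 * (u ^ (6 - 2) + (1 - u) ^ (6 - 2)) / (u ^ 6 + (1 - u) ^ 6)).
      + rewrite HQ, HN. clearbody w. simpl INR. field. split; lra.
      + rewrite HQ. clearbody w. field. split; lra. }
  assert (G := atan_pair a b Ha Hab).
  unfold F in E.
  replace (a * (2 * 1 - 1)) with a in E by ring. replace (a * (2 * 0 - 1)) with (- a) in E by ring.
  replace (b * (2 * 1 - 1)) with b in E by ring. replace (b * (2 * 0 - 1)) with (- b) in E by ring.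
  replace (2 * 1 - 1) with 1 in E by ring. replace (2 * 0 - 1) with (- (1)) in E by ring.
  rewrite !atan_opp, atan_1 in E. lra.
Qed.

(** * Harmonic numbers and binomial products for the four degrees *)

Lemma harmonic_diff_lim (m : nat) : (1 <= m)%nat ->
  is_lim_seq (fun k => harmonic (m * k) - harmonic k) (ln (INR m)).
Proof.
  intros Hm. set (u := fun k => harmonic (S k) - ln (INR (S k))).
  assert (Hln : forall x, 0 < x -> / (x + 1) <= ln (x + 1) - ln x <= / x).
  { intros x Hx.
    assert (U : forall y, 0 < y -> ln y <= y - 1).
    { intros y Hy. assert (X := exp_ineq1_le (ln y)). rewrite exp_ln in X by exact Hy. lra. }
    assert (U1 := U ((x + 1) / x) ltac:(apply Rdiv_lt_0_compat; lra)).
    assert (U2 := U (x / (x + 1)) ltac:(apply Rdiv_lt_0_compat; lra)).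
    rewrite ln_div in U1, U2 by lra.
    replace ((x + 1) / x - 1) with (/ x) in U1 by (field; lra).
    replace (x / (x + 1) - 1) with (- / (x + 1)) in U2 by (field; lra). lra. }
  assert (Hpos : forall k, 0 < INR (S k)) by (intros k; apply lt_0_INR; lia).
  assert (Hu : ex_finite_lim_seq u).
  { apply ex_finite_lim_seq_decr with 0.
    - intros k. unfold u. rewrite (harmonic_S (S k)), (S_INR (S k)).
      assert (X := Hln _ (Hpos k)). lra.
    - intros k. unfold u. induction k as [|k IH].
      + rewrite harmonic_1. simpl. rewrite ln_1. lra.
      + assert (L : forall k, ln (INR (S k)) <= harmonic k).
        { intros j. induction j as [|j IHj]; [rewrite harmonic_0; simpl; rewrite ln_1; lra|].
          rewrite harmonic_S, (S_INR (S j)). assert (X := Hln _ (Hpos j)).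
          rewrite (S_INR j) in *. lra. }
        specialize (L (S k)). rewrite (harmonic_S (S k)).
        assert (0 < / INR (S (S k))) by (apply Rinv_0_lt_compat, Hpos). lra. }
  (* The limit [gam] is Euler's constant; it cancels in the difference. *)
  destruct Hu as [gam Hgam].
  apply is_lim_seq_incr_1.
  (* Term [k] of [u] belongs to the harmonic number of index [k + 1], hence [m k + m - 1] for the
     index [m (k + 1)]. *)
  apply is_lim_seq_ext with (fun k => u (m * k + m - 1)%nat - u k + ln (INR m)).
  - intros k. unfold u. replace (S (m * k + m - 1)) with (m * S k)%nat by lia.
    rewrite mult_INR, ln_mult by (apply lt_0_INR; lia). ring.
  - replace (Finite (ln (INR m))) with (Finite (gam - gam + ln (INR m))) by (f_equal; ring).
    apply is_lim_seq_plus'; [|apply is_lim_seq_const].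
    apply is_lim_seq_minus'; [|exact Hgam].
    apply (is_lim_seq_subseq u gam (fun k => (m * k + m - 1)%nat)); [|exact Hgam].
    apply eventually_subseq. intros k. nia.
Qed.

Definition kappa_lim (n : nat) (kap : R) : Prop :=
  is_lim_seq (fun k => cL (qn n) k - 2 * harmonic k) kap.

Lemma qn_2 : qn 2 = / 4. Proof. unfold qn. simpl. field. Qed.
Lemma qn_3 : qn 3 = 2 / 9. Proof. unfold qn. simpl. field. Qed.
Lemma qn_4 : qn 4 = 3 / 16. Proof. unfold qn. simpl. field. Qed.
Lemma qn_6 : qn 6 = 5 / 36. Proof. unfold qn. simpl. field. Qed.

(** The summands of [cL] are [n / (n j + 1)] and [n / (n j + n - 1)]. In each of these four lemmas
    the harmonic combination keeps exactly these residues modulo [n]; for [n = 6] it is inclusion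
    and exclusion of the multiples of 2 and 3. *)
Lemma cL_2 (k : nat) : cL (qn 2) k = 4 * harmonic (2 * k) - 2 * harmonic k.
Proof.
  rewrite qn_2. induction k as [|k IH]; [simpl; rewrite harmonic_0; ring|].
  cbn [cL]. rewrite IH. replace (2 * S k)%nat with (S (S (2 * k))) by lia.
  rewrite !harmonic_S, !S_INR, mult_INR. simpl (INR 2). assert (H := pos_INR k).
  field. repeat split; nra.
Qed.

Lemma cL_3 (k : nat) : cL (qn 3) k = 3 * harmonic (3 * k) - harmonic k.
Proof.
  rewrite qn_3. induction k as [|k IH]; [simpl; rewrite harmonic_0; ring|].
  cbn [cL]. rewrite IH. replace (3 * S k)%nat with (S (S (S (3 * k)))) by lia.
  rewrite !harmonic_S, !S_INR, mult_INR. simpl (INR 3). assert (H := pos_INR k).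
  field. repeat split; nra.
Qed.

Lemma cL_4 (k : nat) : cL (qn 4) k = 2 * (2 * harmonic (4 * k) - harmonic (2 * k)).
Proof.
  rewrite qn_4. induction k as [|k IH]; [simpl; rewrite harmonic_0; ring|].
  cbn [cL]. rewrite IH. replace (4 * S k)%nat with (S (S (S (S (4 * k))))) by lia.
  replace (2 * S k)%nat with (S (S (2 * k))) by lia.
  rewrite !harmonic_S, !S_INR, !mult_INR. simpl (INR 2). simpl (INR 4). assert (H := pos_INR k).
  field. repeat split; nra.
Qed.

Lemma cL_6 (k : nat) : cL (qn 6) k =
  6 * harmonic (6 * k) - 3 * harmonic (3 * k) - 2 * harmonic (2 * k) + harmonic k.
Proof.
  rewrite qn_6. induction k as [|k IH]; [simpl; rewrite harmonic_0; ring|].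
  cbn [cL]. rewrite IH. replace (6 * S k)%nat with (S (S (S (S (S (S (6 * k))))))) by lia.
  replace (3 * S k)%nat with (S (S (S (3 * k)))) by lia.
  replace (2 * S k)%nat with (S (S (2 * k))) by lia.
  rewrite !harmonic_S, !S_INR, !mult_INR. simpl (INR 2). simpl (INR 3). simpl (INR 6).
  assert (H := pos_INR k). field. repeat split; nra.
Qed.

Lemma INR_fact_S (m : nat) : INR (fact (S m)) = (INR m + 1) * INR (fact m).
Proof. change (fact (S m)) with (S m * fact m)%nat. now rewrite mult_INR, S_INR. Qed.

Lemma INR_fact_pos (m : nat) : 0 < INR (fact m).
Proof. apply lt_0_INR, lt_O_fact. Qed.

Lemma binom_fact (a b : nat) : binom (a + b) b = INR (fact (a + b)) / (INR (fact b) * INR (fact a)).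
Proof. unfold binom, Binomial.C. now rewrite Nat.add_sub. Qed.

(** By comparison of consecutive ratios. The base [16] normalises the series and, by [kappa_2], is
    also [exp kappa]; the same coincidence for the other degrees puts these constants into the
    logarithms of part (b). *)
Lemma ca_2 (k : nat) : binom (2 * k) k * binom (2 * k) k = ca (qn 2) k * 16 ^ k.
Proof.
  replace (2 * k)%nat with (k + k)%nat by lia. rewrite binom_fact.
  replace (k + k)%nat with (2 * k)%nat by lia.
  rewrite qn_2. induction k as [|k IH]; [simpl; field|].
  cbn [ca pow]. replace (2 * S k)%nat with (S (S (2 * k))) by lia.
  rewrite !INR_fact_S, !S_INR, mult_INR. simpl (INR 2).
  assert (H := pos_INR k). assert (F1 := INR_fact_pos k). assert (F2 := INR_fact_pos (2 * k)).
  set (x := INR k) in *. set (f := INR (fact k)) in *. set (g := INR (fact (2 * k))) in *.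
  replace (ca (/ 4) k * (x * x + x + / 4) / ((x + 1) * (x + 1)) * (16 * 16 ^ k))
    with (ca (/ 4) k * 16 ^ k * (16 * (x * x + x + / 4) / ((x + 1) * (x + 1)))) by (field; lra).
  rewrite <- IH. field. repeat split; nra.
Qed.

Lemma ca_3 (k : nat) : binom (2 * k) k * binom (3 * k) k = ca (qn 3) k * 27 ^ k.
Proof.
  replace (2 * k)%nat with (k + k)%nat by lia. replace (3 * k)%nat with (2 * k + k)%nat by lia.
  rewrite !binom_fact.
  replace (2 * k + k)%nat with (3 * k)%nat by lia. replace (k + k)%nat with (2 * k)%nat by lia.
  rewrite qn_3. induction k as [|k IH]; [simpl; field|].
  cbn [ca pow]. replace (2 * S k)%nat with (S (S (2 * k))) by lia.
  replace (3 * S k)%nat with (S (S (S (3 * k)))) by lia.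
  rewrite !INR_fact_S, !S_INR, !mult_INR. simpl (INR 2). simpl (INR 3).
  assert (H := pos_INR k). assert (F1 := INR_fact_pos k). assert (F2 := INR_fact_pos (2 * k)).
  assert (F3 := INR_fact_pos (3 * k)).
  set (x := INR k) in *. set (f := INR (fact k)) in *. set (g := INR (fact (2 * k))) in *.
  set (h := INR (fact (3 * k))) in *.
  replace (ca (2 / 9) k * (x * x + x + 2 / 9) / ((x + 1) * (x + 1)) * (27 * 27 ^ k))
    with (ca (2 / 9) k * 27 ^ k * (27 * (x * x + x + 2 / 9) / ((x + 1) * (x + 1)))) by (field; lra).
  rewrite <- IH. field. repeat split; nra.
Qed.

Lemma ca_4 (k : nat) : binom (2 * k) k * binom (4 * k) (2 * k) = ca (qn 4) k * 64 ^ k.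
Proof.
  replace (4 * k)%nat with (2 * k + 2 * k)%nat by lia. rewrite binom_fact.
  replace (2 * k + 2 * k)%nat with (4 * k)%nat by lia.
  replace (binom (2 * k) k) with (binom (k + k) k) by (f_equal; lia). rewrite binom_fact.
  replace (k + k)%nat with (2 * k)%nat by lia.
  rewrite qn_4. induction k as [|k IH]; [simpl; field|].
  cbn [ca pow]. replace (2 * S k)%nat with (S (S (2 * k))) by lia.
  replace (4 * S k)%nat with (S (S (S (S (4 * k))))) by lia.
  rewrite !INR_fact_S, !S_INR, !mult_INR. simpl (INR 2). simpl (INR 4).
  assert (H := pos_INR k). assert (F1 := INR_fact_pos k). assert (F2 := INR_fact_pos (2 * k)).
  assert (F3 := INR_fact_pos (4 * k)).
  set (x := INR k) in *. set (f := INR (fact k)) in *. set (g := INR (fact (2 * k))) in *.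
  set (h := INR (fact (4 * k))) in *.
  replace (ca (3 / 16) k * (x * x + x + 3 / 16) / ((x + 1) * (x + 1)) * (64 * 64 ^ k))
    with (ca (3 / 16) k * 64 ^ k * (64 * (x * x + x + 3 / 16) / ((x + 1) * (x + 1)))) by (field; lra).
  rewrite <- IH. field. repeat split; nra.
Qed.

Lemma ca_6 (k : nat) : binom (3 * k) k * binom (6 * k) (3 * k) = ca (qn 6) k * 432 ^ k.
Proof.
  replace (6 * k)%nat with (3 * k + 3 * k)%nat by lia. rewrite binom_fact.
  replace (3 * k + 3 * k)%nat with (6 * k)%nat by lia.
  replace (binom (3 * k) k) with (binom (2 * k + k) k) by (f_equal; lia). rewrite binom_fact.
  replace (2 * k + k)%nat with (3 * k)%nat by lia.
  rewrite qn_6. induction k as [|k IH]; [simpl; field|].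
  cbn [ca pow]. replace (2 * S k)%nat with (S (S (2 * k))) by lia.
  replace (3 * S k)%nat with (S (S (S (3 * k)))) by lia.
  replace (6 * S k)%nat with (S (S (S (S (S (S (6 * k))))))) by lia.
  rewrite !INR_fact_S, !S_INR, !mult_INR. simpl (INR 2). simpl (INR 3). simpl (INR 6).
  assert (H := pos_INR k). assert (F1 := INR_fact_pos k). assert (F2 := INR_fact_pos (2 * k)).
  assert (F3 := INR_fact_pos (3 * k)). assert (F4 := INR_fact_pos (6 * k)).
  set (x := INR k) in *. set (f := INR (fact k)) in *. set (g := INR (fact (2 * k))) in *.
  set (h := INR (fact (3 * k))) in *. set (l := INR (fact (6 * k))) in *.
  replace (ca (5 / 36) k * (x * x + x + 5 / 36) / ((x + 1) * (x + 1)) * (432 * 432 ^ k))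
    with (ca (5 / 36) k * 432 ^ k * (432 * (x * x + x + 5 / 36) / ((x + 1) * (x + 1)))) by (field; lra).
  rewrite <- IH. field. repeat split; nra.
Qed.

Lemma kappa_2 : kappa_lim 2 (ln 16).
Proof.
  apply is_lim_seq_ext with (fun k => 4 * (harmonic (2 * k) - harmonic k)).
  - intros k. rewrite cL_2. ring.
  - replace (ln 16) with (4 * ln (INR 2)).
    + apply (is_lim_seq_scal_l _ 4 (Finite _)). apply harmonic_diff_lim. lia.
    + replace (INR 2) with 2 by (simpl; ring). replace 16 with (2 ^ 4) by ring. rewrite ln_pow by lra. simpl. ring.
Qed.

Lemma kappa_3 : kappa_lim 3 (ln 27).
Proof.
  apply is_lim_seq_ext with (fun k => 3 * (harmonic (3 * k) - harmonic k)).
  - intros k. rewrite cL_3. ring.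
  - replace (ln 27) with (3 * ln (INR 3)).
    + apply (is_lim_seq_scal_l _ 3 (Finite _)). apply harmonic_diff_lim. lia.
    + replace (INR 3) with 3 by (simpl; ring). replace 27 with (3 ^ 3) by ring.
      rewrite ln_pow by lra. simpl. ring.
Qed.

Lemma kappa_4 : kappa_lim 4 (ln 64).
Proof.
  apply is_lim_seq_ext with
    (fun k => 4 * (harmonic (4 * k) - harmonic k) - 2 * (harmonic (2 * k) - harmonic k)).
  - intros k. rewrite cL_4. ring.
  - replace (ln 64) with (4 * ln (INR 4) - 2 * ln (INR 2)).
    + apply is_lim_seq_minus'.
      * apply (is_lim_seq_scal_l _ 4 (Finite _)). apply harmonic_diff_lim. lia.
      * apply (is_lim_seq_scal_l _ 2 (Finite _)). apply harmonic_diff_lim. lia.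
    + replace 64 with (2 ^ 6) by ring. replace (INR 4) with (2 ^ 2) by (simpl; ring).
      replace (INR 2) with 2 by (simpl; ring).
      rewrite !ln_pow by lra. simpl. ring.
Qed.

Lemma kappa_6 : kappa_lim 6 (ln 432).
Proof.
  apply is_lim_seq_ext with (fun k => 6 * (harmonic (6 * k) - harmonic k)
    - 3 * (harmonic (3 * k) - harmonic k) - 2 * (harmonic (2 * k) - harmonic k)).
  - intros k. rewrite cL_6. ring.
  - replace (ln 432) with (6 * ln (INR 6) - 3 * ln (INR 3) - 2 * ln (INR 2)).
    + apply (is_lim_seq_minus' (fun k => 6 * (harmonic (6 * k) - harmonic k)
        - 3 * (harmonic (3 * k) - harmonic k))); [apply is_lim_seq_minus'|].
      * apply (is_lim_seq_scal_l _ 6 (Finite _)). apply harmonic_diff_lim. lia.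
      * apply (is_lim_seq_scal_l _ 3 (Finite _)). apply harmonic_diff_lim. lia.
      * apply (is_lim_seq_scal_l _ 2 (Finite _)). apply harmonic_diff_lim. lia.
    + replace 432 with (2 ^ 4 * 3 ^ 3) by ring. replace (INR 6) with (2 * 3) by (simpl; ring).
      replace (INR 3) with 3 by (simpl; ring). replace (INR 2) with 2 by (simpl; ring).
      rewrite !ln_mult, !ln_pow by (try apply pow_lt; lra). simpl. ring.
Qed.

(** * Back to the Legendre functions *)

Lemma legendreP_J (n : nat) (nu : R) (t : C) : (2 <= n)%nat -> nu = - / INR n ->
  slit (1 - t) -> legendreP nu (1 - 2 * t) = ((sin (PI / INR n) / PI)%R * J n t)%C.
Proof.
  intros Hn -> Hs. unfold legendreP.
  replace ((1 - (1 - 2 * t)) / 2)%C with t.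
  - rewrite legendre_integral_J by assumption.
    replace (- / INR n * PI) with (- (PI / INR n)) by (unfold Rdiv; ring).
    rewrite sin_neg. rewrite <- RtoC_opp. do 2 f_equal. unfold Rdiv. ring.
  - field.
Qed.

Lemma legendreP_J' (n : nat) (nu : R) (t : C) : (2 <= n)%nat -> nu = - / INR n ->
  slit t -> legendreP nu (2 * t - 1) = ((sin (PI / INR n) / PI)%R * J n (1 - t))%C.
Proof.
  intros Hn Hnu Hs. replace (2 * t - 1)%C with (1 - 2 * (1 - t))%C by ring.
  apply legendreP_J; trivial. replace (1 - (1 - t))%C with t by ring. exact Hs.
Qed.

(** Off the real axis [t] and [1 - t] lie in opposite half planes, so the difference of their
    arguments is known only to be less than [2 PI] in modulus. The imaginary part of [(1 - t) / t]
    is [- Im t / |t|^2], and its sign excludes the values beyond [PI]. *)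
Lemma Clog_quotient (c : R) (t : C) : 0 < c -> t <> 0 -> t <> 1 ->
  (Im t <> 0 \/ (Im t = 0 /\ 0 < Re t < 1)) ->
  Clog (c * ((1 - t) / t)) = (ln c + Clog (1 - t) - Clog t)%C.
Proof.
  intros Hc H0 H1 HI.
  assert (H1' : (1 - t)%C <> 0) by (apply Cmod_gt_0; now apply one_minus_neq_0').
  assert (Hq : ((1 - t) / t)%C <> 0).
  { intros E. apply H1'. replace (1 - t)%C with ((1 - t) / t * t)%C by (field; exact H0). rewrite E. ring. }
  rewrite Clog_scal by assumption.
  assert (St : slit t) by (destruct HI as [H|[_ H]]; [now left|right; lra]).
  assert (EI : Im (1 - t) = - Im t) by (simpl; unfold Im; ring).
  assert (ER : Re (1 - t) = 1 - Re t) by (simpl; unfold Re; ring).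
  assert (St1 : slit (1 - t)).
  { destruct HI as [H|[_ H]]; [left; rewrite EI; lra|right; rewrite ER; lra]. }
  assert (EX : Cexp (Clog (1 - t) - Clog t) = ((1 - t) / t)%C).
  { assert (M : (Cexp (Clog (1 - t) - Clog t) * t)%C = (1 - t)%C).
    { transitivity (Cexp (Clog (1 - t) - Clog t) * Cexp (Clog t))%C;
        [now rewrite (Cexp_Clog t H0)|]. rewrite <- Cexp_plus.
      replace (Clog (1 - t) - Clog t + Clog t)%C with (Clog (1 - t)) by ring. now apply Cexp_Clog. }
    transitivity (Cexp (Clog (1 - t) - Clog t) * t / t)%C; [field; exact H0|now rewrite M]. }
  rewrite (Clog_unique (Clog (1 - t) - Clog t) _ EX); [ring|].
  replace (Im (Clog (1 - t) - Clog t)) with (Carg (1 - t) - Carg t) by (simpl; ring).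
  assert (B1 := Carg_slit_bound _ St). assert (B2 := Carg_slit_bound _ St1).
  assert (G1 := Carg_sign _ St). assert (G2 := Carg_sign _ St1). rewrite EI in G2.
  assert (P := PI_RGT_0).
  destruct (Req_dec (Im t) 0) as [E|E].
  { assert (Carg t = 0) by now apply G1. assert (Carg (1 - t) = 0) by (apply G2; lra). lra. }
  assert (HS : Im ((1 - t) / t) = exp (Re (Clog (1 - t) - Clog t)) * sin (Carg (1 - t) - Carg t)).
  { rewrite <- EX. unfold Cexp. simpl. do 2 f_equal. }
  assert (HT : Im ((1 - t) / t) = - Im t / (Re t ^ 2 + Im t ^ 2)).
  { assert (N := norm2_pos t H0). destruct t as [a b]. simpl in *. field. nra. }
  assert (N := norm2_pos t H0). rewrite HT in HS.
  set (X := exp _) in HS. assert (PX : 0 < X) by apply exp_pos.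
  assert (HS' : - Im t = (Re t ^ 2 + Im t ^ 2) * X * sin (Carg (1 - t) - Carg t)).
  { apply Rmult_eq_reg_r with (/ (Re t ^ 2 + Im t ^ 2)); [|apply Rinv_neq_0_compat; lra].
    fold (- Im t / (Re t ^ 2 + Im t ^ 2)). rewrite HS. field. lra. }
  assert (PY : 0 < (Re t ^ 2 + Im t ^ 2) * X) by now apply Rmult_lt_0_compat.
  set (Y := (Re t ^ 2 + Im t ^ 2) * X) in *. set (d := Carg (1 - t) - Carg t) in *.
  destruct (Rlt_dec 0 (Im t)) as [L|L].
  - assert (0 < Carg t) by now apply G1. assert (Carg (1 - t) < 0) by (apply G2; lra).
    split; [|unfold d; lra]. apply Rnot_le_lt. intros D.
    assert (S : 0 <= sin (d + 2 * PI)) by (apply sin_ge_0; unfold d in *; lra).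
    rewrite sin_plus, cos_2PI, sin_2PI in S. nra.
  - assert (Carg t < 0) by (apply G1; lra). assert (0 < Carg (1 - t)) by (apply G2; lra).
    split; [unfold d; lra|]. apply Rnot_le_lt. intros D.
    assert (S : 0 <= sin (2 * PI - d)) by (apply sin_ge_0; unfold d in *; lra).
    rewrite sin_minus, cos_2PI, sin_2PI in S. nra.
Qed.

Lemma coef_term (b a c : R) (t : C) (k : nat) : c <> 0 -> b = a * c ^ k ->
  (b * (t / c) ^ k = a * t ^ k)%C.
Proof.
  intros Hc ->. unfold Cdiv. rewrite Cpow_mult_l, Cpow_inv by now apply RtoC_neq_0.
  rewrite RtoC_mult, RtoC_pow. field. apply Cpow_nz. now apply RtoC_neq_0.
Qed.

Lemma is_sum_from1_ext (a b : nat -> C) (s : C) : (forall k, a k = b k) ->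
  is_sum_from1 a s -> is_sum_from1 b s.
Proof.
  intros H. unfold is_sum_from1. apply (@is_series_ext C_AbsRing C_NormedModule).
  intros k. apply H.
Qed.

Lemma is_sum_from1_scal (x : C) (a : nat -> C) (s : C) :
  is_sum_from1 a s -> is_sum_from1 (fun k => x * a k)%C (x * s)%C.
Proof. intros H. exact (@is_series_scal C_AbsRing C_NormedModule x _ s H). Qed.

Lemma slit_unit_disk (t : C) : Cmod t <= 1 -> (forall x : R, -1 <= x <= 0 -> t <> x) -> slit t.
Proof.
  intros H Hx. destruct (Req_dec (Im t) 0) as [E|E]; [right|now left].
  apply Rnot_le_lt. intros L. apply (Hx (Re t)).
  - assert (R := re_le_Cmod t). apply Rabs_le_between in R. lra.
  - apply C_eq; [reflexivity|exact E].
Qed.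

Lemma in_lens (t : C) : Cmod t <= 1 -> slit t -> t <> 1 ->
  Im t <> 0 \/ (Im t = 0 /\ 0 < Re t < 1).
Proof.
  intros H Hs H1. destruct (Req_dec (Im t) 0) as [E|E]; [right|now left].
  split; [exact E|]. destruct Hs as [Hs|Hs]; [contradiction|]. split; [exact Hs|].
  assert (R := re_le_Cmod t). apply Rabs_le_between in R.
  assert (Re t <> 1) by (intros F; apply H1; apply C_eq; simpl; assumption). lra.
Qed.

(** * The statements for one degree *)

Section instance.
Context (n : nat) (nu kap C0 D0 : R) (series : C -> C -> Prop) (rhs : C -> C)
  (Hn : (2 <= n)%nat) (Hnu : nu = - / INR n) (HC : 0 < C0) (Hk : kappa_lim n (ln C0))
  (HD : D0 <> 0) (HJ : J n 0 = RtoC (2 * PI / D0)) (Hsin : sin (PI / INR n) = D0 / 2)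
  (Hseries : forall t s : C, is_sum_from1 (fun k => caH (qn n) k * t ^ k)%C s -> series t (- s)%C)
  (Hrhs : forall t : C, t <> 0 -> rhs t = (- (PI * legendreP nu (2 * t - 1) / D0)
     + legendreP nu (1 - 2 * t) / 2 * Clog (C0 * ((1 - t) / t)))%C).

Lemma J0_neq_0 : J n 0 <> 0.
Proof.
  rewrite HJ. apply RtoC_neq_0. assert (P := PI_RGT_0).
  intros E. assert (2 * PI = 0) by (replace (2 * PI) with (2 * PI / D0 * D0) by (field; exact HD); rewrite E; ring).
  lra.
Qed.

(** The normalisation [P = 1] at [t = 0]: since [D0 = 2 sin (pi / n)] and [J n 0 = 2 pi / D0], the
    prefactor of [legendreP] is exactly [1 / J n 0]. The same [D0] is the denominator of the first
    term of [rhs]. *)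
Lemma legendre_norm (z : C) : ((sin (PI / INR n) / PI)%R * z)%C = (z / J n 0)%C.
Proof.
  assert (P := PI_RGT_0).
  rewrite HJ, Hsin. replace (D0 / 2 / PI) with (/ (2 * PI / D0)).
  - rewrite RtoC_inv.
    + unfold Cdiv. ring.
    + intros E. apply J0_neq_0. rewrite HJ, E. reflexivity.
  - field. split; lra.
Qed.

Lemma rhs_closed (t : C) : slit t -> slit (1 - t) -> t <> 1 ->
  (Im t <> 0 \/ (Im t = 0 /\ 0 < Re t < 1)) ->
  rhs t = SLt_closed n (ln C0) t.
Proof.
  intros H1 H2 H3 H4. assert (H0 := slit_neq_0 _ H1). assert (P := PI_RGT_0).
  assert (P' : RtoC PI <> 0) by (apply RtoC_neq_0; lra).
  assert (D' : RtoC D0 <> 0) by now apply RtoC_neq_0.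
  assert (T' : RtoC 2 <> 0) by (apply RtoC_neq_0; lra).
  assert (J' := J0_neq_0).
  rewrite Hrhs by exact H0.
  rewrite (legendreP_J n nu t Hn Hnu H2), (legendreP_J' n nu t Hn Hnu H1), !legendre_norm.
  rewrite Clog_quotient by assumption.
  unfold SLt_closed.
  assert (E : forall z : C, (PI * (z / J n 0) / D0)%C = (z / 2)%C).
  { intros z. rewrite HJ, RtoC_div, RtoC_mult by exact HD. field. repeat split; assumption. }
  rewrite E. field. assumption.
Qed.

Lemma instance_disk (t : C) : Cmod t <= 1 ->
  (forall x : R, -1 <= x <= 0 -> t <> x) -> t <> 1 -> series t (rhs t).
Proof.
  intros Ht Hcut H1. assert (Hs := slit_unit_disk t Ht Hcut). assert (Hq := qn_bound n Hn).
  rewrite rhs_closed; trivial.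
  - rewrite <- (SLt_PS n (ln C0) t Hn J0_neq_0 Hk Ht Hs H1). apply Hseries.
    apply is_sum_from1_PS; trivial. now apply dirichlet_caH.
  - now apply slit_one_minus.
  - now apply in_lens.
Qed.

Lemma instance_cut (x : R) : -1 <= x < 0 -> is_limit_on_cut series rhs x.
Proof.
  intros Hx. assert (Hq := qn_bound n Hn).
  assert (Hxm : Cmod x <= 1) by (rewrite Cmod_R, Rabs_left1; lra).
  assert (Hx1 : RtoC x <> 1) by (intros E; apply RtoC_inj in E; lra).
  exists (- (x * PS (sh (caH (qn n))) x))%C. split.
  { apply Hseries. apply is_sum_from1_PS; trivial. now apply dirichlet_caH. }
  assert (Hpos : at_right 0 (fun e => 0 < e)).
  { apply locally_interval with (-1) 1; simpl; intros; lra. }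
  assert (A : forall sg, (sg = 1 \/ sg = -1) -> forall e, 0 < e ->
    rhs (cut_pt x sg e) = SLt_closed n (ln C0) (cut_pt x sg e)).
  { intros sg Hsg e He. assert (I : Im (cut_pt x sg e) <> 0).
    { simpl. destruct Hsg as [-> | ->]; lra. }
    apply rhs_closed.
    - now left.
    - left. simpl. simpl in I. lra.
    - intros E. rewrite E in I. simpl in I. lra.
    - now left. }
  split.
  - eapply filterlim_ext_loc; [|apply (cut_limit n (ln C0) x 1 Hn J0_neq_0 Hk Hx); now left].
    revert Hpos; apply filter_imp. intros e He. rewrite <- A by (trivial; now left). f_equal.
    apply C_eq; simpl; ring.
  - eapply filterlim_ext_loc; [|apply (cut_limit n (ln C0) x (-1) Hn J0_neq_0 Hk Hx); now right].
    revert Hpos; apply filter_imp. intros e He. rewrite <- A by (trivial; now right). f_equal.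
    apply C_eq; simpl; ring.
Qed.

Lemma instance_SL (t : C) : Cmod t <= 1 -> t <> 1 ->
  is_sum_from1 (fun k => caL (qn n) k * t ^ k)%C (- legendreP nu (1 - 2 * t) * Clog (1 - t))%C.
Proof.
  intros Ht H1. assert (Hs := slit_one_minus t Ht H1).
  rewrite (legendreP_J n nu t Hn Hnu Hs), legendre_norm.
  exact (main_SL n t Hn J0_neq_0 Ht H1).
Qed.

End instance.

(** * Translation of the four series and closed forms *)

Lemma RtoC_2_4 : (2 ^ 4)%C = 16.
Proof. rewrite <- RtoC_pow. f_equal. ring. Qed.
Lemma RtoC_3_3 : (3 ^ 3)%C = 27.
Proof. rewrite <- RtoC_pow. f_equal. ring. Qed.
Lemma RtoC_2_6 : (2 ^ 6)%C = 64.
Proof. rewrite <- RtoC_pow. f_equal. ring. Qed.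
Lemma RtoC_2_4_3_3 : (2 ^ 4 * 3 ^ 3)%C = 432.
Proof. rewrite RtoC_2_4, RtoC_3_3, <- RtoC_mult. f_equal. ring. Qed.

Lemma term_2 (t : C) (k : nat) :
  ((binom (2 * k) k)%R ^ 2 * (t / 2 ^ 4) ^ k = ca (qn 2) k * t ^ k)%C.
Proof.
  rewrite RtoC_2_4, <- RtoC_pow. apply coef_term; [lra|]. rewrite <- ca_2. ring.
Qed.

Lemma term_3 (t : C) (k : nat) :
  (binom (2 * k) k * binom (3 * k) k * (t / 3 ^ 3) ^ k = ca (qn 3) k * t ^ k)%C.
Proof.
  rewrite RtoC_3_3, <- RtoC_mult. apply coef_term; [lra|]. apply ca_3.
Qed.

Lemma term_4 (t : C) (k : nat) :
  (binom (2 * k) k * binom (4 * k) (2 * k) * (t / 2 ^ 6) ^ k = ca (qn 4) k * t ^ k)%C.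
Proof.
  rewrite RtoC_2_6, <- RtoC_mult. apply coef_term; [lra|]. apply ca_4.
Qed.

Lemma term_6 (t : C) (k : nat) :
  (binom (3 * k) k * binom (6 * k) (3 * k) * (t / (2 ^ 4 * 3 ^ 3)) ^ k = ca (qn 6) k * t ^ k)%C.
Proof.
  rewrite RtoC_2_4_3_3, <- RtoC_mult. apply coef_term; [lra|]. apply ca_6.
Qed.

Lemma is_SLt_2_of (t s : C) :
  is_sum_from1 (fun k => caH (qn 2) k * t ^ k)%C s -> is_SLt_2 t (- s)%C.
Proof.
  intros H. exists s. split; [|reflexivity]. revert H. apply is_sum_from1_ext. intros k.
  rewrite term_2. unfold caH. rewrite RtoC_mult. ring.
Qed.

Lemma is_SLt_3_of (t s : C) :
  is_sum_from1 (fun k => caH (qn 3) k * t ^ k)%C s -> is_SLt_3 t (- s)%C.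
Proof.
  intros H. exists s. split; [|reflexivity]. revert H. apply is_sum_from1_ext. intros k.
  rewrite term_3. unfold caH. rewrite RtoC_mult. ring.
Qed.

Lemma is_SLt_4_of (t s : C) :
  is_sum_from1 (fun k => caH (qn 4) k * t ^ k)%C s -> is_SLt_4 t (- s)%C.
Proof.
  intros H. exists s. split; [|reflexivity]. revert H. apply is_sum_from1_ext. intros k.
  rewrite term_4. unfold caH. rewrite RtoC_mult. ring.
Qed.

Lemma is_SLt_6_of (t s : C) :
  is_sum_from1 (fun k => caH (qn 6) k * t ^ k)%C s -> is_SLt_6 t (- s)%C.
Proof.
  intros H. exists s. split; [|reflexivity]. revert H. apply is_sum_from1_ext. intros k.
  rewrite term_6. unfold caH. rewrite RtoC_mult. ring.
Qed.

Lemma is_SL_2_of (t s : C) : is_sum_from1 (fun k => caL (qn 2) k * t ^ k)%C s -> is_SL_2 t s.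
Proof.
  intros H. exists (/ 2 * s)%C. split.
  - apply is_sum_from1_scal with (x := (/ 2)%C) in H. revert H. apply is_sum_from1_ext. intros k.
    rewrite term_2. unfold caL. rewrite cL_2, RtoC_mult.
    replace (4 * harmonic (2 * k) - 2 * harmonic k) with (2 * (2 * harmonic (2 * k) - harmonic k)) by ring.
    rewrite RtoC_mult. field.
  - field.
Qed.

Lemma is_SL_3_of (t s : C) : is_sum_from1 (fun k => caL (qn 3) k * t ^ k)%C s -> is_SL_3 t s.
Proof.
  apply is_sum_from1_ext. intros k. rewrite term_3. unfold caL. rewrite cL_3, RtoC_mult. ring.
Qed.

Lemma is_SL_4_of (t s : C) : is_sum_from1 (fun k => caL (qn 4) k * t ^ k)%C s -> is_SL_4 t s.
Proof.
  intros H. exists (/ 2 * s)%C. split.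
  - apply is_sum_from1_scal with (x := (/ 2)%C) in H. revert H. apply is_sum_from1_ext. intros k.
    rewrite term_4. unfold caL. rewrite cL_4, !RtoC_mult. field.
  - field.
Qed.

Lemma is_SL_6_of (t s : C) : is_sum_from1 (fun k => caL (qn 6) k * t ^ k)%C s -> is_SL_6 t s.
Proof.
  apply is_sum_from1_ext. intros k. rewrite term_6. unfold caL. rewrite cL_6, RtoC_mult. ring.
Qed.

Lemma SLt_rhs_2_eq (t : C) : t <> 0 ->
  SLt_rhs_2 t = (- (PI * legendreP (- / 2) (2 * t - 1) / 2%R)
     + legendreP (- / 2) (1 - 2 * t) / 2 * Clog (16%R * ((1 - t) / t)))%C.
Proof.
  intros H. unfold SLt_rhs_2. rewrite RtoC_2_4. do 3 f_equal. unfold Cdiv. ring.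
Qed.

Lemma SLt_rhs_3_eq (t : C) : t <> 0 ->
  SLt_rhs_3 t = (- (PI * legendreP (- / 3) (2 * t - 1) / sqrt 3)
     + legendreP (- / 3) (1 - 2 * t) / 2 * Clog (27%R * ((1 - t) / t)))%C.
Proof.
  intros H. unfold SLt_rhs_3. rewrite RtoC_3_3. do 3 f_equal. unfold Cdiv. ring.
Qed.

Lemma SLt_rhs_4_eq (t : C) : t <> 0 ->
  SLt_rhs_4 t = (- (PI * legendreP (- / 4) (2 * t - 1) / sqrt 2)
     + legendreP (- / 4) (1 - 2 * t) / 2 * Clog (64%R * ((1 - t) / t)))%C.
Proof.
  intros H. unfold SLt_rhs_4. rewrite RtoC_2_6. do 3 f_equal. unfold Cdiv. ring.
Qed.

Lemma SLt_rhs_6_eq (t : C) : t <> 0 ->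
  SLt_rhs_6 t = (- (PI * legendreP (- / 6) (2 * t - 1) / 1%R)
     + legendreP (- / 6) (1 - 2 * t) / 2 * Clog (432%R * ((1 - t) / t)))%C.
Proof.
  intros H. unfold SLt_rhs_6. rewrite RtoC_2_4_3_3. f_equal.
  - field.
  - do 2 f_equal. unfold Cdiv. ring.
Qed.

Lemma INR_lit_2 : INR 2 = 2. Proof. simpl; ring. Qed.
Lemma INR_lit_3 : INR 3 = 3. Proof. simpl; ring. Qed.
Lemma INR_lit_4 : INR 4 = 4. Proof. simpl; ring. Qed.
Lemma INR_lit_6 : INR 6 = 6. Proof. simpl; ring. Qed.

Lemma nu_2 : - / 2 = - / INR 2. Proof. now rewrite INR_lit_2. Qed.
Lemma nu_3 : - / 3 = - / INR 3. Proof. now rewrite INR_lit_3. Qed.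
Lemma nu_4 : - / 4 = - / INR 4. Proof. now rewrite INR_lit_4. Qed.
Lemma nu_6 : - / 6 = - / INR 6. Proof. now rewrite INR_lit_6. Qed.

Lemma J_0_2 : J 2 0 = RtoC (2 * PI / 2).
Proof. rewrite J2_0. f_equal. field. Qed.
Lemma J_0_6 : J 6 0 = RtoC (2 * PI / 1).
Proof. rewrite J6_0. f_equal. field. Qed.

Lemma sin_2 : sin (PI / INR 2) = 2 / 2.
Proof. rewrite INR_lit_2, sin_PI2. field. Qed.
Lemma sin_3 : sin (PI / INR 3) = sqrt 3 / 2.
Proof. rewrite INR_lit_3. apply sin_PI3. Qed.
Lemma sin_4 : sin (PI / INR 4) = sqrt 2 / 2.
Proof.
  rewrite INR_lit_4, sin_PI4.
  assert (H : sqrt 2 * sqrt 2 = 2) by (apply sqrt_sqrt; lra).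
  assert (P : 0 < sqrt 2) by (apply sqrt_lt_R0; lra).
  apply Rmult_eq_reg_r with (2 * sqrt 2); [|lra]. field_simplify; [|lra]. 
  replace (sqrt 2 ^ 2) with 2 by (simpl; lra). field.
Qed.
Lemma sin_6 : sin (PI / INR 6) = 1 / 2.
Proof. rewrite INR_lit_6. apply sin_PI6. Qed.

Lemma sqrt_neq_0 (x : R) : 0 < x -> sqrt x <> 0.
Proof. intros H. now apply Rgt_not_eq, sqrt_lt_R0. Qed.

Theorem theorem2p1 :
  (forall t : C, Cmod t <= 1 -> t <> 1 ->
      is_SL_2 t (- legendreP (- / 2) (1 - 2 * t) * Clog (1 - t))%C
   /\ is_SL_3 t (- legendreP (- / 3) (1 - 2 * t) * Clog (1 - t))%C
   /\ is_SL_4 t (- legendreP (- / 4) (1 - 2 * t) * Clog (1 - t))%C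
   /\ is_SL_6 t (- legendreP (- / 6) (1 - 2 * t) * Clog (1 - t))%C)
  /\
  (forall t : C, Cmod t <= 1 ->
   (forall x : R, -1 <= x <= 0 -> t <> x) -> t <> 1 ->
      is_SLt_2 t (SLt_rhs_2 t)
   /\ is_SLt_3 t (SLt_rhs_3 t)
   /\ is_SLt_4 t (SLt_rhs_4 t)
   /\ is_SLt_6 t (SLt_rhs_6 t))
  /\
  (forall x : R, -1 <= x < 0 ->
      is_limit_on_cut is_SLt_2 SLt_rhs_2 x
   /\ is_limit_on_cut is_SLt_3 SLt_rhs_3 x
   /\ is_limit_on_cut is_SLt_4 SLt_rhs_4 x
   /\ is_limit_on_cut is_SLt_6 SLt_rhs_6 x).
Proof.
  assert (N2 : (2 <= 2)%nat) by lia. assert (N3 : (2 <= 3)%nat) by lia.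
  assert (N4 : (2 <= 4)%nat) by lia. assert (N6 : (2 <= 6)%nat) by lia.
  assert (D2 : 2 <> 0) by lra. assert (D3 := sqrt_neq_0 3 ltac:(lra)).
  assert (D4 := sqrt_neq_0 2 ltac:(lra)). assert (D6 : 1 <> 0) by lra.
  split; [|split].
  - intros t Ht H1. split; [|split; [|split]].
    + apply is_SL_2_of.
      exact (instance_SL 2 _ 2 N2 nu_2 D2 J_0_2 sin_2 t Ht H1).
    + apply is_SL_3_of.
      exact (instance_SL 3 _ _ N3 nu_3 D3 J3_0 sin_3 t Ht H1).
    + apply is_SL_4_of.
      exact (instance_SL 4 _ _ N4 nu_4 D4 J4_0 sin_4 t Ht H1).
    + apply is_SL_6_of.
      exact (instance_SL 6 _ 1 N6 nu_6 D6 J_0_6 sin_6 t Ht H1).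
  - intros t Ht Hc H1. split; [|split; [|split]].
    + exact (instance_disk 2 _ 16 2 _ _ N2 nu_2 ltac:(lra) kappa_2 D2 J_0_2 sin_2
        is_SLt_2_of SLt_rhs_2_eq t Ht Hc H1).
    + exact (instance_disk 3 _ 27 _ _ _ N3 nu_3 ltac:(lra) kappa_3 D3 J3_0 sin_3
        is_SLt_3_of SLt_rhs_3_eq t Ht Hc H1).
    + exact (instance_disk 4 _ 64 _ _ _ N4 nu_4 ltac:(lra) kappa_4 D4 J4_0 sin_4
        is_SLt_4_of SLt_rhs_4_eq t Ht Hc H1).
    + exact (instance_disk 6 _ 432 1 _ _ N6 nu_6 ltac:(lra) kappa_6 D6 J_0_6 sin_6
        is_SLt_6_of SLt_rhs_6_eq t Ht Hc H1).
  - intros x Hx. split; [|split; [|split]].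
    + exact (instance_cut 2 _ 16 2 _ _ N2 nu_2 ltac:(lra) kappa_2 D2 J_0_2 sin_2
        is_SLt_2_of SLt_rhs_2_eq x Hx).
    + exact (instance_cut 3 _ 27 _ _ _ N3 nu_3 ltac:(lra) kappa_3 D3 J3_0 sin_3
        is_SLt_3_of SLt_rhs_3_eq x Hx).
    + exact (instance_cut 4 _ 64 _ _ _ N4 nu_4 ltac:(lra) kappa_4 D4 J4_0 sin_4
        is_SLt_4_of SLt_rhs_4_eq x Hx).
    + exact (instance_cut 6 _ 432 1 _ _ N6 nu_6 ltac:(lra) kappa_6 D6 J_0_6 sin_6
        is_SLt_6_of SLt_rhs_6_eq x Hx).
Qed.
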